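(* The hyperspaces $\mathcal S_P(\mathbb R^2)$ and $\mathcal K_P$ are $\sigma$-compact, strongly countable-dimensional absolute neighborhood retracts.
   Context: For a space $X$, $C(X)$ denotes the hyperspace of all nonempty continua (compact connected subsets) in $X$ with the Vietoris topology, whose basic open sets are $\langle U_1,\dots,U_n\rangle=\{C\in C(X): C\subset\bigcup_{k=1}^n U_k \text{ and } U_k\cap C\neq\emptyset \text{ for all } k\}$, with $n\in\mathbb N$ and $U_k$ open in $X$ (equivalently, for $X=\mathbb R^n$, the topology of the Hausdorff distance). $\mathcal S_P(\mathbb R^2)\subset C(\mathbb R^2)$ is the hyperspace of simple closed polygons in $\mathbb R^2$ (simple closed curves, i.e. homeomorphic copies of the circle, that are finite unions of straight line segments). $\mathcal K_P\subset C(\mathbb R^3)$ is the hyperspace of polygonal knots (simple closed curves in $\mathbb R^3$ that are finite unions of straight line segments). Both carry the subspace topology. A space is strongly countable-dimensional if it is a countable union of closed finite-dimensional subspaces. Absolute neighborhood retract (ANR) is understood in the class of metrizable spaces. *)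

(* Defs.v *)
From HB Require Import structures.
From mathcomp Require Import all_boot all_order all_algebra.
From mathcomp Require Import all_classical all_reals all_analysis.

Set Implicit Arguments.
Unset Strict Implicit.
Unset Printing Implicit Defensive.

Import Order.TTheory GRing.Theory Num.Theory.
Import numFieldNormedType.Exports.

Local Open Scope classical_set_scope.
Local Open Scope ring_scope.

Definition continuum (X : topologicalType) (C : set X) : Prop :=
  [/\ C !=set0, compact C & connected C].

Definition hyperspace (X : topologicalType) : Type :=
  set_type [set C : set X | continuum C].

HB.instance Definition _ (X : topologicalType) := Choice.on (hyperspace X).

Definition hset (X : topologicalType) (C : hyperspace X) : set X := val C.

(* <U_0, ..., U_(n-1)>; only the first n terms of the sequence U matter. *)
Definition vietoris_base (X : topologicalType) (nU : nat * (nat -> set X)) :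
    set (hyperspace X) :=
  [set C | hset C `<=` \bigcup_(k < nU.1) nU.2 k /\
           forall k, (k < nU.1)%N -> nU.2 k `&` hset C !=set0].

Definition vietoris_index (X : topologicalType) :
    set (nat * (nat -> set X)) :=
  [set nU | (0 < nU.1)%N /\ forall k, (k < nU.1)%N -> open (nU.2 k)].

Lemma vietoris_base_cover (X : topologicalType) :
  \bigcup_(nU in @vietoris_index X) @vietoris_base X nU = setT.
Proof.
apply/seteqP; split=> // C _; exists (1%N, fun=> setT).
  by split=> // k _; exact: openT.
split=> [x _|k _]; first by exists 0%N.
have [[x Cx] _ _] := set_mem (valP C).
by exists x.
Qed.

Lemma vietoris_base_join (X : topologicalType)
    (i j : nat * (nat -> set X)) (C : hyperspace X) :
  vietoris_index i -> vietoris_index j ->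
  vietoris_base i C -> vietoris_base j C ->
  exists k, [/\ vietoris_index k, vietoris_base k C &
                vietoris_base k `<=` vietoris_base i `&` vietoris_base j].
Proof.
case: i j => [m U] [n V] [/= m0 oU] [/= n0 oV] [/= CU UC] [/= CV VC].
pose A := \bigcup_(k < m) U k; pose B := \bigcup_(k < n) V k.
have oA : open A by apply: bigcup_open => k /= km; exact: oU.
have oB : open B by apply: bigcup_open => k /= kn; exact: oV.
pose W k := if (k < m)%N then U k `&` B else V (k - m)%N `&` A.
exists ((m + n)%N, W); split.
- split=> /= [|k kmn]; first by rewrite addn_gt0 m0.
  rewrite /W; case: ltnP => km; apply: openI => //; first exact: oU.
  by apply: oV; rewrite ltn_subLR.
- split=> /= [x Cx|k kmn].
    have [k /= km Ux] := CU x Cx; exists k => /=; first exact: ltn_addr.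
    by rewrite /W km; split => //; exact: CV.
  rewrite /W; case: ltnP => km.
    have [x [Ux Cx]] := UC k km; exists x; split => //; split => //.
    exact: CV.
  have [|x [Vx Cx]] := VC (k - m)%N; first by rewrite ltn_subLR.
  by exists x; split => //; split => //; exact: CU.
- move=> D [/= DW WD]; split; split=> /=.
  + move=> x /DW[k /= _]; rewrite /W; case: ltnP => km [].
      by move=> Ux _; exists k.
    by [].
  + move=> k km; have [|x] := WD k; first exact: ltn_addr.
    by rewrite /W km => -[[Ux _] Dx]; exists x.
  + move=> x /DW[k /= kmn]; rewrite /W; case: ltnP => km [].
      by [].
    by move=> Vx _; exists (k - m)%N => //=; rewrite ltn_subLR.
  + move=> k kn; have [|x] := WD (m + k)%N; first by rewrite ltn_add2l.
    by rewrite /W ltnNge leq_addr /= addKn => -[[Vx _] Dx]; exists x.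
Qed.

HB.instance Definition _ (X : topologicalType) :=
  isBaseTopological.Build (hyperspace X)
    (@vietoris_base_cover X) (@vietoris_base_join X).

Definition homeomorphic (S T : topologicalType) : Prop :=
  exists (f : S -> T) (g : T -> S),
    [/\ continuous f, continuous g, cancel f g & cancel g f].

Section Polygons.
Variable R : realType.

Definition circle : set 'rV[R]_2 :=
  [set v : 'rV[R]_2 | v ord0 ord0 ^+ 2 + v ord0 ord_max ^+ 2 = 1].

Definition simple_closed_curve (X : topologicalType) (C : set X) : Prop :=
  homeomorphic circle C.

Definition segment (n : nat) (a b : 'rV[R]_n) : set 'rV[R]_n :=
  [set (1 - t) *: a + t *: b | t in `[0, 1]].

Definition polygonal (n : nat) (C : set 'rV[R]_n) : Prop :=
  exists (m : nat) (a b : 'I_m -> 'rV[R]_n),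
    (forall i, a i != b i) /\ C = \bigcup_i segment (a i) (b i).

Definition polygonal_curves (n : nat) : set (hyperspace 'rV[R]_n) :=
  [set C | simple_closed_curve (hset C) /\ polygonal (hset C)].

End Polygons.

Definition simple_closed_polygons (R : realType) : set (hyperspace 'rV[R]_2) :=
  @polygonal_curves R 2.

Definition polygonal_knots (R : realType) : set (hyperspace 'rV[R]_3) :=
  @polygonal_curves R 3.

Arguments simple_closed_polygons : clear implicits.
Arguments polygonal_knots : clear implicits.

Definition sigma_compact (X : topologicalType) : Prop :=
  exists F : nat -> set X,
    (forall n, compact (F n)) /\ \bigcup_n F n = setT.

Definition open_cover (X : topologicalType) (U : set (set X)) : Prop :=
  U `<=` open /\ \bigcup_(A in U) A = setT.

(* Covering dimension at most n; the empty space has dimension at most 0. *)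
Definition covering_dim_le (X : topologicalType) (n : nat) : Prop :=
  forall U : set (set X), finite_set U -> open_cover U ->
  exists V : set (set X),
    [/\ finite_set V, open_cover V,
        forall B, V B -> exists2 A, U A & B `<=` A
      & forall x, ([set B | V B /\ B x] #<= `I_n.+1)%card].

Definition finite_dimensional (X : topologicalType) : Prop :=
  exists n : nat, covering_dim_le X n.

Definition strongly_countable_dimensional (X : topologicalType) : Prop :=
  exists F : nat -> set X,
    [/\ forall n, closed (F n),
        forall n, finite_dimensional (F n)
      & \bigcup_n F n = setT].

(* All real types are isomorphic, so the choice of R is immaterial. *)
Definition metrizable (R : realType) (X : topologicalType) : Prop :=
  exists M : metricType R, homeomorphic X M.

Definition neighborhood_retract (Y : topologicalType) (A : set Y) : Prop :=
  exists N : set Y, [/\ open N, A `<=` N &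
    exists r : Y -> Y,
      [/\ {within N, continuous r}, r @` N `<=` A & {in A, r =1 id}]].

Definition absolute_neighborhood_retract (R : realType) (X : topologicalType) :
    Prop :=
  metrizable R X /\
  forall (Y : metricType R) (A : set Y),
    closed A -> homeomorphic X A -> neighborhood_retract A.

(* Main.v *)
(* Let X be the space of polygonal simple closed curves in R^n.

   X is a countable union of compact sets, each an injective image of a
   compact set in a Euclidean space: fix the number of vertices, a bound d
   from below for the simplicity of the polygon and for the angles at its
   corners, and rational points d/4-close to the vertices.  The curve determines
   its corners, as the points where it is not straight, and the rational points
   tell them apart.

   X is locally contractible.  Let P be a polygon, surround its edges by thin
   convex cells, adjacent cells meeting in the level set of a functional through
   the common corner, and let theta_k be a coordinate on the k-th cell that runs
   from 0 to 1 along the edge.  A continuum Q close to P meets the cells in such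
   a way that theta_k maps Q onto [0, 1] up to a single short gap.  Collapsing
   the gap gives a map of the k-th cell onto the k-th edge, and moving the points
   of Q straight to their images is a homotopy from Q to P.  It is injective
   before time 1 and takes its values in finitely many lines at each time, so
   that Q stays in X.

   A locally contractible X of this kind, embedded as a closed subset of a metric
   space Y, is a retract of a neighbourhood, by an argument of Haver.  Each
   compact piece is a union of small images of cubes in finitely many colours,
   cubes of one colour being disjoint.  Contracting near all cubes of one
   colour at once, then colour after colour, gives an operator T_y on X close to
   the identity which is constant for y near the piece.  The infinite composition of
   these operators, one for each piece, depends near X on y only, and it is
   the retraction. *)

From HB Require Import structures.
Require Import Defs.
From mathcomp Require Import all_boot all_order all_algebra.
From mathcomp Require Import all_classical all_reals all_analysis.
From mathcomp Require Import lra ring zify.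

Set Implicit Arguments.
Unset Strict Implicit.
Unset Printing Implicit Defensive.

Import Order.TTheory GRing.Theory Num.Theory.
Import numFieldNormedType.Exports.

Local Open Scope classical_set_scope.
Local Open Scope ring_scope.

(** * Neighbourhood retractions from local contractibility *)

(** A curve Q near P need not wind around P: it may be a thin loop that follows most of P and turns
    back. Hence part of an edge can be missed, and no parametrization of Q by P is at hand. The gap
    enters only through the length of the longest interval that Q leaves free, a number that varies
    continuously with Q, whereas the place of a closing gap may jump. Connectedness of Q excludes a
    second gap in a cell. At time 1 injectivity is lost, but there the image is the set P itself.
    Before that, injectivity comes from the coordinate on a cell being monotone in the direction of
    the edge.

    In the retraction every colour costs a loss of tolerance that is fixed in advance. The number of
    colours must therefore not depend on the mesh, and this is where the finite dimension of the
    pieces enters. The constants of all layers are chosen before any cutoff function, since the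
    cutoff of a layer is adapted to the neighbourhoods treated by the later layers. *)

Section MetricFacts.
Context {R : realType} {Y : metricType R}.
Implicit Types (x y z : Y) (A B : set Y).

Lemma mdist_nbhs (y : Y) (r : R) : 0 < r -> \forall z \near y, mdist y z < r.
Proof.
by move=> r0; have := nbhsx_ballx y r r0; rewrite ballEmdist.
Qed.

Lemma nbhs_mdist_ex (y : Y) (P : set Y) : nbhs y P ->
  exists2 r : R, 0 < r & forall z, mdist y z < r -> P z.
Proof.
by move/nbhs_ballP => [r /= r0 rP]; exists r => // z yz; apply: rP; rewrite ballEmdist.
Qed.

Lemma nbhs_mdistl (T : topologicalType) (f : T -> Y) (t : T) (r : R) :
  {for t, continuous f} -> 0 < r -> \forall u \near t, mdist (f t) (f u) < r.
Proof. by move=> ft r0; exact: (ft _ (mdist_nbhs (f t) r0)). Qed.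

Lemma cvg_mdist (T : topologicalType) (f : T -> Y) (t : T) :
  (forall r : R, 0 < r -> \forall u \near t, mdist (f t) (f u) < r) ->
  {for t, continuous f}.
Proof.
move=> H P /nbhs_mdist_ex[r r0 rP]; apply: filterS (H r r0) => u.
exact: rP.
Qed.

Definition infdist B y : R := inf [set mdist y b | b in B].

Lemma infdist_le B y b : B b -> infdist B y <= mdist y b.
Proof.
move=> Bb; apply: ge_inf; last by exists b.
by exists 0 => _ [c _ <-]; exact: mdist_ge0.
Qed.

Lemma infdist_lt B y (r : R) : B !=set0 -> infdist B y < r ->
  exists2 b, B b & mdist y b < r.
Proof.
move=> [b Bb] /(@inf_lt R) []; first by exists (mdist y b), b.
by move=> _ [c Bc <-] cr; exists c.
Qed.

Lemma infdist_lip B y z : B !=set0 -> infdist B y <= infdist B z + mdist y z.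
Proof.
move=> B0; apply/ler_addgt0Pl => e e0.
have [|b Bb zb] := @infdist_lt B z (infdist B z + e) B0; first by rewrite ltrDl.
have := metric_triangle y z b; have := infdist_le y Bb; lra.
Qed.

Lemma infdist_continuous B : B !=set0 -> continuous (infdist B).
Proof.
move=> B0 y; apply/cvgrPdist_lt => e e0; near=> z.
have yz : mdist y z < e by near: z; exact: mdist_nbhs.
have := infdist_lip y z B0; have := infdist_lip z y B0.
rewrite (metric_sym z y) => ? ?.
by rewrite ltr_norml; apply/andP; split; lra.
Unshelve. all: by end_near. Qed.

Lemma compact_disjoint_dist A B : compact A -> compact B -> A `&` B = set0 ->
  \forall r \near (0 : R)^'+, forall a b, A a -> B b -> r <= mdist a b.
Proof.
move=> cA cB AB0.
have cAB := compact_setX cA cB.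
have /compact_near_coveringP/(_ R (0 : R)^'+
  (fun r (ab : Y * Y) => r <= mdist ab.1 ab.2) _) := cAB.
move=> H; apply: filterS (H _).
  by move=> r rP a b Aa Bb; exact: (rP (a, b)).
move=> [a b] [/= Aa Bb].
have ab : a != b.
  by apply/eqP => ab; rewrite -ab in Bb; have : (A `&` B) a by []; rewrite AB0.
have d0 : 0 < mdist a b by rewrite mdist_gt0.
exists ([set ab' : Y * Y | mdist a ab'.1 < mdist a b / 4 /\
    mdist b ab'.2 < mdist a b / 4], [set r | r <= mdist a b / 4]) => /=.
  split; last by apply: nbhs_right_le; lra.
  exists (ball a (mdist a b / 4), ball b (mdist a b / 4)).
    by split; apply: nbhsx_ballx; lra.
  by rewrite !ballEmdist.
move=> [[a' b'] r] [[/= aa bb] rr] /=.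
have := metric_triangle a a' b; have := metric_triangle a' b' b.
rewrite (metric_sym b' b); lra.
Qed.

End MetricFacts.

(** * Operators on X that depend on a point of the ambient space *)

Section Operators.
Context {R : realType} {X : topologicalType} {Y : metricType R} (phi : X -> Y).
Implicit Types (T : Y -> X -> X) (V : set Y) (b : R).

(** The end value [z] is required for every [x], also outside [W]: an operator that has run to time
    1 is then constant on all of [X]. *)
Definition contracts_in (W U : set X) (c : X -> R -> X) (z : X) :=
  [/\ open W, forall x, W x -> c x 0 = x, forall x, c x 1 = z,
      forall x s, W x -> U (c x s)
    & forall x s, W x -> {for (x, s), continuous (fun p => c p.1 p.2)}].

(** A tolerance budget: points [b']-near [y] may be moved but stay [b]-near [y]. Continuity is asked
    at these points only, as a contraction is continuous only on its domain. *)
Definition op_good T b b' := forall y x, mdist (phi x) y < b' ->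
  mdist (phi (T y x)) y < b /\ {for (y, x), continuous (fun p => T p.1 p.2)}.

(** Constancy in all [x], even far from [y], survives any operator applied before ([op_on_compl]);
    the bound on [t] lets it survive a good operator applied after ([op_on_compr]). *)
Definition op_on T V b := open V /\ exists t : Y -> X, forall y, V y ->
  [/\ forall x, T y x = t y, mdist (phi (t y)) y < b & {for y, continuous t}].

Lemma op_good_id b b' : b' <= b -> op_good (fun _ x => x) b b'.
Proof.
move=> b'b y x yx; split; first exact: lt_le_trans b'b.
exact: cvg_snd.
Qed.

Lemma continuous_pair_at (A B C : topologicalType) (f : A -> B) (g : A -> C) a :
  {for a, continuous f} -> {for a, continuous g} ->
  {for a, continuous (fun x => (f x, g x))}.
Proof. by move=> fa ga; exact: (@cvg_pair _ _ _ _ (nbhs (f a)) (nbhs (g a))). Qed.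

Lemma op_good_comp T1 T2 b0 b1 b2 : op_good T1 b0 b1 -> op_good T2 b1 b2 ->
  op_good (fun y x => T1 y (T2 y x)) b0 b2.
Proof.
move=> g1 g2 y x yx; have [d2 c2] := g2 _ _ yx; have [d1 c1] := g1 _ _ d2.
split=> //.
pose h := fun p : Y * X => (p.1, T2 p.1 p.2).
apply: (@continuous_comp _ _ _ h (fun p => T1 p.1 p.2)); last exact: c1.
by apply: continuous_pair_at => //; exact: cvg_fst.
Qed.

Lemma op_on_compr T1 T2 V b0 b1 : op_good T1 b0 b1 -> op_on T2 V b1 ->
  op_on (fun y x => T1 y (T2 y x)) V b0.
Proof.
move=> g1 [oV [t tP]]; split=> //; exists (fun y => T1 y (t y)) => y /tP[ty dy cy].
have [d1 c1] := g1 _ _ dy; split=> // [x|]; first by rewrite ty.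
pose h := fun y : Y => (y, t y).
apply: (@continuous_comp _ _ _ h (fun p => T1 p.1 p.2)); last exact: c1.
by apply: continuous_pair_at => //; exact: cvg_id.
Qed.

Lemma op_on_compl T1 T2 V b : op_on T1 V b ->
  op_on (fun y x => T1 y (T2 y x)) V b.
Proof.
by move=> [oV [t tP]]; split=> //; exists t => y /tP[ty dy cy]; split.
Qed.

(** On overlaps the local constants agree, all being equal to [T y x0], so they glue without a
    choice. *)
Lemma op_on_bigcup (I : Type) (D : set I) T (V : I -> set Y) b (x0 : X) :
  (forall i, D i -> op_on T (V i) b) -> op_on T (\bigcup_(i in D) V i) b.
Proof.
move=> H; split; first by apply: bigcup_open => i /H[].
exists (fun y => T y x0) => y [i Di Viy]; have [oV [t tP]] := H i Di.
have [ty dy cy] := tP y Viy; split=> [x||]; first by rewrite !ty.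
  by rewrite ty.
have E : \forall z \near y, t z = T z x0.
  by near=> z; have [|->] := tP z; first by near: z; exact: open_nbhs_nbhs.
change (T y' x0 @[y' --> y] --> T y x0); rewrite ty; apply: cvg_trans cy.
exact: near_eq_cvg.
Unshelve. all: by end_near. Qed.

End Operators.

(** * Contracting at once near the disjoint pieces of one colour *)

Section ColorOperator.
Context {R : realType} {X : topologicalType} {Y : metricType R} (phi : X -> Y).
Context (I : finType) (U : I -> set Y) (s : I -> Y -> R) (W : I -> set X).
Context (c : I -> X -> R -> X) (z : I -> X) (b b' : R).
Hypothesis b'b : b' <= b.
Hypothesis oU : forall i, open (U i).
Hypothesis dU : forall i j y, U i y -> U j y -> i = j.
Hypothesis cs : forall i, continuous (s i).
Hypothesis s0 : forall i y, ~ U i y -> \forall y' \near y, s i y' = 0.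
Hypothesis cP : forall i, contracts_in (W i) setT (c i) (z i).
Hypothesis cW : forall i y x, U i y -> mdist (phi x) y < b' ->
  W i x /\ forall r, mdist (phi (c i x r)) y < b.
Hypothesis zU : forall i y, U i y -> mdist (phi (z i)) y < b.
Hypothesis phic : continuous phi.

Definition color_op (y : Y) (x : X) : X :=
  if [pick i | `[< U i y >]] is Some i then c i x (s i y) else x.

Lemma color_opE i y x : U i y -> color_op y x = c i x (s i y).
Proof.
move=> Uy; rewrite /color_op; case: pickP => [j /asboolP Ujy|/(_ i)/asboolP//].
by rewrite (dU Uy Ujy).
Qed.

Lemma color_op_out y x : (forall i, ~ U i y) -> color_op y x = x.
Proof.
by move=> Uy; rewrite /color_op; case: pickP => // j /asboolP /Uy.
Qed.

Lemma color_op0 y x : mdist (phi x) y < b' -> (forall i, s i y = 0) ->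
  color_op y x = x.
Proof.
move=> xy sy; have [[i Uy]|Uy] := pselect (exists i, U i y); last first.
  by apply: color_op_out => i Ui; apply: Uy; exists i.
rewrite (color_opE _ Uy) sy; have [_ c0 _ _ _] := cP i.
by have [Wx _] := cW Uy xy; exact: c0.
Qed.

(** At a point of some [U i] the operator is locally a single contraction. At a point outside all of
    them every time [s i] vanishes nearby, and a contraction at time 0 is the identity on [W i]; so
    the two branches fit together continuously. *)
Lemma color_op_good : op_good phi color_op b b'.
Proof.
move=> y x xy; have [[i Uy]|Uy] := pselect (exists i, U i y).
  have [Wx cb] := cW Uy xy; split; first by rewrite (color_opE _ Uy).
  have [_ _ _ _ /(_ x (s i y) Wx) cc] := cP i.
  pose h := fun p : Y * X => (p.2, s i p.1).
  have ch : {for (y, x), continuous ((fun p => c i p.1 p.2) \o h)}.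
    apply: continuous_comp; last exact: cc.
    apply: continuous_pair_at; first exact: cvg_snd.
    by apply: (@continuous_comp _ _ _ fst); [exact: cvg_fst | exact: cs].
  change (color_op p.1 p.2 @[p --> (y, x)] --> color_op y x).
  rewrite (color_opE _ Uy); apply: cvg_trans ch; apply: near_eq_cvg.
  exists (U i, setT) => /=; first by split; [exact: open_nbhs_nbhs | exact: filterT].
  by move=> [y' x'] [/= Uy' _]; rewrite (color_opE _ Uy').
have {}Uy i : ~ U i y by move=> Ui; apply: Uy; exists i.
rewrite color_op_out //; split; first exact: lt_le_trans b'b.
change (color_op p.1 p.2 @[p --> (y, x)] --> color_op y x).
rewrite color_op_out //.
have E : \forall p \near (y, x), p.2 = color_op p.1 p.2.
  have n1 : \forall y' \near y, forall i, s i y' = 0.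
    by apply: filter_forall => i; exact: s0.
  have e0 : 0 < (b' - mdist (phi x) y) / 2 by lra.
  have n2 := mdist_nbhs y e0; have n3 := nbhs_mdistl (@phic x) e0.
  exists ([set y' | (forall i, s i y' = 0) /\ mdist y y' < (b' - mdist (phi x) y) / 2],
          [set x' | mdist (phi x) (phi x') < (b' - mdist (phi x) y) / 2]).
    by split=> //; apply: filterI.
  move=> [y' x'] [/= [sy' yy'] xx']; rewrite color_op0 //.
  have := metric_triangle (phi x') (phi x) y'; have := metric_triangle (phi x) y y'.
  rewrite (metric_sym (phi x') (phi x)); lra.
by apply: cvg_trans; [apply: near_eq_cvg E | exact: cvg_snd].
Qed.

Lemma color_op_on i : op_on phi color_op (U i `&` [set y | s i y = 1]^°) b.
Proof.
split; first by apply: openI => //; exact: open_interior.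
exists (fun=> z i) => y [Uy /interior_subset/= sy]; split.
- by move=> x; rewrite (color_opE _ Uy) sy; have [_ _ -> _ _] := cP i.
- exact: zU.
- exact: cvg_cst.
Qed.

End ColorOperator.

Definition clip01 {R : realType} (t : R) : R := Num.max 0 (Num.min 1 t).

Lemma clip01_continuous (R : realType) : continuous (@clip01 R).
Proof.
move=> t; apply: (@continuous_max R R (fun=> 0) (fun t => Num.min 1 t)).
  exact: cvg_cst.
by apply: (@continuous_min R R (fun=> 1) id); [exact: cvg_cst | exact: cvg_id].
Qed.

Lemma clip01_id (R : realType) (t : R) : 0 <= t <= 1 -> clip01 t = t.
Proof. by move=> /andP[t0 t1]; rewrite /clip01 min_r // max_r. Qed.

Lemma clip01_eq1 (R : realType) (t : R) : 1 <= t -> clip01 t = 1.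
Proof. by move=> t1; rewrite /clip01 min_l // max_r. Qed.

Lemma clip01_eq0 (R : realType) (t : R) : t <= 0 -> clip01 t = 0.
Proof. by move=> t0; rewrite /clip01 min_r ?max_l //; lra. Qed.

Lemma clip01_itv (R : realType) (t : R) : 0 <= clip01 t <= 1.
Proof. by rewrite /clip01 le_max lexx /= ge_max ler01 ge_min lexx. Qed.

Definition locally_contractible (R : realType) (X : topologicalType) :=
  forall (x : X) (U : set X), nbhs x U ->
  exists (W : set X) (c : X -> R -> X) (z : X), W x /\ contracts_in W U c z.

(** The colours [C] are fixed before the mesh [mu]: a form of finite-dimensionality. The order of
    these quantifiers is what [layer_op] relies on. *)
Definition colored_covers (R : realType) (X : topologicalType)
    (Y : metricType R) (phi : X -> Y) (F : set X) (C : finType) :=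
  forall mu : R, 0 < mu -> exists (I : finType) (col : I -> C) (B : I -> set X),
  [/\ forall i, compact (B i), F = \bigcup_i B i,
      forall i x x', B i x -> B i x' -> mdist (phi x) (phi x') < mu
    & forall i j, i != j -> col i = col j -> B i `&` B j = set0].

Lemma open_fattening (R : realType) (X : Type) (Y : metricType R) (phi : X -> Y)
    (F : set X) (r : R) : open [set y | exists2 x, F x & mdist (phi x) y < r].
Proof.
rewrite openE => y [x Fx xy]; have e0 : 0 < r - mdist (phi x) y by lra.
apply: filterS (mdist_nbhs y e0) => y' yy'; exists x => //.
by have := metric_triangle (phi x) y y'; lra.
Qed.

(** Finitely many disjoint compact pieces have positive distances; a separation of [3 * rho] keeps
    the [rho]-fattenings of pieces of one colour disjoint. *)
Lemma colors_apart (R : realType) (X : topologicalType) (Y : metricType R)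
    (phi : X -> Y) (I C : finType) (col : I -> C) (B : I -> set X) (mu : R) :
  continuous phi -> injective phi -> (forall i, compact (B i)) ->
  (forall i j, i != j -> col i = col j -> B i `&` B j = set0) -> 0 < mu ->
  exists rho : R, [/\ 0 < rho, rho <= mu &
    forall i j, i != j -> col i = col j -> forall x x', B i x -> B j x' ->
    3 * rho <= mdist (phi x) (phi x')].
Proof.
move=> phic phi_inj cB disB mu0.
have cphiB i : compact [set phi x | x in B i].
  by apply: continuous_compact => //; exact: continuous_subspaceT.
have H : \forall r \near (0 : R)^'+, forall i j, i != j -> col i = col j ->
    forall x x', B i x -> B j x' -> r <= mdist (phi x) (phi x').
  apply: filter_forall => i; apply: filter_forall => j.
  have [->|ij] := eqVneq i j; first exact: nearW.
  have [ijc|ijc] := pselect (col i = col j); last exact: nearW.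
  have BB : [set phi x | x in B i] `&` [set phi x | x in B j] = set0.
    rewrite -subset0 => _ [[x Bx <-] [x' Bx' xx']].
    have E := phi_inj _ _ xx'; rewrite E in Bx'.
    by have : (B i `&` B j) x by []; rewrite disB.
  apply: filterS (compact_disjoint_dist (cphiB i) (cphiB j) BB) => r rP _ _ x x' Bx Bx'.
  by apply: rP; [exists x | exists x'].
near (0 : R)^'+ => r; exists (Num.min (r / 3) mu).
have r0 : 0 < r by near: r; exact: nbhs_right_gt.
have rP : forall i j, i != j -> col i = col j ->
    forall x x', B i x -> B j x' -> r <= mdist (phi x) (phi x') by near: r.
split; first by rewrite lt_min; apply/andP; split; lra.
  by rewrite ge_min lexx orbT.
move=> i j ij ijc x x' Bx Bx'; apply: le_trans (rP i j ij ijc x x' Bx Bx').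
have : Num.min (r / 3) mu <= r / 3 by rewrite ge_min lexx.
lra.
Unshelve. all: by end_near. Qed.

(** * The operator attached to one compact piece *)

Section Layer.
Context {R : realType} {X : topologicalType} {Y : metricType R} (phi : X -> Y).
Hypothesis phic : continuous phi.
Hypothesis phi_inj : injective phi.
Hypothesis phie : forall x (U : set X), nbhs x U ->
  exists2 r : R, 0 < r & forall x', mdist (phi x) (phi x') < r -> U x'.
Hypothesis lcX : locally_contractible R X.
Context (x0 : X).

Lemma op_on_subset T (V V' : set Y) b : op_on phi T V b -> open V' ->
  V' `<=` V -> op_on phi T V' b.
Proof. by move=> [_ [t tP]] oV' V'V; split=> //; exists t => y /V'V/tP. Qed.

(** A contraction inside the ball of radius [e / 2] about [phi x] also serves all nearby centres,
    whose balls of radius [e] contain that ball; compactness of [F] then makes [d] uniform. *)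
Lemma uniform_contraction (F : set X) : compact F -> forall e : R, 0 < e ->
  exists2 d : R, 0 < d & forall x, F x -> exists (W : set X) (c : X -> R -> X) z,
    contracts_in W [set x' | mdist (phi x) (phi x') < e] c z /\
    forall x', mdist (phi x) (phi x') < d -> W x'.
Proof.
move=> cF e e0.
pose P (d : R) (x : X) := exists (W : set X) (c : X -> R -> X) z,
    contracts_in W [set x' | mdist (phi x) (phi x') < e] c z /\
    forall x', mdist (phi x) (phi x') < d -> W x'.
have /compact_near_coveringP/(_ R (0 : R)^'+ P _) H := cF.
have {}H : \forall d \near (0 : R)^'+, F `<=` P d.
  apply: H => x Fx.
  have e2 : 0 < e / 2 by lra.
  have [W [c [z [Wx [oW c0 c1 cU cc]]]]] :=
    lcX (nbhs_mdistl (@phic x) e2).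
  have [r r0 rW] := phie (open_nbhs_nbhs (conj oW Wx)).
  have m0 : 0 < Num.min (r / 2) (e / 2) by rewrite lt_min; apply/andP; split; lra.
  exists ([set x' | mdist (phi x) (phi x') < Num.min (r / 2) (e / 2)],
          [set d | d <= r / 2]) => /=.
    by split; [exact: (nbhs_mdistl (@phic x) m0) | apply: nbhs_right_le; lra].
  move=> [x' d] [/= + dr]; rewrite lt_min => /andP[xr xe].
  exists W, c, z; split.
    split=> // x'' s Wx''; have /= := cU x'' s Wx''.
    have := metric_triangle (phi x') (phi x) (phi (c x'' s)).
    by rewrite (metric_sym (phi x') (phi x)) /=; lra.
  move=> x'' xx; apply: rW.
  by have := metric_triangle (phi x) (phi x') (phi x''); lra.
have [d [d0 dP]] : exists d : R, 0 < d /\ F `<=` P d.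
  near (0 : R)^'+ => d; exists d; split; last by near: d.
  by near: d; exact: nbhs_right_gt.
by exists d.
Unshelve. all: by end_near. Qed.

(** [theta] is a dial: the layer is off where it is 0 and fully on where it is 1. It is quantified
    after [b'] and [rho] because in the retraction it depends on the radii of all later layers. *)
Lemma layer_op (F : set X) (C : finType) : compact F -> colored_covers phi F C ->
  forall b : R, 0 < b -> exists b' rho : R, [/\ 0 < b', b' <= b, 0 < rho &
  forall theta : Y -> R, continuous theta -> exists T : Y -> X -> X,
    [/\ op_good phi T b b',
        forall y x, theta y = 0 -> mdist (phi x) y < b' -> T y x = x
      & op_on phi T ([set y | exists2 f, F f & mdist (phi f) y < rho] `&`
                     [set y | theta y = 1]^°) b]].
Proof.
move=> cF colF b b0.
have /choice[dl dlP] : forall e : R, exists d : R, 0 < e -> 0 < d /\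
    forall x, F x -> exists (W : set X) (c : X -> R -> X) z,
    contracts_in W [set x' | mdist (phi x) (phi x') < e] c z /\
    forall x', mdist (phi x) (phi x') < d -> W x'.
  move=> e; have [e0|] := ltP 0 e; last by exists 0.
  by have [d d0 dP] := uniform_contraction cF e0; exists d.
(* The constants bs do not depend on the mesh mu, which can thus be chosen after
   them, since the number of colors is fixed. *)
pose next (e : R) := Num.min (dl (e / 2) / 2) (e / 2).
pose bs l : R := iter l next b.
have bs0 l : 0 < bs l.
  elim: l => //= l IH; rewrite /next lt_min; apply/andP; split; last by lra.
  by have [|+ _] := dlP (bs l / 2); lra.
have bsS l : bs l.+1 <= dl (bs l / 2) / 2 /\ bs l.+1 <= bs l / 2.
  by rewrite /bs /= /next !ge_min !lexx orbT.
have bs_le l k : bs (l + k)%N <= bs l.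
  elim: k => [|k IH]; first by rewrite addn0.
  by rewrite addnS; have := bs0 (l + k)%N; have [_] := bsS (l + k)%N; lra.
have bsE : bs 0%N = b by [].
clearbody bs; subst b; clear b0.
(* One stage per colour. The two errors, [mu] for the size of a piece and [rho <= mu] for its
   fattening, add up to at most [bs n], which every stage can afford. *)
pose n := #|C|; pose mu := bs n / 2.
have mu0 : 0 < mu by have := bs0 n; rewrite /mu; lra.
have [I [col [B [cB FB dB disB]]]] := colF mu mu0.
have [rho [rho0 rhomu rhoB]] := colors_apart phic phi_inj cB disB mu0.
pose U i y := exists2 x, B i x & mdist (phi x) y < rho.
have oU i : open (U i) by exact: open_fattening.
have dU i j y : col i = col j -> U i y -> U j y -> i = j.
  move=> ijc [x Bx xy] [x' Bx' xy']; apply/eqP/contraT => ij.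
  have := rhoB i j ij ijc x x' Bx Bx'.
  by have := metric_triangle (phi x) y (phi x'); rewrite (metric_sym y); lra.
pose D i := infdist [set phi x | x in B i].
(* The bump is 1 up to distance [rho / 2] from the piece and 0 from distance [3 / 4 * rho] on, hence
   0 near the complement of [U i]. For an empty piece [infdist] is meaningless, and the bump is
   0. *)
pose bump i y : R := if `[< B i !=set0 >] then clip01 (3 - 4 * D i y / rho) else 0.
have bump_c i : continuous (bump i).
  move=> y; rewrite /bump; case: asboolP => [[x Bx]|_]; last exact: cvg_cst.
  apply: (@continuous_comp _ _ _ (fun y => 3 - 4 * D i y / rho)); last exact: clip01_continuous.
  apply: cvgB; first exact: cvg_cst.
  apply: cvgM; last exact: cvg_cst.
  apply: cvgM; first exact: cvg_cst.
  by apply: infdist_continuous; exists (phi x), x.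
have bump0 i y : ~ U i y -> \forall y' \near y, bump i y' = 0.
  move=> Uy; rewrite /bump; case: asboolP => [[x Bx]|_]; last exact: nearW.
  have BI : [set phi x | x in B i] !=set0 by exists (phi x), x.
  have rD : rho <= D i y.
    rewrite leNgt; apply/negP => /(infdist_lt BI)[_ [x' Bx' <-] yx'].
    by apply: Uy; exists x' => //; rewrite metric_sym.
  have e0 : 0 < rho / 4 by lra.
  apply: filterS (mdist_nbhs y e0) => y' yy'; apply: clip01_eq0.
  have Dy' : 3 / 4 * rho <= D i y'.
    by have := infdist_lip y y' BI; rewrite -/(D i); lra.
  by rewrite subr_le0 ler_pdivlMr //; lra.
(* One contraction for each stage [l] and piece [i], taken at some point of the piece; passing to
   another point of the piece costs [mu] in both estimates. An empty piece gets the empty domain. *)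
have /choice[cs csP] : forall li : nat * I, exists p : set X * (X -> R -> X) * X,
   contracts_in p.1.1 setT p.1.2 p.2 /\ forall x, B li.2 x ->
     forall x', mdist (phi x) (phi x') + mu < 2 * bs li.1.+1 ->
     p.1.1 x' /\ forall r, mdist (phi x) (phi (p.1.2 x' r)) < bs li.1 / 2 + mu.
  move=> [l i] /=; have [[x Bx]|Bi0] := pselect (B i !=set0); last first.
    exists (set0, fun _ _ => x0, x0); split; last first.
      by move=> x Bx; case: Bi0; exists x.
    by split=> //; exact: open0.
  have [|dl0 /(_ x)] := dlP (bs l / 2); first by have := bs0 l; lra.
  case=> [|W [c [z [[oW c0 c1 cU cc] WP]]]].
    by rewrite FB; exists i.
  exists (W, c, z); split=> /=; first by split.
  move=> x1 Bx1 x' xx'; have [b1 b2] := bsS l.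
  have xx1 := dB i x x1 Bx Bx1.
  have Wx' : W x'.
    by apply: WP; have := metric_triangle (phi x) (phi x1) (phi x'); lra.
  split=> // r; have /= := cU x' r Wx'.
  have := metric_triangle (phi x1) (phi x) (phi (c x' r)).
  by rewrite (metric_sym (phi x1) (phi x)); lra.
(* Within the radius [rho / 2] the bump is 1 on a whole neighbourhood, as the interior in the claim
   requires. *)
exists (bs n), (rho / 2); split; [exact: bs0 | exact: (bs_le 0%N) | by lra | ].
move=> theta ctheta.
pose Uk k i y := col i = k /\ U i y.
pose sk k i y : R := if col i == k then theta y * bump i y else 0.
pose op k l := color_op (Uk k) (sk k) (fun i => (cs (l, i)).1.2).
have colorP k l : (l < n)%N ->
    [/\ op_good phi (op k l) (bs l) (bs l.+1),
      forall i, op_on phi (op k l) (Uk k i `&` [set y | sk k i y = 1]^°) (bs l)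
    & forall y x, theta y = 0 -> mdist (phi x) y < bs l.+1 -> op k l y x = x].
  move=> ln.
  have bn : bs n <= bs l.+1 by have := bs_le l.+1 (n - l.+1)%N; rewrite subnKC.
  have [b1 b2] := bsS l; have b3 := bs0 l; have b4 := bs0 l.+1.
  have oUk i : open (Uk k i).
    have [ik|ik] := pselect (col i = k).
      suff -> : Uk k i = U i by [].
      by apply/seteqP; split=> [y [] //|y].
    suff -> : Uk k i = set0 by exact: open0.
    by rewrite -subset0 => y [].
  have dUk i j y : Uk k i y -> Uk k j y -> i = j.
    by move=> [ik Ui] [jk Uj]; apply: (dU i j y) => //; rewrite ik jk.
  have csk i : continuous (sk k i).
    move=> y; rewrite /sk; case: eqP => _; last exact: cvg_cst.
    by apply: cvgM; [exact: ctheta | exact: bump_c].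
  have sk0 i y : ~ Uk k i y -> \forall y' \near y, sk k i y' = 0.
    rewrite /sk; case: eqP => [ik Uy|_ _]; last exact: nearW.
    have Uy' : ~ U i y by move=> Uy'; apply: Uy.
    by apply: filterS (bump0 i y Uy') => y' ->; rewrite mulr0.
  have ckP i := (csP (l, i)).1.
  have ckW i y x : Uk k i y -> mdist (phi x) y < bs l.+1 ->
      (cs (l, i)).1.1 x /\ forall r, mdist (phi ((cs (l, i)).1.2 x r)) y < bs l.
    move=> [_ [f Bf fy]] xy; have [|Wx cx] := (csP (l, i)).2 f Bf x.
      have := metric_triangle (phi f) y (phi x); rewrite (metric_sym y (phi x)) /=.
      by rewrite /mu in rhomu *; lra.
    split=> // r; have := cx r; have := metric_triangle (phi ((cs (l, i)).1.2 x r)) (phi f) y.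
    by rewrite (metric_sym _ (phi f)) /=; rewrite /mu in rhomu *; lra.
  have zk i y : Uk k i y -> mdist (phi (cs (l, i)).2) y < bs l.
    move=> Uy; have [_ [f Bf fy]] := Uy; have [_ _ c1 _ _] := ckP i.
    have [|Wx cx] := (csP (l, i)).2 f Bf f.
      by rewrite mdistxx /= /mu; have := bs0 n; lra.
    rewrite -(c1 f); have := cx 1.
    have := metric_triangle (phi ((cs (l, i)).1.2 f 1)) (phi f) y.
    by rewrite (metric_sym _ (phi f)) /=; rewrite /mu in rhomu *; lra.
  have bb : bs l.+1 <= bs l by lra.
  split.
  - exact: (color_op_good bb oUk dUk csk sk0 ckP ckW phic).
  - by move=> i; exact: (color_op_on (sk k) oUk dUk ckP zk).
  - move=> y x ty xy; apply: (color_op0 dUk ckP ckW xy) => i.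
    by rewrite /sk ty mul0r; case: ifP.
(* The head of the list acts last: stage [l] turns tolerance [bs l.+1] into [bs l], so the whole
   composition leads from [bs n] to [bs 0]. *)
pose comp := fix comp l ks : Y -> X -> X :=
  if ks is k :: ks' then fun y x => op k l y (comp l.+1 ks' y x) else fun y x => x.
have comp_good ks l : (l + size ks <= n)%N ->
    op_good phi (comp l ks) (bs l) (bs (l + size ks)%N).
  elim: ks l => [|k ks IH] l /=; first by move=> _; apply: op_good_id; by rewrite addn0.
  move=> ln; have ln' : (l < n)%N by lia.
  have [gk _ _] := colorP k l ln'.
  apply: (op_good_comp gk); have -> : (l + (size ks).+1 = l.+1 + size ks)%N by lia.
  by apply: IH; lia.
have comp0 ks l y x : (l + size ks <= n)%N -> theta y = 0 ->
    mdist (phi x) y < bs (l + size ks)%N -> comp l ks y x = x.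
  elim: ks l => [|k ks IH] l //= ln ty.
  have -> : (l + (size ks).+1 = l.+1 + size ks)%N by lia.
  move=> xy; have ln' : (l < n)%N by lia.
  have [_ _ H] := colorP k l ln'; rewrite IH //; last by lia.
  by apply: H => //; apply: lt_le_trans xy (bs_le _ _).
have comp_on ks l i : (l + size ks <= n)%N -> col i \in ks ->
    op_on phi (comp l ks) (U i `&` [set y | theta y * bump i y = 1]^°) (bs l).
  elim: ks l => [|k ks IH] l //= ln; rewrite inE => /orP[/eqP <-|iks].
    have ln' : (l < n)%N by lia.
    apply: op_on_compl; have [_ + _] := colorP (col i) l ln'.
    move=> /(_ i); congr (op_on _ _ (_ `&` _°) _).
      by apply/seteqP; split=> [y [] //|y Uy]; split.
    by apply/seteqP; split=> y; rewrite /sk /= eqxx.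
  have ln' : (l < n)%N by lia.
  have [gk _ _] := colorP k l ln'.
  have ln2 : (l.+1 + size ks <= n)%N by move: ln; rewrite addnS addSn.
  exact: op_on_compr gk (IH l.+1 ln2 iks).
have sC : (0 + size (enum C) <= n)%N by rewrite add0n -cardE.
exists (comp 0%N (enum C)); split.
- by have := comp_good (enum C) 0%N sC; rewrite add0n -cardE.
- by move=> y x ty xy; apply: comp0 => //; rewrite add0n -cardE.
- have := @op_on_bigcup _ _ _ phi I setT (comp 0%N (enum C)) _ _ x0
    (fun i _ => comp_on (enum C) 0%N i sC (mem_enum _ _)).
  move/op_on_subset; apply.
    by apply: openI; [exact: open_fattening | exact: open_interior].
  move=> y [[f Ff fy] ty]; move: Ff; rewrite FB => -[i _ Bf].
  exists i => //; split; first by exists f => //; lra.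
  have BI : [set phi x | x in B i] !=set0 by exists (phi f), f.
  have e0 : 0 < rho / 2 - mdist (phi f) y by lra.
  apply: filterS2 ty (mdist_nbhs y e0) => y' ty' yy' /=.
  rewrite ty' mul1r /bump; case: asboolP; last by case; exists f.
  move=> _; apply: clip01_eq1.
  have Dy : D i y' < rho / 2.
    have Bf' : [set phi x | x in B i] (phi f) by exists f.
    have := infdist_le y' Bf'; rewrite -/(D i) (metric_sym y').
    by have := metric_triangle (phi f) y y'; lra.
  suff : 4 * D i y' / rho <= 2 by lra.
  by rewrite ler_pdivrMr //; lra.
Qed.

End Layer.

(** * The infinite composition and the retraction *)

Section Retraction.
Context {R : realType} {X : topologicalType} {Y : metricType R} (phi : X -> Y).
Hypothesis phic : continuous phi.
Hypothesis phi_inj : injective phi.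
Hypothesis phie : forall x (U : set X), nbhs x U ->
  exists2 r : R, 0 < r & forall x', mdist (phi x) (phi x') < r -> U x'.
Hypothesis lcX : locally_contractible R X.
Context (F : nat -> set X) (C : nat -> finType).
Hypothesis cF : forall j, compact (F j).
Hypothesis colF : forall j, colored_covers phi (F j) (C j).
Hypothesis FT : \bigcup_j F j = setT.
Hypothesis closed_range : closed (range phi).
Context (x0 : X).

(** An Urysohn function is 0 and 1 on the two closed sets only; replacing [f] by the clipped
    [3 * f y - 1] makes it constant near each of them. *)
Lemma cutoff (G : set Y) : open G -> range phi `<=` G ->
  exists theta : Y -> R, [/\ continuous theta,
    forall y, range phi y -> \forall y' \near y, theta y' = 0
  & forall y, ~ G y -> \forall y' \near y, theta y' = 1].
Proof.
move=> oG AG.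
have : uniform_separator (range phi) (~` G).
  apply: ((@normal_separatorP R Y).1 (@pseudometric_normal R Y)) => //.
    exact: open_closedC.
  by rewrite -subset0 => y [/AG].
move=> /(@uniform_separatorP _ R) [f [cf _ f0 f1]].
exists (fun y => clip01 (3 * f y - 1)); split.
- move=> y; apply: (@continuous_comp _ _ _ (fun y => 3 * f y - 1)); last exact: clip01_continuous.
  by apply: cvgB; [apply: cvgM; [exact: cvg_cst | exact: cf] | exact: cvg_cst].
- move=> y Ay; have fy : f y = 0 by apply: f0; exists y.
  have := cf y; rewrite /continuous_at fy => /cvgr_lt /(_ (1/3)) H.
  by apply: filterS (H _) => [y' ?|]; [apply: clip01_eq0; lra | lra].
- move=> y Gy; have fy : f y = 1 by apply: f1; exists y.
  have := cf y; rewrite /continuous_at fy => /cvgr_gt /(_ (2/3)) H.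
  by apply: filterS (H _) => [y' ?|]; [apply: clip01_eq1; lra | lra].
Qed.

Lemma neighborhood_retract_range : neighborhood_retract (range phi).
Proof.
(* Every F j reappears infinitely often, so each tail of the layers still
   covers the whole range. *)
pose idx j := logn 2 j.+1.
have /choice[L LP] : forall jb : nat * R, exists p : R * R, 0 < jb.2 ->
    [/\ 0 < p.1, p.1 <= jb.2, 0 < p.2 &
    forall theta : Y -> R, continuous theta -> exists T : Y -> X -> X,
    [/\ op_good phi T jb.2 p.1,
        forall y x, theta y = 0 -> mdist (phi x) y < p.1 -> T y x = x
      & op_on phi T ([set y | exists2 f, F (idx jb.1) f & mdist (phi f) y < p.2] `&`
                     [set y | theta y = 1]^°) jb.2]].
  move=> [j b] /=; have [b0|] := ltP 0 b; last by exists (0, 0).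
  have [b' [rho H]] := layer_op phic phi_inj phie lcX x0 (@cF (idx j)) (@colF (idx j)) b0.
  by exists (b', rho).
(* The next tolerance is what the current layer accepts, and at most half of the current one, so
   that the tolerances tend to 0. *)
pose next (jb : nat * R) := (jb.1.+1, Num.min (L jb).1 (jb.2 / 2)).
pose it j : nat * R := iter j next (0%N, 1).
have it1 j : (it j).1 = j by elim: j => //= j ->.
pose bt j := (it j).2.
have btS j : bt j.+1 = Num.min (L (j, bt j)).1 (bt j / 2).
  by rewrite {1}/bt /= -/(it j) {1 2}(surjective_pairing (it j)) it1.
have bt0 j : 0 < bt j.
  elim: j => [|j IH]; first exact: ltr01.
  rewrite btS lt_min; apply/andP; split; last by lra.
  by have [] := LP (j, bt j) IH.
have bt_le j : bt j <= (2^-1) ^+ j.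
  elim: j => [|j IH]; first by rewrite expr0.
  by rewrite btS ge_min exprS; apply/orP; right; lra.
have bt_lim (e : R) : 0 < e -> exists j, forall k, (j <= k)%N -> bt k < e.
  move=> e0; have H : (2^-1 : R) ^+ n @[n --> \oo] --> (0 : R).
    by apply: cvg_expr; rewrite ger0_norm; lra.
  have /cvgr_lt /(_ e e0) [j _ jP] := H.
  by exists j => k /jP; apply: le_lt_trans.
clearbody bt; clear it it1.
pose rho j := Num.min (L (j, bt j)).2 (bt j).
have rho0 j : 0 < rho j.
  by rewrite lt_min bt0 andbT; have [] := LP (j, bt j) (bt0 j).
pose O j := [set y | exists2 f, F (idx j) f & mdist (phi f) y < rho j].
have oO j : open (O j) by exact: open_fattening.
(* The sets [G j] decrease, and only the range is common to all of them, since it is closed and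
   [rho k <= bt k] tends to 0. *)
pose G j := \bigcup_(k in [set k | (j <= k)%N]) O k.
have oG j : open (G j) by apply: bigcup_open.
have AG j : range phi `<=` G j.
  move=> _ [x _ <-]; have [k _ Fx] : (\bigcup_j F j) x by rewrite FT.
  (* An index at least [j] whose successor is [2 ^ k] times an odd number, so that its [idx] is
     [k]. *)
  exists (2 ^ k * (2 * j).+1).-1; last first.
    exists x; last by rewrite mdistxx.
    suff -> : idx (2 ^ k * (2 * j).+1).-1 = k by [].
    rewrite /idx prednK ?muln_gt0 ?expn_gt0 // lognM ?expn_gt0 //.
    rewrite pfactorK // logn_coprime ?addn0 //.
    by rewrite coprime2n /= mul2n odd_double.
  rewrite /= -ltnS prednK ?muln_gt0 ?expn_gt0 //.
  have : (0 < 2 ^ k)%N by rewrite expn_gt0.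
  by move: (2 ^ k)%N => u; nia.
have /choice[theta thetaP] := fun j => cutoff (oG j.+1) (@AG j.+1).
have /choice[T TP] : forall j, exists T : Y -> X -> X,
    [/\ op_good phi T (bt j) (bt j.+1),
        forall y x, theta j y = 0 -> mdist (phi x) y < bt j.+1 -> T y x = x
      & op_on phi T (O j `&` [set y | theta j y = 1]^°) (bt j)].
  move=> j; have [_ _ _ /(_ (theta j))] := LP (j, bt j) (bt0 j).
  have [cth _ _] := thetaP j; case/(_ cth) => S /= [S1 S2 S3].
  have le1 : bt j.+1 <= (L (j, bt j)).1 by rewrite btS ge_min lexx.
  exists S; split.
  - by move=> y x xy; apply: S1; exact: lt_le_trans xy le1.
  - by move=> y x ty xy; apply: S2 => //; exact: lt_le_trans xy le1.
  - apply: op_on_subset S3 _ _; first by apply: openI => //; exact: open_interior.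
    move=> y [[f Ff fy] ty]; split=> //; exists f => //.
    by move: fy; rewrite lt_min => /andP[].
pose V j := O j `&` [set y | theta j y = 1]^°.
(* [T i] acts last. For [y] in [V j] the operator [T j] is constant, so adding operators beyond
   [T j] does not change the value. *)
pose comp := fix comp i k : Y -> X -> X :=
  if k is k'.+1 then fun y x => T i y (comp i.+1 k' y x) else fun y x => x.
have comp_split k l i y x : comp i (k + l)%N y x = comp i k y (comp (i + k)%N l y x).
  elim: k i => [|k IH] i /=; first by rewrite addn0.
  by rewrite IH addSnnS.
have comp0 k i y x : (forall j, (i <= j < i + k)%N -> theta j y = 0) ->
    mdist (phi x) y < bt (i + k)%N -> comp i k y x = x.
  elim: k i => [|k IH] i //= ty; rewrite -addSnnS => xy.
  rewrite IH //; last by move=> j ijk; apply: ty; lia.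
  have [_ H _] := TP i; apply: H; first by apply: ty; lia.
  apply: lt_le_trans xy _.
  elim: k {IH ty} => [|k IH]; first by rewrite addn0.
  rewrite addnS (le_trans _ IH) // btS ge_min; apply/orP; right.
  by have := bt0 (i.+1 + k)%N; lra.
have comp_on k i j : (i <= j < i + k)%N -> op_on phi (comp i k) (V j) (bt i).
  elim: k i => [|k IH] i /= ij; first by lia.
  have [g _ o] := TP i.
  have [ji|ji] := eqVneq j i; first by rewrite ji; exact: op_on_compl o.
  have ij' : (i.+1 <= j < i.+1 + k)%N by lia.
  exact: op_on_compr g (IH i.+1 ij').
have /choice[t tP] : forall j, exists t : Y -> X, forall y, V j y ->
    [/\ forall x k, (j < k)%N -> comp 0%N k y x = t y,
        {for y, continuous t} & True].
  move=> j; have [|_ [t tP]] := comp_on j.+1 0%N j; first by lia.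
  exists t => y /tP [ty _ cy]; split=> // x k jk.
  by rewrite -(subnKC jk) comp_split ty.
(* A point of [G 0] off the range lies in some [G j] but not in [G j.+1]. Hence it lies in [O j],
   and [theta j] is 1 near it. *)
have V_ex y : G 0%N y -> ~ range phi y -> exists j, V j y.
  move=> G0 Ay.
  have [e e0 eP] : exists2 e : R, 0 < e & forall x, e <= mdist y (phi x).
    have oA : open (~` range phi) by exact: closed_openC.
    have [e e0 eP] := nbhs_mdist_ex (open_nbhs_nbhs (conj oA Ay)).
    exists e => // x; rewrite leNgt; apply/negP => /eP; apply.
    by exists x.
  have [n nP] := bt_lim e e0.
  have Gn : ~ G n y.
    move=> [k /= nk [f _ fy]]; have := nP k nk; have := eP f.
    by move: fy; rewrite lt_min metric_sym => /andP[_]; lra.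
  have : exists j, ~ G j.+1 y /\ G j y.
    elim: n Gn {nP} => [//|n IH] Gn.
    by have [Gn'|/IH] := pselect (G n y); first by exists n.
  case=> j [Gj1 [k /= jk Oky]].
  have kj : k = j.
    apply/eqP; rewrite eqn_leq jk andbT leqNgt; apply/negP => jk'.
    by apply: Gj1; exists k.
  rewrite kj in Oky; exists j; split=> //.
  by have [_ _] := thetaP j; apply.
have /choice[J JP] : forall y, exists j, G 0%N y -> ~ range phi y -> V j y.
  move=> y; have [[G0 Ay]|H] := pselect (G 0%N y /\ ~ range phi y).
    by have [j Vj] := V_ex y G0 Ay; exists j.
  by exists 0%N => G0 Ay; case: H.
pose r y := if `[< range phi y >] then y else phi (t (J y) y).
have rA y : range phi y -> r y = y by rewrite /r; case: asboolP.
(* Compositions longer than both indices have both values, so the choice of [J y] is immaterial. *)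
have rV j y : V j y -> ~ range phi y -> G 0%N y -> r y = phi (t j y).
  move=> Vy Ay G0; rewrite /r; case: asboolP => // _; congr phi.
  have [tJ _ _] := tP _ _ (JP y G0 Ay); have [tj _ _] := tP _ _ Vy.
  by rewrite -(tJ x0 (maxn (J y) j).+1) ?ltnS ?leq_maxl // (tj x0) ?ltnS ?leq_maxr.
have VG j : V j `<=` G 0%N by move=> y [Oy _]; exists j.
have oV j : open (V j) by apply: openI => //; exact: open_interior.
have rcont y : G 0%N y -> {for y, continuous r}.
  move=> G0; have [Ay|Ay] := pselect (range phi y); last first.
    have [j Vj] := V_ex y G0 Ay.
    have [_ ct _] := tP _ _ Vj.
    have cpt : {for y, continuous (phi \o t j)}.
      by apply: continuous_comp => //; exact: phic.
    change (r z @[z --> y] --> r y).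
    rewrite (rV j y Vj Ay G0); apply: cvg_trans cpt.
    have oA : open (~` range phi) by exact: closed_openC.
    have E : \forall z \near y, (phi \o t j) z = r z.
      near=> z; have Vz : V j z.
        by near: z; exact: (open_nbhs_nbhs (conj (oV j) Vj)).
      rewrite /= (rV j z Vz) //; last exact: VG Vz.
      by near: z; exact: (open_nbhs_nbhs (conj oA Ay)).
    exact: near_eq_cvg.
  apply: cvg_mdist => e e0; rewrite rA //.
  have e2 : 0 < e / 2 by lra.
  have [n nP] := bt_lim _ e2.
  (* Near a point of the range the first [n] layers are switched off; [r z] is then the value of the
     layers from [n] on, which is [bt n]-near [z]. *)
  have th0 : \forall z \near y, forall j : 'I_n, theta j z = 0.
    by apply: filter_forall => j; have [_ + _] := thetaP j; apply.
  near=> z.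
  have tz : forall j : 'I_n, theta j z = 0 by near: z.
  have yz : mdist y z < e / 2 by near: z; exact: mdist_nbhs.
  have [Az|Az] := pselect (range phi z); first by rewrite rA //; lra.
  have Gz : G 0%N z by near: z; exact: (open_nbhs_nbhs (conj (oG 0%N) G0)).
  have [j Vj] := V_ex z Gz Az.
  have nj : (n <= j)%N.
    rewrite leqNgt; apply/negP => jn; have [_ /interior_subset /=] := Vj.
    by have := tz (Ordinal jn) => /= -> /eqP; rewrite eq_sym oner_eq0.
  rewrite (rV j z Vj Az Gz).
  have nj' : (n <= j < n + (j.+1 - n))%N by lia.
  have [_ [v vP]] := comp_on (j.+1 - n)%N n j nj'.
  have [vE vz _] := vP z Vj.
  have [tj _ _] := tP _ _ Vj; rewrite -(tj x0 _ (leqnn _)).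
  have <- : (n + (j.+1 - n) = j.+1)%N by lia.
  rewrite comp_split vE comp0 //.
    have := nP n (leqnn n); have := metric_triangle y z (phi (v z)).
    by rewrite (metric_sym z); lra.
  by move=> i /andP[_ ni]; exact: (tz (Ordinal ni)).
exists (G 0%N); split; [exact: oG | exact: AG | exists r; split].
- by apply: continuous_in_subspaceT => y; rewrite inE; exact: rcont.
- move=> _ [y0 Gy <-]; rewrite /r; case: asboolP => [|_]; first by [].
  by exists (t (J y0) y0).
- by move=> y; rewrite inE => /rA.
Unshelve. all: by end_near. Qed.

End Retraction.

Lemma ler_coord_norm (R : realType) m n (x : 'M[R]_(m, n)) i j :
  `|x i j| <= `|x|.
Proof.
rewrite [leRHS]/(Num.norm x) /= mx_normrE.
exact: (@le_bigmax_cond _ _ _ 0 (i, j) xpredT (fun ij => `|x ij.1 ij.2|)).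
Qed.

Lemma ler_norm_coord (R : realType) m n (x : 'M[R]_(m, n)) (e : R) : 0 <= e ->
  (forall i j, `|x i j| <= e) -> `|x| <= e.
Proof.
move=> e0 xe; rewrite [leLHS]/(Num.norm x) /= mx_normrE.
by apply: bigmax_le => // -[i j] _; exact: xe.
Qed.

Lemma within_near (R : realType) (T : topologicalType) (Y : metricType R)
    (K : set T) (g : T -> Y) x (r : R) : {within K, continuous g} -> K x ->
  0 < r -> \forall x' \near x, K x' -> mdist (g x) (g x') < r.
Proof.
move=> /subspace_continuousP cg Kx r0.
exact: (cg x Kx _ (mdist_nbhs (g x) r0)).
Qed.

(** * Coloured covers of parametrized compact sets *)

Section ColoredParametrization.
Context {R : realType} {X : topologicalType} {Y : metricType R} (phi : X -> Y).
Hypothesis phic : continuous phi.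
Hypothesis phi_inj : injective phi.

(** Cubes are coloured by the parities of their integer positions: positions of cubes that meet
    differ by at most 1 in each coordinate, so equal parities force equal cubes. Injectivity of
    [psi] carries disjointness over to [X]; the side [h] comes from uniform continuity on [K]. *)
Lemma colored_covers_image (N : nat) (K : set 'rV[R]_N) (psi : 'rV[R]_N -> X) :
  compact K -> {within K, continuous psi} -> {in K &, injective psi} ->
  colored_covers phi [set psi x | x in K] {ffun 'I_N -> bool}.
Proof.
move=> cK cpsi ipsi mu mu0.
pose g x := phi (psi x).
have cg : {within K, continuous g}.
  by move=> x; apply: continuous_comp; [exact: cpsi | exact: phic].
have [h h0 hP] : exists2 h : R, 0 < h & forall x x', K x -> K x' ->
    `|x - x'| <= h -> mdist (g x) (g x') < mu.
  pose P (h : R) x := forall x', K x' -> `|x - x'| <= h -> mdist (g x) (g x') < mu.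
  have /compact_near_coveringP/near_covering_withinP/(_ R (0 : R)^'+ P _) H := cK.
  have {}H : \forall h \near (0 : R)^'+, K `<=` P h.
    apply: H => x Kx; have mu2 : 0 < mu / 2 by lra.
    have [r /= r0 rP] := (@nbhs_normP _ 'rV[R]_N _ _).1 (within_near cg Kx mu2).
    exists ([set x' | `|x - x'| < r / 2], [set h | h < r / 2]) => /=.
      split; last by apply: nbhs_right_lt; lra.
      by apply/(@nbhs_normP _ 'rV[R]_N); exists (r / 2) => //=; lra.
    move=> [x1 h] [/= xx1 hr] Kx1 x2 Kx2 x12.
    have H1 := rP x1 _ Kx1; have H2 := rP x2 _ Kx2.
    have := metric_triangle (g x1) (g x) (g x2); rewrite (metric_sym (g x1) (g x)).
    have := ler_distD x1 x x2; move: H1 H2 => /=.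
    by move=> H1 H2 tr; have := H1 ltac:(lra); have := H2 ltac:(lra); lra.
  near (0 : R)^'+ => h; exists h; first by near: h; exact: nbhs_right_gt.
  have hP : K `<=` P h by near: h.
  by move=> x x' Kx; exact: hP.
have [b b0 bP] : exists2 b : R, 0 < b & forall x, K x -> `|x| <= b.
  have [M [_ MP]] := compact_bounded cK.
  exists (Num.max 1 (M + 1)); first by rewrite lt_max ltr01.
  by move=> x; apply: (MP); rewrite lt_max; apply/orP; right; lra.
pose L := (Num.truncn (2 * b / h)).
pose cube (k : {ffun 'I_N -> 'I_L.+1}) : set 'rV[R]_N :=
  [set x | forall j, (k j)%:R * h <= x ord0 j + b <= ((k j)%:R + 1) * h].
have ccube k : closed (cube k).
  have -> : cube k = \bigcap_j (((fun x : 'rV[R]_N => x ord0 j) @^-1` [set t | (k j)%:R * h - b <= t]) `&`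
      ((fun x : 'rV[R]_N => x ord0 j) @^-1` [set t | t <= ((k j)%:R + 1) * h - b])).
    apply/seteqP; split=> [x xk j _ /=|x xk j].
      by have /andP[? ?] := xk j; split; lra.
    by have [/= ? ?] := xk j I; apply/andP; split; lra.
  apply: closed_bigI => j _; apply: closedI; apply: closed_comp.
  - by move=> x _; exact: coord_continuous.
  - exact: closed_ge.
  - by move=> x _; exact: coord_continuous.
  - exact: closed_le.
exists {ffun 'I_N -> 'I_L.+1}, (fun k : {ffun 'I_N -> 'I_L.+1} => [ffun j => odd (k j)]),
  (fun k => [set psi x | x in K `&` cube k]).
split.
- move=> k; apply: continuous_compact; last exact: compact_closedI.
  by apply: continuous_subspaceW cpsi => x [].
- apply/seteqP; split=> [_ [x Kx <-]|_ [k _ [x [Kx _] <-]]]; last by exists x.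
  have xb j : 0 <= x ord0 j + b <= 2 * b.
    have := le_trans (ler_coord_norm x ord0 j) (bP x Kx).
    by rewrite ler_norml => /andP[? ?]; apply/andP; split; lra.
  have xL j : (Num.truncn ((x ord0 j + b) / h) < L.+1)%N.
    rewrite ltnS; apply: le_truncn; rewrite ler_pM2r ?invr_gt0 //.
    by have /andP[] := xb j.
  exists [ffun j => Ordinal (xL j)] => //; exists x => //; split=> // j.
  have d0 : 0 <= (x ord0 j + b) / h.
    by apply: divr_ge0; [have /andP[] := xb j | lra].
  have /andP[t1 /ltW t2] := truncn_itv d0; rewrite ffunE /=; apply/andP; split.
    by rewrite -(ler_pdivlMr _ _ h0).
  by rewrite -(ler_pdivrMr _ _ h0) natr1.
- move=> k _ _ [x [Kx xk] <-] [x' [Kx' xk'] <-]; apply: hP => //.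
  apply: ler_norm_coord => [|i j]; first lra.
  rewrite ord1 !mxE ler_norml.
  by have /andP[? ?] := xk j; have /andP[? ?] := xk' j; apply/andP; split; lra.
- move=> k k' kk' col; rewrite -subset0 => _ [[x [Kx xk] <-] [x' [Kx' xk'] xx']].
  have E : x' = x by apply: ipsi; rewrite ?inE.
  move: xk'; rewrite E => xk'.
  case/eqP: kk'; apply/ffunP => j.
  suff : nat_of_ord (k j) = nat_of_ord (k' j) by move/val_inj.
  have := congr1 (fun f : {ffun 'I_N -> bool} => f j) col; rewrite !ffunE.
  have /andP[x1 x2] := xk j; have /andP[x3 x4] := xk' j.
  have l1 : (k j)%:R * h <= ((k' j)%:R + 1) * h by lra.
  have l2 : (k' j)%:R * h <= ((k j)%:R + 1) * h by lra.
  move: l1 l2; rewrite !ler_pM2r // !natr1 !ler_nat.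
  move: (nat_of_ord (k j)) (nat_of_ord (k' j)) => u v uv vu par.
  case: (ltngtP u v) => // lt.
    have E2 : v = u.+1 by lia.
    by move: par; rewrite E2 /=; case: odd.
  have E2 : u = v.+1 by lia.
  by move: par; rewrite E2 /=; case: odd.
Unshelve. all: by end_near. Qed.

End ColoredParametrization.

Lemma nbhs_set_type (T : topologicalType) (A : set T) (a : A) (U : set A) :
  nbhs a U <-> exists2 V : set T, nbhs (set_val a) V &
    forall b : A, V (set_val b) -> U b.
Proof.
split=> [|[V nV VU]].
  move=> [_ [/= [W oW <-] /= Wa WU]]; exists W; last by move=> b Wb; exact: WU.
  exact: open_nbhs_nbhs.
apply: filterS VU _; exact: (@initial_continuous A T set_val a V nV).
Qed.

(** The third property is the continuity of the inverse, expressed by distances in [Y]. *)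
Lemma homeomorphic_embedding (R : realType) (X : topologicalType)
    (Y : metricType R) (A : set Y) : homeomorphic X A ->
  exists phi : X -> Y, [/\ continuous phi, injective phi,
    forall x (U : set X), nbhs x U ->
      exists2 r : R, 0 < r & forall x', mdist (phi x) (phi x') < r -> U x'
  & range phi = A].
Proof.
move=> [f [g [cf cg fg gf]]]; exists (fun x => set_val (f x)); split.
- move=> x; apply: (@continuous_comp _ _ _ f); first exact: cf.
  exact: initial_continuous.
- by move=> x y /val_inj /(can_inj fg).
- move=> x U nU; have := cg (f x); rewrite /continuous_at fg => /(_ U nU).
  move=> /nbhs_set_type[V /nbhs_mdist_ex[r r0 rV] VU]; exists r => // x' xx'.
  by have /= := VU (f x') (rV _ xx'); rewrite fg.
- apply/seteqP; split=> [_ [x _ <-]|y Ay]; first exact: set_valP.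
  exists (g (exist _ y (mem_set Ay))) => //.
  by rewrite gf.
Qed.

Lemma homeomorphic_setT (X Y : topologicalType) :
  homeomorphic X Y -> homeomorphic X [set: Y].
Proof.
move=> [f [g [cf cg fg gf]]].
exists (fun x => exist _ (f x) (mem_set I) : [set: Y]), (fun y => g (set_val y)).
split.
- move=> x U /nbhs_set_type[V nV VU]; have H : nbhs x (f @^-1` V) := cf x V nV.
  by apply: filterS H => x' Vx'; exact: VU.
- move=> y; apply: (@continuous_comp _ _ _ set_val); last exact: cg.
  exact: initial_continuous.
- by move=> x /=; rewrite fg.
- by move=> y; apply: val_inj; rewrite /= gf.
Qed.

Lemma injective_hausdorff (X Y : topologicalType) (phi : X -> Y) :
  continuous phi -> injective phi -> hausdorff_space Y -> hausdorff_space X.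
Proof.
move=> cphi iphi hY p q pq; apply: iphi; apply: hY => A B nA nB.
have [x [Ax Bx]] := pq _ _ (cphi p A nA) (cphi q B nB).
by exists (phi x).
Qed.

Lemma metrizable_embedding (R : realType) (X : topologicalType) :
  metrizable R X -> exists (Y : metricType R) (phi : X -> Y),
    [/\ continuous phi, injective phi
      & forall x (U : set X), nbhs x U ->
        exists2 r : R, 0 < r & forall x', mdist (phi x) (phi x') < r -> U x'].
Proof.
move=> [M /homeomorphic_setT /homeomorphic_embedding[phi [cphi iphi ephi _]]].
by exists M, phi.
Qed.

(** Pieces of mesh below a Lebesgue number, slightly fattened, refine the cover. Fattened pieces of
    one colour stay disjoint, so a point lies in at most one member per colour. *)
Lemma covering_dim_colored (R : realType) (X : topologicalType)
    (Y : metricType R) (phi : X -> Y) (F : set X) (C : finType) :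
  continuous phi -> injective phi ->
  (forall x (U : set X), nbhs x U ->
    exists2 r : R, 0 < r & forall x', mdist (phi x) (phi x') < r -> U x') ->
  compact F -> colored_covers phi F C -> covering_dim_le F #|C|.
Proof.
move=> cphi iphi ephi cF colF U finU [oU UT].
have [mu mu0 muP] : exists2 mu : R, 0 < mu & forall x : F, exists2 A : set F, U A &
    forall x' : F, mdist (phi (set_val x)) (phi (set_val x')) < mu -> A x'.
  pose P (mu : R) x := exists2 A : set F, U A &
    forall x' : F, mdist (phi x) (phi (set_val x')) < mu -> A x'.
  have /compact_near_coveringP/(_ R (0 : R)^'+ P _) H := cF.
  have {}H : \forall mu \near (0 : R)^'+, F `<=` P mu.
    apply: H => x Fx; pose a : F := exist _ x (mem_set Fx).
    have [A UA Aa] : (\bigcup_(A in U) A) a by rewrite UT.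
    have /nbhs_set_type[V /ephi[r r0 rV] VA] := open_nbhs_nbhs (conj (oU A UA) Aa).
    have r2 : 0 < r / 2 by lra.
    exists ([set x' | mdist (phi x) (phi x') < r / 2], [set mu | mu < r / 2]) => /=.
      by split; [exact: nbhs_mdistl (@cphi x) r2 | exact: nbhs_right_lt].
    move=> [x1 mu] [/= xx1 mur]; exists A => // x' xx'; apply/VA/rV.
    by have := metric_triangle (phi x) (phi x1) (phi (set_val x')); rewrite /=; lra.
  near (0 : R)^'+ => mu; exists mu; first by near: mu; exact: nbhs_right_gt.
  have muP : F `<=` P mu by near: mu.
  by move=> x; apply: muP; exact: set_valP.
have mu2 : 0 < mu / 2 by lra.
have [I [col [B [cB FB dB disB]]]] := colF (mu / 2) mu2.
have [rho [rho0 rhomu rhoB]] := colors_apart cphi iphi cB disB mu2.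
pose W i : set F := [set y | exists2 x, B i x & mdist (phi x) (phi (set_val y)) < rho].
have W1 i j y : col i = col j -> W i y -> W j y -> i = j.
  move=> ijc [x Bx xy] [x' Bx' xy']; apply/eqP/contraT => ij.
  have := rhoB i j ij ijc x x' Bx Bx'.
  have := metric_triangle (phi x) (phi (set_val y)) (phi x').
  by rewrite (metric_sym (phi (set_val y))); lra.
exists [set W i | i in [set i | B i !=set0]]; split.
- exact: finite_image.
- split.
    move=> _ [i _ <-]; rewrite openE => y [x Bx xy].
    have e0 : 0 < rho - mdist (phi x) (phi (set_val y)) by lra.
    apply/nbhs_set_type; exists [set z | mdist (phi (set_val y)) (phi z) < rho - mdist (phi x) (phi (set_val y))].
      exact: nbhs_mdistl (@cphi _) e0.
    move=> z /= yz; exists x => //.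
    by have := metric_triangle (phi x) (phi (set_val y)) (phi (set_val z)); lra.
  apply/seteqP; split=> // y _.
  have : F (set_val y) by exact: set_valP.
  rewrite {1}FB => -[i _ By]; exists (W i); first by exists i => //; exists (set_val y).
  by exists (set_val y); rewrite ?mdistxx.
- move=> _ [i [x Bx] <-].
  have Fx : F x by rewrite FB; exists i.
  have [A UA AP] := muP (exist _ x (mem_set Fx)); exists A => // y [x' Bx' xy].
  apply: AP; have /= := dB i _ _ Bx Bx'.
  by have := metric_triangle (phi x) (phi x') (phi (set_val y)); lra.
(* [f] sends the rank of a colour to the only member of that colour through [y]. *)
- move=> y; pose f (k : nat) : set F :=
    if [pick i : I | `[< W i y >] && (enum_rank (col i) == k :> nat)] is Some i then W i else set0.
  apply: (card_le_trans _ (card_image_le f _)); apply: subset_card_le.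
  move=> _ [[i _ <-] Wy]; exists (enum_rank (col i)) => /=.
    by apply: leq_trans (ltn_ord _) _.
  rewrite /f; case: pickP => [j /andP[/asboolP Wj /eqP ij]|/(_ i)].
    by rewrite (@W1 j i y) //; apply: enum_rank_inj; apply: val_inj.
  by rewrite eqxx andbT => /asboolP.
Unshelve. all: by end_near. Qed.

Definition has_compact_cells (R : realType) (X : topologicalType) :=
  exists (N : nat -> nat) (K : forall j, set 'rV[R]_(N j))
    (psi : forall j, 'rV[R]_(N j) -> X),
  [/\ forall j, compact (K j), forall j, {within K j, continuous (psi j)},
      forall j, {in K j &, injective (psi j)}
    & \bigcup_j [set psi j x | x in K j] = setT].

(** The empty space is treated apart, since the operators need a base point; the cells are assumed
    only for an inhabited [X], since their construction needs a default value. *)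
Lemma compact_cells_ANR (R : realType) (X : topologicalType) :
  metrizable R X -> (X -> has_compact_cells R X) -> locally_contractible R X ->
  [/\ sigma_compact X, strongly_countable_dimensional X
    & absolute_neighborhood_retract R X].
Proof.
move=> mX HX lcX; have [[x0 _]|X0] := pselect (exists x : X, True); last first.
  split.
  - exists (fun=> set0); split=> [_|]; first exact: compact0.
    by apply/seteqP; split=> // x; case: X0; exists x.
  - exists (fun=> set0); split=> [_|_|]; first exact: closed0; last first.
      by apply/seteqP; split=> // x; case: X0; exists x.
    exists 0 => U finU cU; exists U; split=> // [B UB|x]; first by exists B.
    by have := set_valP x.
  - split=> // Y A clA /homeomorphic_embedding[phi [_ _ _ rphi]].
    exists set0; rewrite -rphi; split; first exact: open0.
      by move=> y [x _ _]; case: X0; exists x.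
    exists id; split; first exact: continuous_subspace0.
      by move=> _ [y [] _].
    by move=> y; rewrite inE => -[x _ _]; case: X0; exists x.
have [N [K [psi [cK cpsi ipsi KT]]]] := HX x0.
pose F j := [set psi j x | x in K j].
have cF j : compact (F j) by apply: continuous_compact.
split.
- by exists F; split.
- have [Y [phi [cphi iphi ephi]]] := metrizable_embedding mX.
  exists F; split=> // j.
    apply: compact_closed => //.
    by apply: (injective_hausdorff cphi iphi); exact: metric_hausdorff.
  exists #|{ffun 'I_(N j) -> bool}|.
  apply: (covering_dim_colored cphi iphi ephi (cF j)).
  by apply: colored_covers_image.
- split=> // Y A clA /homeomorphic_embedding[phi [cphi iphi ephi rphi]].
  rewrite -rphi in clA *.
  apply: (neighborhood_retract_range cphi iphi ephi lcX cF _ KT clA x0).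
  by move=> j; apply: colored_covers_image.
Qed.

(** * The Hausdorff distance *)

(** A Lebesgue number argument: half of the local radius at [x] leaves room for moving the first
    point, and compactness makes the radius uniform. *)
Lemma compact_uniform (R : realType) (V : normedModType R) (C : set V) (P : V -> V -> Prop) :
  compact C ->
  (forall x, C x -> exists2 r, 0 < r & forall y z, `|x - y| < r -> `|x - z| < r -> P y z) ->
  exists2 r, 0 < r & forall y z, C y -> `|y - z| < r -> P y z.
Proof.
move=> cC CP; pose Q (r : R) x := forall z, `|x - z| < r -> P x z.
have /compact_near_coveringP/(_ R (0 : R)^'+ Q _) H := cC.
have {}H : \forall r \near (0 : R)^'+, C `<=` Q r.
  apply: H => x /CP[r r0 rP].
  exists ([set y | `|x - y| < r / 2], [set h | h < r / 2]) => /=.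
    split; last by apply: nbhs_right_lt; lra.
    by apply/nbhs_normP; exists (r / 2) => //=; lra.
  move=> [y s] [/= xy sr] z yz; apply: rP; first lra.
  by have := ler_distD y x z; lra.
near (0 : R)^'+ => r; exists r; first by near: r; exact: nbhs_right_gt.
have rP : C `<=` Q r by near: r.
by move=> x y /rP; exact.
Unshelve. all: by end_near. Qed.

Section HausdorffDistance.
Context {R : realType} {V : normedModType R}.
Implicit Types (C D E : set V) (r : R).

Definition hclose r C D := (forall x, C x -> exists2 y, D y & `|x - y| < r) /\
  (forall y, D y -> exists2 x, C x & `|x - y| < r).

Lemma hclose_refl r C : 0 < r -> hclose r C C.
Proof. by move=> r0; split=> x Cx; exists x; rewrite // subrr normr0. Qed.

Lemma hclose_sym r C D : hclose r C D -> hclose r D C.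
Proof.
by move=> [CD DC]; split=> [x /DC|x /CD] [y ? ?]; exists y; rewrite // distrC.
Qed.

Lemma hclose_trans r s C D E : hclose r C D -> hclose s D E -> hclose (r + s) C E.
Proof.
move=> [CD DC] [DE ED]; split=> [x /CD[y /DE[z Ez yz] xy]|z /ED[y /DC[x Cx xy] yz]].
  by exists z => //; have := ler_distD y x z; lra.
by exists x => //; have := ler_distD y x z; lra.
Qed.

Lemma hclose_le r s C D : r <= s -> hclose r C D -> hclose s C D.
Proof.
move=> rs [CD DC]; split=> [x /CD|x /DC] [y ? xy]; exists y => //;
  exact: lt_le_trans xy rs.
Qed.

Lemma hyperspace_continuum (C : hyperspace V) : continuum (hset C).
Proof. exact: set_mem (valP C). Qed.

Lemma compact_fattening C (O : set V) : compact C -> open O -> C `<=` O ->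
  exists2 r : R, 0 < r & forall x y, C x -> `|x - y| < r -> O y.
Proof.
move=> cC oO CO; apply: (@compact_uniform R V C (fun _ y => O y)) => // x Cx.
have /nbhs_normP[r /= r0 rO] : nbhs x O by apply: open_nbhs_nbhs; split=> //; exact: CO.
by exists r => // _ y _; exact: rO.
Qed.

(** The Vietoris topology is that of the Hausdorff distance. One way, a fattening of the compact set
    [C] stays in the union of the open sets, and one point of [C] in each of them has a ball to
    spare. The other way, balls of radius [r / 2] about finitely many points of [C] form a basic
    open set. *)
Lemma nbhs_hyperspace (C : hyperspace V) (U : set (hyperspace V)) :
  nbhs C U <-> exists2 r, 0 < r & forall D : hyperspace V, hclose r (hset C) (hset D) -> U D.
Proof.
have [[c0 Cc0] cC _] := hyperspace_continuum C.
split=> [|[r r0 rU]].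
  rewrite nbhsE => -[B [[I ID <-] [[n W] InW [CW WC]]] BU].
  have [n0 oW] := ID _ InW; rewrite /= in n0 oW CW WC.
  have [|r r0 rP] := compact_fattening cC _ CW.
    by apply: bigcup_open => k /= kn; exact: oW.
  have /choice[s sP] : forall k : 'I_n, exists s : R, 0 < s /\
      exists2 x, hset C x & forall y, `|x - y| < s -> W k y.
    move=> k; have [x [Wx Cx]] := WC k (ltn_ord k).
    have /nbhs_normP[s /= s0 sW] : nbhs x (W k).
      by apply: open_nbhs_nbhs; split=> //; exact: (oW k (ltn_ord k)).
    by exists s; split=> //; exists x => // y; exact: sW.
  pose t := \big[Num.min/r]_(k < n) s k.
  have t0 : 0 < t.
    by apply: lt_bigmin => // k _; have [] := sP k.
  exists t => // D [CD DC]; apply: BU; exists (n, W) => //; split=> /=.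
    move=> y /DC[x Cx xy]; apply: rP Cx (lt_le_trans xy _).
    exact: bigmin_le_id.
  move=> k kn; have [_ [x Cx xW]] := sP (Ordinal kn).
  have [y Dy xy] := CD x Cx; exists y; split=> //.
  apply: xW; apply: lt_le_trans xy _.
  exact: (@bigmin_le_cond _ _ _ r (Ordinal kn) xpredT s).
have r2 : 0 < r / 2 by lra.
have [K KC CK] : finite_subset_cover (hset C) (fun x : V => ball x (r / 2)) (hset C).
  have : cover_compact (hset C) by rewrite -compact_cover.
  apply=> [x _|x Cx]; first exact: ball_open.
  by exists x => //; exact: ballxx.
pose Ks : seq V := finmap.enum_fset K.
(* The extra centre [c0] makes the number of balls visibly positive, as [vietoris_index] demands. *)
pose c k := nth c0 (c0 :: Ks) k.
have cC' k : (k < (size Ks).+1)%N -> hset C (c k).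
  case: k => // k; rewrite ltnS => kK.
  by have := KC _ (mem_nth c0 kK); rewrite inE.
have Cc x : hset C x -> exists2 k, (k < (size Ks).+1)%N & `|c k - x| < r / 2.
  move=> /CK[y /= yK]; rewrite -ball_normE /= => yx.
  exists (index y Ks).+1; first by rewrite ltnS index_mem.
  by rewrite /c /= nth_index.
have bC : vietoris_base ((size Ks).+1, fun k => ball (c k) (r / 2)) C.
  split=> /= [x /Cc[k kK ckx]|k kK]; first by exists k => //; rewrite -ball_normE.
  by exists (c k); split; [exact: ballxx | exact: cC'].
rewrite nbhsE; exists (vietoris_base ((size Ks).+1, fun k => ball (c k) (r / 2))).
  split=> //; exists [set ((size Ks).+1, fun k => ball (c k) (r / 2))].
    by move=> _ ->; split=> //= k _; exact: ball_open.
  by rewrite bigcup_set1.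
move=> D [/= Db bD]; apply: rU; split=> [x /Cc[k kK ckx]|y /Db[k /= kK]].
  have [y [+ Dy]] := bD k kK; rewrite -ball_normE /= => cky.
  by exists y => //; have := ler_distD (c k) x y; rewrite (distrC x (c k)); lra.
rewrite -ball_normE /= => cky; exists (c k); first exact: cC'.
lra.
Qed.

Lemma nbhs_hyperspace_sub (A : set (hyperspace V)) (C : A) (U : set A) :
  nbhs C U <-> exists2 r, 0 < r &
    forall D : A, hclose r (hset (val C)) (hset (val D)) -> U D.
Proof.
split=> [/nbhs_set_type[W /nbhs_hyperspace[r r0 rW] WU]|[r r0 rU]].
  by exists r => // D CD; apply/WU/rW.
apply/nbhs_set_type; exists [set D | hclose r (hset (val C)) (hset D)] => //.
by apply/nbhs_hyperspace; exists r.
Qed.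

Lemma compact_near_closure C D : closed D ->
  (forall r, 0 < r -> forall x, C x -> exists2 y, D y & `|x - y| < r) -> C `<=` D.
Proof.
move=> cD CD x Cx; apply: cD => W /nbhs_normP[r /= r0 rW].
by have [y Dy xy] := CD r r0 x Cx; exists y; split=> //; exact: rW.
Qed.

Lemma hclose_ex C D : C !=set0 -> D !=set0 -> compact C -> compact D ->
  exists r : R, hclose r C D.
Proof.
move=> [c Cc] [d Dd] /compact_bounded[M [_ MP]] /compact_bounded[N [_ NP]].
have MC x : C x -> `|x| <= M + 1 by apply: MP; rewrite ltrDl.
have ND x : D x -> `|x| <= N + 1 by apply: NP; rewrite ltrDl.
exists (M + 1 + (N + 1) + 1); split=> [x Cx|y Dy].
  exists d => //; have := ler_normB x d; have := MC x Cx; have := ND d Dd; lra.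
exists c => //; have := ler_normB c y; have := MC c Cc; have := ND y Dy; lra.
Qed.

Lemma hclose_gt0 r C D : C !=set0 -> hclose r C D -> 0 < r.
Proof. by move=> [x /[swap] -[+ _] Cx] => /(_ x Cx)[y _]; apply: le_lt_trans. Qed.

Definition hdist C D : R := inf [set r | hclose r C D].

End HausdorffDistance.

(** A copy of the subspace that carries the metric topology, while [A] itself keeps the Vietoris
    topology; [hyperspace_metrizable] compares the two by the identity. *)
Definition hausdorff_type (R : realType) (V : normedModType R)
  (A : set (hyperspace V)) : Type := A.

Section HausdorffMetric.
Context {R : realType} {V : normedModType R} (A : set (hyperspace V)).
Implicit Types C D E : hausdorff_type A.

Let hs C : set V := hset (val C).

Let hs0 C : hs C !=set0. Proof. by have [] := hyperspace_continuum (val C). Qed.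
Let hsc C : compact (hs C). Proof. by have [] := hyperspace_continuum (val C). Qed.

Lemma hdist_ge0 C D : 0 <= hdist (hs C) (hs D).
Proof.
have [r CD] := hclose_ex (hs0 C) (hs0 D) (@hsc C) (@hsc D).
by apply: lb_le_inf; [exists r | move=> s /(hclose_gt0 (hs0 C)) /ltW].
Qed.

Lemma hdist_le C D (r : R) : hclose r (hs C) (hs D) -> hdist (hs C) (hs D) <= r.
Proof.
move=> CD; apply: ge_inf => //.
by exists 0 => s /(hclose_gt0 (hs0 C)) /ltW.
Qed.

Lemma hdist_lt C D (r : R) : hdist (hs C) (hs D) < r -> hclose r (hs C) (hs D).
Proof.
have [s CD] := hclose_ex (hs0 C) (hs0 D) (@hsc C) (@hsc D).
move=> /inf_lt[]; first by exists s.
by move=> t Ct /ltW tr; exact: hclose_le tr Ct.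
Qed.

Let hdistxx C : hdist (hs C) (hs C) = 0.
Proof.
apply/eqP; rewrite eq_le hdist_ge0 andbT; apply/ler_addgt0Pl => e e0.
by rewrite addr0; apply: hdist_le; exact: hclose_refl.
Qed.

Let hdist_eq0 C D : hdist (hs C) (hs D) = 0 -> C = D.
Proof.
move=> CD0; do 2 apply: val_inj; apply/seteqP.
have H r : 0 < r -> hclose r (hs C) (hs D) by move=> r0; apply: hdist_lt; rewrite CD0.
split; apply: compact_near_closure.
- exact: compact_closed (@norm_hausdorff _ _) (@hsc D).
- by move=> r r0; have [] := H r r0.
- exact: compact_closed (@norm_hausdorff _ _) (@hsc C).
- by move=> r r0; have [] := hclose_sym (H r r0).
Qed.

Let hdist_sym C D : hdist (hs C) (hs D) = hdist (hs D) (hs C).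
Proof.
by congr inf; apply/seteqP; split=> r; exact: hclose_sym.
Qed.

Let hdist_triangle D C E : hdist (hs C) (hs E) <= hdist (hs C) (hs D) + hdist (hs D) (hs E).
Proof.
apply/ler_addgt0Pl => e e0.
have CD : hclose (hdist (hs C) (hs D) + e / 2) (hs C) (hs D) by apply: hdist_lt; lra.
have DE : hclose (hdist (hs D) (hs E) + e / 2) (hs D) (hs E) by apply: hdist_lt; lra.
by apply: le_trans (hdist_le (hclose_trans CD DE)) _; lra.
Qed.

HB.instance Definition _ := Choice.on (hausdorff_type A).
HB.instance Definition _ := isMetric.Build R (hausdorff_type A)
  hdistxx hdist_eq0 hdist_sym hdist_triangle.

Lemma hyperspace_metrizable : metrizable R A.
Proof.
exists (hausdorff_type A), id, id; split=> //.
- move=> C U /nbhs_mdist_ex[r r0 rU]; apply/nbhs_hyperspace_sub.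
  exists (r / 2) => [|D CD]; first lra.
  by apply: rU; apply: le_lt_trans (hdist_le CD) _; lra.
- move=> C U /nbhs_hyperspace_sub[r r0 rU]; apply: filterS (mdist_nbhs (C : hausdorff_type A) r0) => D.
  by move=> /hdist_lt CD; apply: rU.
Qed.

End HausdorffMetric.

(** * Loops and polygons *)

(** A continuous surjection [a] from a compact set to a Hausdorff space is a quotient map. Points of
    [K] whose image is not [p] are separated from [p], and those over [p] are handled by continuity
    of [b]; compactness combines the two. *)
Lemma factor_continuous (T P S : topologicalType) (K : set T) (a : T -> P)
    (b : T -> S) (F : P -> S) : compact K -> {within K, continuous a} ->
  {within K, continuous b} -> hausdorff_space P ->
  (forall x, K x -> F (a x) = b x) -> (forall p, exists2 x, K x & a x = p) ->
  continuous F.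
Proof.
move=> cK /subspace_continuousP ca /subspace_continuousP cb hP Fab aT p U nU.
have /compact_near_coveringP/near_covering_withinP
  /(_ P (nbhs p) (fun q x => a x = q -> U (F q)) _) H := cK.
have {}H : \forall q \near p, K `<=` (fun x => a x = q -> U (F q)).
  apply: H => x Kx.
  have [axp|axp] := eqVneq (a x) p.
    have nb : \forall x' \near x, K x' -> U (b x').
      have nbU : nbhs (b x) U by rewrite -Fab // axp.
      exact: (cb x Kx U nbU).
    exists ([set x' | K x' -> U (b x')], setT) => /=; first by split=> //; exact: filterT.
    by move=> [x' q] [/= Ub _] Kx' <-; rewrite Fab //; exact: Ub.
  have := hP; rewrite open_hausdorff => /(_ _ _ axp) [[A B] [/= Aa Bp] [oA oB AB]].
  have na : \forall x' \near x, K x' -> A (a x').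
    by apply: (ca x Kx); apply: open_nbhs_nbhs; split=> //; exact: set_mem.
  exists ([set x' | K x' -> A (a x')], B) => /=.
    by split=> //; apply: open_nbhs_nbhs; split=> //; exact: set_mem.
  move=> [x' q] [/= Aax' Bq] Kx' E; have := Aax' Kx'; rewrite E => Aq.
  by have : (A `&` B) q by []; rewrite (eqP AB).
have H' : \forall q \near p, U (F q).
  by apply: filterS H => q Hq; have [x Kx ax] := aT q; exact: (Hq x Kx ax).
exact: H'.
Qed.

Lemma set_val_injective (T : Type) (A : set T) : injective (@set_val T A).
Proof. by move=> x y /val_inj. Qed.

(** * Simple closed curves as traces of loops *)

Section Loops.
Context {R : realType}.

Definition is_loop (T : topologicalType) (f : R -> T) :=
  [/\ {within `[0, 1], continuous f}, f 0 = f 1 & {in `[0, 1[ &, injective f}].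

Definition trace (T : topologicalType) (f : R -> T) : set T :=
  [set f t | t in `[0, 1]].

Lemma clip01_in (t : R) : clip01 t \in `[0, 1].
Proof. by rewrite in_itv /= clip01_itv. Qed.

(** Clipping the parameter makes the corestriction a total function on the line. *)
Definition loop_corestr (T : topologicalType) (f : R -> T) (t : R) : trace f :=
  exist _ (f (clip01 t)) (mem_set (ex_intro2 _ _ (clip01 t) (clip01_in t) erefl)).

Lemma loop_corestrE (T : topologicalType) (f : R -> T) t : t \in `[0, 1] ->
  set_val (loop_corestr f t) = f t.
Proof. by rewrite in_itv set_valE /= => t01; rewrite clip01_id. Qed.

Lemma loop_corestr_continuous (T : topologicalType) (f : R -> T) :
  {within `[0, 1], continuous f} -> {within `[0, 1], continuous (loop_corestr f)}.
Proof.
move=> /subspace_continuousP cf; apply/subspace_continuousP => t t01 U.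
move=> /nbhs_set_type[V nV VU].
rewrite loop_corestrE // in nV.
have : nbhs (f @ within `[0,1] (nbhs t)) V := cf t t01 V nV.
apply: filterS2 (withinT _ _) => s s01 Vs.
by apply: VU; rewrite loop_corestrE.
Qed.

Lemma loop_eq (T : topologicalType) (f : R -> T) s t : is_loop f ->
  s \in `[0, 1] -> t \in `[0, 1] -> f s = f t ->
  s = t \/ (s = 0 /\ t = 1) \/ (s = 1 /\ t = 0).
Proof.
move=> [_ f01 fi]; rewrite !in_itv /= => /andP[s0 s1] /andP[t0 t1] fst.
have [s1'|s1'] := eqVneq s 1; have [t1'|t1'] := eqVneq t 1.
- by left; rewrite s1'.
- right; right; split=> //; apply: fi; rewrite ?in_itv /= ?t0 ?lexx ?ltr01 //.
    by rewrite lt_neqAle t1'.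
  by rewrite -fst s1'.
- right; left; split=> //; apply: fi; rewrite ?in_itv /= ?s0 ?lexx ?ltr01 //.
    by rewrite lt_neqAle s1'.
  by rewrite fst t1'.
- by left; apply: fi => //; rewrite in_itv /= ?s0 ?t0 lt_neqAle ?s1' ?t1'.
Qed.

Lemma set_type_hausdorff (T : topologicalType) (A : set T) :
  hausdorff_space T -> hausdorff_space A.
Proof.
move=> hT; apply: (@injective_hausdorff _ _ (@set_val _ A)) => //.
exact: initial_continuous.
Qed.

(** Any two loops identify the same parameters, namely 0 and 1, so following the parameter is well
    defined on the trace. *)
Lemma loop_map (T T' : topologicalType) (f : R -> T) (g : R -> T') :
  hausdorff_space T -> is_loop f -> is_loop g ->
  exists2 F : trace f -> trace g, continuous F &
    forall t, t \in `[0, 1] -> F (loop_corestr f t) = loop_corestr g t.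
Proof.
move=> hT lf lg.
have /choice[tau tauP] : forall p : trace f, exists t, t \in `[0, 1] /\ f t = set_val p.
  by move=> p; have [t t01 ft] := set_valP p; exists t.
pose F p := loop_corestr g (tau p).
have FE t : t \in `[0, 1] -> F (loop_corestr f t) = loop_corestr g t.
  move=> t01; have [s01 sE] := tauP (loop_corestr f t).
  apply: set_val_injective; rewrite !loop_corestrE //.
  move: s01 sE; rewrite loop_corestrE //; set s := tau _ => s01 sE.
  have [_ g01 _] := lg.
  by have [->|[[-> ->]|[-> ->]]] := loop_eq lf s01 t01 sE.
have [cf _ _] := lf; have [cg _ _] := lg.
exists F => //.
have surj p : exists2 t, [set` `[0, 1]] t & loop_corestr f t = p.
  have [t01 tE] := tauP p; exists (tau p) => //.
  by apply: set_val_injective; rewrite loop_corestrE.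
exact: (factor_continuous (@segment_compact R 0 1) (loop_corestr_continuous cf)
  (loop_corestr_continuous cg) (@set_type_hausdorff _ _ hT) FE surj).
Qed.

Lemma loops_homeomorphic (T T' : topologicalType) (f : R -> T) (g : R -> T') :
  hausdorff_space T -> hausdorff_space T' -> is_loop f -> is_loop g ->
  homeomorphic (trace f) (trace g).
Proof.
move=> hT hT' lf lg; have [F cF FE] := loop_map hT lf lg.
have [G cG GE] := loop_map hT' lg lf; exists F, G; split=> //.
- move=> p; have [t t01 ft] := set_valP p.
  have -> : p = loop_corestr f t by apply: set_val_injective; rewrite loop_corestrE.
  by rewrite FE // GE.
- move=> p; have [t t01 ft] := set_valP p.
  have -> : p = loop_corestr g t by apply: set_val_injective; rewrite loop_corestrE.
  by rewrite GE // FE.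
Qed.

Definition circle_loop (t : R) : 'rV[R]_2 :=
  \row_j (if j == ord0 then cos (t * (2 * pi)) else sin (t * (2 * pi))).

Lemma matrix_continuous (T : topologicalType) m n (f : T -> 'M[R]_(m, n)) (t : T) :
  (forall i j, {for t, continuous (fun s => f s i j)}) -> {for t, continuous f}.
Proof.
move=> H; apply/cvgrPdist_le => e e0.
have : \forall s \near t, forall i j, `|f t i j - f s i j| <= e.
  apply: filter_forall => i; apply: filter_forall => j.
  by have /cvgrPdist_le := H i j; exact.
apply: filterS => s Hs; apply: ler_norm_coord; first exact: ltW.
by move=> i j; rewrite !mxE.
Qed.

Lemma circle_loopP : is_loop circle_loop /\ trace circle_loop = @circle R.
Proof.
have p0 := @pi_gt0 R.
have ord_max_neq0 : (@ord_max 1 == ord0) = false by [].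
split; first split.
- apply: continuous_subspaceT => t; apply: matrix_continuous => i j.
  have ct : {for t, continuous (fun t : R => t * (2 * pi))}.
    by apply: cvgM; [exact: cvg_id | exact: cvg_cst].
  have -> : (fun s => circle_loop s i j) =
      (fun s => if j == ord0 then cos (s * (2 * pi)) else sin (s * (2 * pi))).
    by apply/funext => s; rewrite mxE.
  by case: (j == ord0); apply: continuous_comp ct _; [exact: continuous_cos | exact: continuous_sin].
- apply/rowP => j; rewrite !mxE mul0r mul1r cos0 sin0 mulr_natl.
  by rewrite cos2pi sin2pi.
(* Equal values would make the cosine of [2 * pi * (t - s)] equal to 1, hence the sine of
   [pi * (t - s)] equal to 0, which is impossible for [0 < t - s < 1]. *)
- have inj s t : 0 <= s -> s < t -> t < 1 -> circle_loop s <> circle_loop t.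
    move=> s0 st t1 E; have := congr1 (fun x : 'rV[R]_2 => x ord0 ord0) E.
    have := congr1 (fun x : 'rV[R]_2 => x ord0 ord_max) E.
    rewrite !mxE ord_max_neq0 eqxx => Es Ec.
    have := cosB (t * (2 * pi)) (s * (2 * pi)); rewrite Es Ec -!expr2 cos2Dsin2.
    have -> : t * (2 * pi) - s * (2 * pi) = ((t - s) * pi) *+ 2 by rewrite mulr2n; ring.
    rewrite cos_mulr2n => C1.
    have : 0 < sin ((t - s) * pi).
      apply: sin_gt0_pi; apply/andP; split; first by apply: mulr_gt0 => //; lra.
      by rewrite gtr_pMl //; lra.
    have := cos2Dsin2 ((t - s) * pi).
    move: (sin _) C1 => S; move: (cos _) => D C1 C2 S0.
    have : S ^+ 2 = 0 by lra.
    by move/eqP; rewrite sqrf_eq0 => /eqP; lra.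
  move=> s t; rewrite !in_itv /= => /andP[s0 s1] /andP[t0 t1] E.
  case: (ltgtP s t) => // st; first by have := inj s t s0 st t1.
  by have := inj t s t0 st s1; case.
- apply/seteqP; split=> [_ [t _ <-]|v].
    by rewrite /circle /= !mxE ord_max_neq0 eqxx cos2Dsin2.
  rewrite /circle /=; set x := v ord0 ord0; set y := v ord0 ord_max => xy.
  have x1 : -1 <= x <= 1.
    by have y0 := sqr_ge0 y; apply/andP; split; nra.
  have y2 : sin (acos x) = `|y|.
    have xy2 : 1 - x ^+ 2 = y ^+ 2 by lra.
    by rewrite sin_acos // xy2 sqrtr_sqr.
  have a0 := acos_ge0 x1; have api := acos_lepi x1.
  have E : v = \row_j (if j == ord0 then x else y).
    apply/rowP => j; rewrite mxE; case: eqP => [->//|/eqP j0].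
    by rewrite /y; congr (v _ _); apply/val_inj; case: j j0 => -[|[|]].
  have [y0|y0] := leP 0 y.
    exists (acos x / (2 * pi)).
      rewrite /= in_itv /=; apply/andP; split; first by apply: divr_ge0 => //; lra.
      by rewrite ler_pdivrMr; lra.
    rewrite /circle_loop divfK; last by apply: lt0r_neq0; lra.
    by rewrite E acosK // y2 ger0_norm.
  exists (1 - acos x / (2 * pi)).
    rewrite /= in_itv /=; apply/andP; split.
      by rewrite subr_ge0 ler_pdivrMr; lra.
    by rewrite gerBl; apply: divr_ge0 => //; lra.
  rewrite /circle_loop mulrBl mul1r divfK; last by apply: lt0r_neq0; lra.
  have -> : 2 * pi - acos x = - acos x + pi *+ 2 :> R by rewrite mulr2n; ring.
  rewrite cosD2pi sinD2pi.
  by rewrite E cosN sinN acosK // y2 ltr0_norm // opprK.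
Qed.

Lemma simple_closed_curveP (T : topologicalType) (C : set T) : hausdorff_space T ->
  @simple_closed_curve R T C <-> exists2 f : R -> T, is_loop f & C = trace f.
Proof.
have [lc tc] := circle_loopP => hT; rewrite /simple_closed_curve -tc; split.
  move=> [h [k [ch ck hk kh]]].
  pose f t := set_val (h (loop_corestr circle_loop t)).
  have fE s t : s \in `[0, 1] -> t \in `[0, 1] -> f s = f t -> circle_loop s = circle_loop t.
    move=> s01 t01 /set_val_injective /(can_inj hk) /(congr1 set_val).
    by rewrite !loop_corestrE.
  have [cc c01 ci] := lc.
  have in0 : (0 : R) \in `[0, 1] by rewrite in_itv /= lexx ler01.
  have in1 : (1 : R) \in `[0, 1] by rewrite in_itv /= lexx ler01.
  exists f; first split.
  - have cvh : continuous (fun p => set_val (h p)).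
      move=> p; apply: (@continuous_comp _ _ _ h); first exact: ch.
      exact: initial_continuous.
    apply/subspace_continuousP => t t01.
    have /subspace_continuousP/(_ t t01) cl := loop_corestr_continuous cc.
    exact: (cvg_comp _ _ cl (cvh _)).
  - rewrite /f; congr (set_val (h _)); apply: set_val_injective.
    by rewrite !loop_corestrE.
  - move=> s t s1 t1; have sub u : u \in `[0, 1[ -> u \in `[0, (1 : R)].
      by rewrite !in_itv /= => /andP[-> /ltW].
    by move/(fE _ _ (sub _ s1) (sub _ t1)); exact: ci.
  - apply/seteqP; split=> [x Cx|_ [t t01 <-]]; last exact: set_valP.
    pose p := k (exist _ x (mem_set Cx)).
    have [t t01 tp] := set_valP p; exists t => //; rewrite /f.
    have -> : loop_corestr circle_loop t = p by apply: set_val_injective; rewrite loop_corestrE.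
    by rewrite kh.
move=> [f lf ->]; apply: loops_homeomorphic => //; exact: norm_hausdorff.
Qed.

End Loops.

Section PointwiseContinuity.
Context {R : realType} {V : normedModType R} {T : topologicalType}.
Implicit Types (f g : T -> V) (k : T -> R) (t : T).

Lemma cont_cst (U : topologicalType) (u : U) t : {for t, continuous (fun=> u)}.
Proof. exact: cvg_cst. Qed.

Lemma cont_add f g t : {for t, continuous f} -> {for t, continuous g} ->
  {for t, continuous (fun s => f s + g s)}.
Proof. by move=> cf cg; exact: cvgD. Qed.

Lemma cont_sub f g t : {for t, continuous f} -> {for t, continuous g} ->
  {for t, continuous (fun s => f s - g s)}.
Proof. by move=> cf cg; exact: cvgB. Qed.

Lemma cont_scale k f t : {for t, continuous k} -> {for t, continuous f} ->
  {for t, continuous (fun s => k s *: f s)}.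
Proof. by move=> cf cg; exact: cvgZ. Qed.

Lemma cont_mul k k' t : {for t, continuous k} -> {for t, continuous k'} ->
  {for t, continuous (fun s => k s * k' s)}.
Proof. by move=> cf cg; exact: cvgM. Qed.

End PointwiseContinuity.

Lemma cont_coord (R : realType) (T : topologicalType) m n (f : T -> 'M[R]_(m, n))
    i j t : {for t, continuous f} -> {for t, continuous (fun s => f s i j)}.
Proof.
by move=> cf; apply: (@continuous_comp _ _ _ f (fun M : 'M[R]_(m, n) => M i j)) => //;
  exact: coord_continuous.
Qed.

Lemma closed_ends (R : realType) (A : set R) (a b : R) : closed A -> a < b ->
  (forall t, a < t < b -> A t) -> A a /\ A b.
Proof.
move=> cA ab At.
have cl c : (forall r : R, 0 < r -> exists2 t, a < t < b & `|c - t| < r) -> A c.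
  move=> H; apply: cA => B /nbhs_ballP[r /= r0 rB].
  by have [t it ct] := H r r0; exists t; split; [exact: At | exact: rB].
have e r : 0 < r -> exists e, [/\ 0 < e, e < r & e < b - a].
  move=> r0; exists (Num.min r (b - a) / 2).
  have u0 : 0 < Num.min r (b - a) by rewrite lt_min r0 subr_gt0.
  have u1 : Num.min r (b - a) <= r by rewrite ge_min lexx.
  have u2 : Num.min r (b - a) <= b - a by rewrite ge_min lexx orbT.
  by split; lra.
split; apply: cl => r /e[u [u0 ur ub]].
  exists (a + u); first by apply/andP; split; lra.
  by rewrite opprD addNKr normrN gtr0_norm.
exists (b - u); first by apply/andP; split; lra.
by rewrite opprB addrC subrK gtr0_norm.
Qed.

(** * Lines and the paths inside them *)

Section Lines.
Context {R : realType} {n : nat}.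
Local Notation V := 'rV[R]_n.
Implicit Types (x y p d : V).

Definition line p d : set V := [set p + t *: d | t in setT].

Definition spt x y (t : R) : V := (1 - t) *: x + t *: y.

Lemma sptE x y t : spt x y t = x + t *: (y - x).
Proof. by rewrite /spt scalerBl scale1r scalerBr addrA addrAC. Qed.

Lemma spt0 x y : spt x y 0 = x.
Proof. by rewrite sptE scale0r addr0. Qed.

Lemma spt1 x y : spt x y 1 = y.
Proof. by rewrite sptE scale1r addrC subrK. Qed.

Lemma spt_inj x y s t : x != y -> spt x y s = spt x y t -> s = t.
Proof.
move=> xy; rewrite !sptE => /addrI /eqP; rewrite -subr_eq0 -scalerBl scaler_eq0.
by rewrite subr_eq0 [X in _ || X]subr_eq0 eq_sym (eq_sym y) (negbTE xy) orbF => /eqP.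
Qed.

Lemma line_through p d x y : line p d x -> line p d y -> x != y ->
  line p d = line x (y - x).
Proof.
move=> [s _ <-] [t _ <-] xy.
have st : t - s != 0.
  by apply: contraNneq xy => /eqP; rewrite subr_eq0 => /eqP ->.
have E : p + t *: d - (p + s *: d) = (t - s) *: d.
  by rewrite scalerBl opprD addrACA subrr add0r.
rewrite E; apply/seteqP; split=> _ [u _ <-].
  exists ((u - s) / (t - s)) => //.
  by rewrite scalerA divfK //; apply/rowP => j; rewrite !mxE; ring.
exists (s + u * (t - s)) => //.
by apply/rowP => j; rewrite !mxE; ring.
Qed.

Lemma line_spt p d x y t : line p d x -> line p d y -> line p d (spt x y t).
Proof.
move=> [s _ <-] [u _ <-]; exists ((1 - t) * s + t * u) => //.
by apply/rowP => j; rewrite !mxE; ring.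
Qed.

Lemma line_coord p d i x y : d ord0 i != 0 -> line p d x -> line p d y ->
  x ord0 i = y ord0 i -> x = y.
Proof.
move=> di [s _ <-] [t _ <-]; rewrite !mxE => /addrI /(mulIf di) ->.
by [].
Qed.

Lemma spt_coord x y t i : spt x y t ord0 i = (1 - t) * x ord0 i + t * y ord0 i.
Proof. by rewrite !mxE. Qed.

Lemma line_closed p d : closed (line p d).
Proof.
have [d0|/eqP/rV0Pn[i di]] := pselect (d = 0).
  have -> : line p d = [set p].
    apply/seteqP; split=> [_ [t _ <-]|_ ->]; first by rewrite d0 scaler0 addr0.
    by exists 0 => //; rewrite scale0r addr0.
  exact: (accessible_closed_set1 (hausdorff_accessible (@norm_hausdorff R V))).
pose g (x : V) := p + ((x - p) ord0 i / d ord0 i) *: d - x.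
have -> : line p d = g @^-1` [set 0].
  apply/seteqP; split=> [_ [t _ <-]|x /= /eqP].
    by apply/rowP => j; rewrite /g !mxE; field.
  by rewrite subr_eq0 => /eqP xE; exists ((x - p) ord0 i / d ord0 i).
have cg x : {for x, continuous (fun x : V => p + ((x - p) ord0 i / d ord0 i) *: d - x)}.
  apply: (@cont_sub R V V); last exact: cvg_id.
  apply: (@cont_add R V V); first exact: cont_cst.
  apply: (@cont_scale R V V); last exact: cont_cst.
  apply: (@cont_mul R V); last exact: cont_cst.
  apply: (@cont_coord R V 1 n (fun x : V => x - p)).
  by apply: (@cont_sub R V V); [exact: cvg_id | exact: cont_cst].
apply: closed_comp => [x _|]; first exact: cg.
exact: (accessible_closed_set1 (hausdorff_accessible (@norm_hausdorff R V))).
Qed.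

(** In a coordinate where [d] is nonzero the path is an injective continuous real function, hence
    monotone, and the intermediate value theorem fills the segment. *)
Lemma injective_segment p d (f : R -> V) (a b : R) : a < b -> continuous f ->
  (forall t, t \in `[a, b] -> line p d (f t)) -> {in `[a, b] &, injective f} ->
  [set f t | t in `[a, b]] = segment (f a) (f b).
Proof.
move=> ab cf fL fi.
have ia : a \in `[a, b] by rewrite in_itv /= lexx ltW.
have ib : b \in `[a, b] by rewrite in_itv /= lexx ltW.
have [i di] : exists i, d ord0 i != 0.
  apply/rV0Pn/eqP => d0.
  have [s _ fa] := fL a ia; have [t _ fb] := fL b ib.
  have : a = b by apply: fi => //; rewrite -fa -fb d0 !scaler0.
  lra.
pose g t := f t ord0 i.
have cg : {within `[a, b], continuous g}.
  apply: continuous_subspaceT => t.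
  exact: cont_coord (cf t).
have gi : {in `[a, b] &, injective g}.
  by move=> s t sI tI st; apply: fi => //; apply: line_coord di (fL s sI) (fL t tI) st.
have gmono : forall t, t \in `[a, b] -> exists2 l, l \in `[0, 1] & g t = (1 - l) * g a + l * g b.
  move=> t; rewrite in_itv /= => /andP[at_ tb].
  have it : t \in `[a, b] by rewrite in_itv /= at_.
  have [Dg Dt] : g b - g a != 0 /\ 0 <= (g t - g a) / (g b - g a) <= 1.
    have [H|H] := itv_continuous_inj_mono cg gi.
      have gab := H a b ia ib ab.
      have gat : g a <= g t by move: at_; rewrite le_eqVlt => /predU1P[->//|at_]; apply/ltW/H.
      have gtb : g t <= g b by move: tb; rewrite le_eqVlt => /predU1P[->//|tb]; apply/ltW/H.
      split; first by apply: lt0r_neq0; lra.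
      by rewrite divr_ge0 /= ?ler_pdivrMr; lra.
    have gab := H b a ib ia ab.
    have gat : g t <= g a by move: at_; rewrite le_eqVlt => /predU1P[->//|at_]; apply/ltW/H.
    have gtb : g b <= g t by move: tb; rewrite le_eqVlt => /predU1P[->//|tb]; apply/ltW/H.
    split; first by apply: ltr0_neq0; lra.
    by rewrite -mulrNN -invrN divr_ge0 /= ?ler_pdivrMr; lra.
  exists ((g t - g a) / (g b - g a)); first by rewrite in_itv.
  by field.
apply/seteqP; split=> [_ [t it <-]|_ [l l01 <-]].
  have [l l01 gl] := gmono t it; exists l => //.
  apply: line_coord di (line_spt l (fL a ia) (fL b ib)) (fL t it) _.
  by rewrite spt_coord -/(g t) gl.
have [] := IVT (ltW ab) cg (v := (1 - l) * g a + l * g b).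
  move: l01; rewrite /= in_itv /= => /andP[l0 l1].
  rewrite ge_min le_max; have [gab|gab] := leP (g a) (g b); apply/andP; split; apply/orP.
  - by left; nra.
  - by right; nra.
  - by right; nra.
  - by left; nra.
move=> t it gt; exists t => //.
apply: line_coord di (fL t it) (line_spt l (fL a ia) (fL b ib)) _.
by rewrite spt_coord.
Qed.

(** On the open interval the times on one line form a closed set, and by hypothesis so do the
    remaining times, a finite union of such sets. Connectedness leaves a single line, and closedness
    adds the ends. *)
Lemma path_in_one_line (I : finType) (P D : I -> V) (f : R -> V) (a b : R) :
  a < b -> continuous f ->
  (forall t, t \in `[a, b] -> exists j, line (P j) (D j) (f t)) ->
  (forall t j k, t \in `]a, b[ -> line (P j) (D j) (f t) ->
    line (P k) (D k) (f t) -> line (P j) (D j) = line (P k) (D k)) ->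
  exists j, forall t, t \in `[a, b] -> line (P j) (D j) (f t).
Proof.
move=> ab cf fL fD; pose m := (a + b) / 2.
have oc t : t \in `]a, b[ -> t \in `[a, b].
  by rewrite !in_itv /= => /andP[? ?]; rewrite !ltW.
have im : m \in `]a, b[ by rewrite in_itv /= /m; apply/andP; split; lra.
have [j mj] := fL m (oc m im); exists j.
pose S := [set` `]a, b[] `&` (f @^-1` line (P j) (D j)).
have cS : closed (f @^-1` line (P j) (D j)).
  by apply: closed_comp => [t _|]; [exact: cf | exact: line_closed].
have SE : S = [set` `]a, b[].
  have /connected_intervalP cI : is_interval [set` `]a, b[] by exact: interval_is_interval.
  apply: cI; first by exists m.
    pose O := ~` \bigcup_(k in [set k | line (P k) (D k) <> line (P j) (D j)])
      (f @^-1` line (P k) (D k)).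
    exists O.
      apply: closed_openC; apply: closed_bigcup; first exact: finite_finset.
      by move=> k _; apply: closed_comp => [t _|]; [exact: cf | exact: line_closed].
    apply/seteqP; split=> t [it]; last first.
      move=> Ot; split=> //; have [k tk] := fL t (oc t it).
      have [<-//|kj] := pselect (line (P k) (D k) = line (P j) (D j)).
      by case: Ot; exists k.
    by move=> tj; split=> // -[k /= kj tk]; apply: kj; exact: fD it tk tj.
  by exists (f @^-1` line (P j) (D j)).
have So t : t \in `]a, b[ -> line (P j) (D j) (f t).
  by move=> it; have [] : S t by rewrite SE.
have [ja jb] : line (P j) (D j) (f a) /\ line (P j) (D j) (f b).
  by apply: (closed_ends cS ab) => t abt; apply: So; rewrite in_itv.
move=> t; rewrite in_itv /= le_eqVlt [X in _ && X]le_eqVlt.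
move=> /andP[/predU1P[<-//|at_] /predU1P[->//|tb]].
by apply: So; rewrite in_itv /= at_.
Qed.

End Lines.

(** * Loops inside finitely many lines are simple polygons *)

Section SimplePolygons.
Context {R : realType} {n : nat}.
Local Notation V := 'rV[R]_n.
Implicit Types (v : nat -> V) (m : nat).

Definition edge v i (t : R) : V := spt (v i) (v i.+1) t.

Definition poly_set v : set V := \bigcup_i segment (v i) (v i.+1).

Definition simple_polygon m v := [/\ (3 <= m)%N, forall i, v (i + m)%N = v i
  & forall i j s t, 0 <= s < 1 -> 0 <= t < 1 -> edge v i s = edge v j t ->
    i = j %[mod m] /\ s = t].

Lemma continuous_clip (T : topologicalType) (f : R -> T) :
  {within `[0, 1], continuous f} -> continuous (fun t => f (clip01 t)).
Proof.
move=> /subspace_continuousP cf t.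
have ct : clip01 s @[s --> t] --> within [set` `[0, 1]] (nbhs (clip01 t)).
  move=> A nA; have H : \forall s \near t, (clip01 s \in `[0, 1] -> A (clip01 s)).
    exact: (@clip01_continuous R t _ nA).
  by apply: filterS H => s; apply; exact: clip01_in.
exact: (cvg_comp _ _ ct (cf _ (clip01_in t))).
Qed.

(* Cutting the loop at the times where it meets two different lines leaves
   injective paths inside single lines. *)
Lemma loop_polygon (I : finType) (P D : I -> V) (f : R -> V) : is_loop f ->
  (forall t, t \in `[0, 1] -> exists j, line (P j) (D j) (f t)) ->
  exists m v, simple_polygon m v /\ trace f = poly_set v.
Proof.
move=> lf fL; have [cf f01 fi] := lf.
have fcE t : 0 <= t <= 1 -> f (clip01 t) = f t by move=> /clip01_id ->.
pose fc t := f (clip01 t).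
have cfc : continuous fc by exact: continuous_clip.
(* Two different lines share at most one point, which the loop visits at most once in [[0, 1)]. *)
have /choice[tau tauP] : forall jk : I * I, exists u : R, forall t, 0 <= t < 1 ->
    line (P jk.1) (D jk.1) <> line (P jk.2) (D jk.2) ->
    line (P jk.1) (D jk.1) (f t) -> line (P jk.2) (D jk.2) (f t) -> t = u.
  move=> [j k] /=.
  have [[u [u01 [uj [uk jk]]]]|H] := pselect (exists u, 0 <= u < 1 /\
     line (P j) (D j) (f u) /\ line (P k) (D k) (f u) /\
     line (P j) (D j) <> line (P k) (D k)); last first.
    by exists 0 => t t01 jk tj tk; case: H; exists t.
  exists u => t t01 _ tj tk; apply: fi; rewrite ?in_itv //=.
  apply/eqP; apply: contraT => tu; case: jk.
  by rewrite (line_through tj uj tu) (line_through tk uk tu).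
(* The cuts at 1/3 and 2/3 ensure at least three edges, so that no piece contains both 0 and 1. *)
pose cuts := [seq t <- undup ([:: 0; 1; 3^-1; 2 / 3] ++ [seq tau jk | jk : I * I]) | 0 <= t <= 1].
pose s := sort <=%R cuts.
have us : uniq s by rewrite sort_uniq filter_uniq // undup_uniq.
have ss : sorted <%R s by rewrite sort_lt_sorted -(sort_uniq <=%R).
have mems t : (t \in s) = (0 <= t <= 1) && (t \in [:: 0; 1; 3^-1; 2 / 3] ++ [seq tau jk | jk : I * I]).
  by rewrite mem_sort mem_filter mem_undup.
pose m := (size s).-1.
have s4 : (4 <= size s)%N.
  have sub : {subset [:: 0; 1; 3^-1; (2 : R) / 3] <= s}.
    move=> t; rewrite mems mem_cat => H; rewrite H andbT /=.
    by move: H; rewrite !inE => /or4P[] /eqP ->; apply/andP; split; lra.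
  apply: (uniq_leq_size _ sub) => /=; rewrite !inE !negb_or.
  by repeat (apply/andP; split => //); apply/eqP; lra.
have sm : size s = m.+1 by rewrite /m prednK // (leq_trans _ s4).
have m3 : (3 <= m)%N by move: s4; rewrite sm.
pose t i := nth 0 s i.
have t01 i : (i <= m)%N -> 0 <= t i <= 1.
  by move=> im; have : t i \in s by [rewrite mem_nth // sm]; rewrite mems => /andP[].
have tlt i j : (i <= m)%N -> (j <= m)%N -> (t i < t j) = (i < j)%N.
  by move=> im jm; apply: lt_sorted_ltn_nth; rewrite // inE sm.
have tle i j : (i <= m)%N -> (j <= m)%N -> (t i <= t j) = (i <= j)%N.
  by move=> im jm; rewrite leNgt tlt // -leqNgt.
have tex u : u \in s -> exists2 i, (i <= m)%N & t i = u.
  move=> us'; exists (index u s); first by rewrite -ltnS -sm index_mem.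
  exact: nth_index.
have t0 : t 0%N = 0.
  have [|i im ti] := tex 0; first by rewrite mems lexx ler01 inE eqxx.
  have : t 0%N <= t i by rewrite tle.
  by rewrite ti; have /andP[] := t01 0%N (leq0n _); lra.
have tm : t m = 1.
  have [|i im ti] := tex 1; first by rewrite mems lexx ler01 !inE eqxx orbT.
  have : t i <= t m by rewrite tle.
  by rewrite ti; have /andP[] := t01 m (leqnn _); lra.
have seg i : (i < m)%N -> [set f u | u in `[t i, t i.+1]] = segment (f (t i)) (f (t i.+1)).
  move=> im; have im' := ltnW im.
  have ti : t i < t i.+1 by rewrite tlt.
  have /andP[a0 a1] := t01 i im'; have /andP[b0 b1] := t01 i.+1 im.
  have sub u : u \in `[t i, t i.+1] -> 0 <= u <= 1.
    by rewrite in_itv /= => /andP[? ?]; apply/andP; split; lra.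
  have [||j jP] := @path_in_one_line R n I P D fc _ _ ti cfc.
  - by move=> u /sub u01; rewrite /fc fcE //; apply: fL; rewrite in_itv.
  - move=> u j k uI; have u01 : 0 <= u <= 1 by apply: sub; move: uI; rewrite !in_itv /= => /andP[? ?]; rewrite !ltW.
    rewrite /fc fcE // => uj uk; apply: contrapT => jk.
    have u1 : u < 1 by move: uI; rewrite in_itv /= => /andP[? ?]; lra.
    have /andP[u0 _] := u01.
    have uE : u = tau (j, k) by apply: tauP => //; rewrite u0 u1.
    have [|l lm lu] := tex u.
      by rewrite mems u01 mem_cat; apply/orP; right; rewrite uE; apply: (map_f tau); rewrite mem_enum.
    move: uI; rewrite in_itv /= -lu (tlt i l im' lm) (tlt l i.+1 lm im) ltnS.
    by move=> /andP[il li]; have := leq_trans il li; rewrite ltnn.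
  have fE u : u \in `[t i, t i.+1] -> fc u = f u by move=> /sub; exact: fcE.
  have it : t i \in `[t i, t i.+1] by rewrite in_itv /= lexx ltW.
  have iu : t i.+1 \in `[t i, t i.+1] by rewrite in_itv /= lexx ltW.
  rewrite -(fE _ it) -(fE _ iu) -(injective_segment ti cfc jP).
    by apply/seteqP; split=> _ [u uI <-]; exists u => //; rewrite fE.
  move=> u w uI wI; rewrite !fE // => uw.
  have [|||[[u0 w1]|[u1 w0]]] := loop_eq lf _ _ uw => //.
  - by rewrite in_itv; exact: sub.
  - by rewrite in_itv; exact: sub.
  - move: uI wI; rewrite u0 w1 !in_itv /= => /andP[le0 _] /andP[_ le1].
    have i0 : (i <= 0)%N by rewrite -(tle i 0%N) // t0.
    have mi : (m <= i.+1)%N by rewrite -(tle m i.+1) // tm.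
    by have := leq_trans m3 mi; move: i0; rewrite leqn0 => /eqP ->.
  - move: uI wI; rewrite u1 w0 !in_itv /= => /andP[_ le1] /andP[le0 _].
    have i0 : (i <= 0)%N by rewrite -(tle i 0%N) // t0.
    have mi : (m <= i.+1)%N by rewrite -(tle m i.+1) // tm.
    by have := leq_trans m3 mi; move: i0; rewrite leqn0 => /eqP ->.
exists m, (fun i => f (t (i %% m)%N)).
have m0 : (0 < m)%N by lia.
have vS i : f (t (i.+1 %% m)%N) = f (t (i %% m).+1).
  have im := ltn_pmod i m0; rewrite -(addn1 i) -modnDml addn1.
  have [E|E] := eqVneq (i %% m).+1 m; first by rewrite E modnn t0 tm.
  by rewrite modn_small // ltn_neqAle E.
have img i : segment (f (t (i %% m)%N)) (f (t (i.+1 %% m)%N)) =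
    [set f u | u in `[t (i %% m)%N, t (i %% m).+1]].
  by rewrite vS seg // ltn_pmod.
split; last first.
  apply/seteqP; split=> [_ [u u01 <-]|x [i _]]; last first.
    rewrite img => -[u uI <-]; exists u => //.
    have im := ltn_pmod i m0.
    have /andP[a0 _] := t01 _ (ltnW im); have /andP[_ b1] := t01 _ im.
    by move: uI; rewrite /= !in_itv /= => /andP[? ?]; apply/andP; split; lra.
  have : exists2 i, (i < m)%N & u \in `[t i, t i.+1].
    move: u01; rewrite /= in_itv /= => /andP[u0 u1].
    have find k : (k < m)%N -> u <= t k.+1 -> exists2 i, (i < m)%N & u \in `[t i, t i.+1].
      elim: k => [|k IH] km uk; first by exists 0%N => //; rewrite in_itv /= t0 u0.
      have [uk'|/ltW uk'] := leP u (t k.+1); first by apply: IH => //; lia.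
      by exists k.+1 => //; rewrite in_itv /= uk'.
    by apply: (find m.-1); rewrite prednK // tm.
  move=> [i im uI]; exists i => //=; rewrite img modn_small //.
  by exists u.
split=> //.
- by move=> i; rewrite modnDr.
have fne a : (a < m)%N -> f (t a) != f (t a.+1).
  move=> am; apply/eqP => E.
  have [|||[[u0 w1]|[u1 w0]]] := loop_eq lf _ _ E.
  - by rewrite in_itv /= t01 // ltnW.
  - by rewrite in_itv /= t01.
  - by move=> E'; have := tlt a a.+1 (ltnW am) am; rewrite E' ltxx; lia.
  - have a0 : a = 0%N.
      by apply/eqP; rewrite -leqn0 -(tle a 0%N) ?(ltnW am) // u0 t0.
    have : (m <= a.+1)%N by rewrite -(tle m a.+1) // w1 tm.
    by lia.
  - have := tlt a a.+1 (ltnW am) am; rewrite u1 w0 ltnS leqnn.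
    by move=> /esym; lra.
have edge_f i u : 0 <= u < 1 -> exists2 w, t (i %% m)%N <= w < t (i %% m).+1 &
    f w = edge (fun i => f (t (i %% m)%N)) i u.
  move=> /andP[u0 u1]; have im := ltn_pmod i m0.
  have : [set f w | w in `[t (i %% m)%N, t (i %% m).+1]] (edge (fun i => f (t (i %% m)%N)) i u).
    by rewrite -img; exists u; rewrite /= ?in_itv /= ?u0 ?ltW.
  move=> [w wI wE]; exists w => //; move: wI; rewrite /= in_itv /= => /andP[-> ].
  rewrite le_eqVlt => /predU1P[wt|//].
  move: wE; rewrite wt /edge vS => wE.
  by have := spt_inj (fne _ im) (etrans (spt1 _ _) wE); lra.
move=> i j x y x01 y01 E.
have [u /andP[u0 u1] uE] := edge_f i x x01; have [w /andP[w0 w1] wE] := edge_f j y y01.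
have im := ltn_pmod i m0; have jm := ltn_pmod j m0.
have uw : u = w.
  have /andP[a0 _] := t01 _ (ltnW im); have /andP[_ a1] := t01 _ im.
  have /andP[b0 _] := t01 _ (ltnW jm); have /andP[_ b1] := t01 _ jm.
  by apply: fi; rewrite ?in_itv /= ?uE ?wE //; apply/andP; split; lra.
have ij : (i %% m = j %% m)%N.
  case: (ltngtP (i %% m) (j %% m))%N => [lt|lt|//].
    have H : t (i %% m).+1 <= t (j %% m)%N by rewrite tle // ltnW.
    by have := lt_le_trans u1 (le_trans H w0); rewrite uw ltxx.
  have H : t (j %% m).+1 <= t (i %% m)%N by rewrite tle // ltnW.
  by have := lt_le_trans w1 (le_trans H u0); rewrite uw ltxx.
split=> //; move: E; rewrite /edge !vS -ij => E.
by apply: spt_inj E; exact: fne.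
Qed.

End SimplePolygons.

(** * Polygons without straight vertices, and their loops *)

Section CornerPolygons.
Context {R : realType} {n : nat}.
Local Notation V := 'rV[R]_n.
Implicit Types (v : nat -> V) (m : nat).

Lemma edgeE v i s : edge v i s = v i + s *: (v i.+1 - v i).
Proof. by rewrite /edge sptE. Qed.

Lemma edge0 v i : edge v i 0 = v i.
Proof. by rewrite edgeE scale0r addr0. Qed.

Lemma edge1 v i : edge v i 1 = v i.+1.
Proof. by rewrite edgeE scale1r addrC subrK. Qed.

Lemma period_mod (T : Type) (v : nat -> T) m i :
  (forall i, v (i + m)%N = v i) -> v (i %% m)%N = v i.
Proof.
move=> vm; rewrite [in RHS](divn_eq i m); elim: (i %/ m)%N => [|k IH].
  by rewrite mul0n add0n.
have -> : (k.+1 * m + i %% m = k * m + i %% m + m)%N by lia.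
by rewrite vm.
Qed.

Lemma modSm i m : ((i %% m).+1 = i.+1 %[mod m])%N.
Proof. by rewrite -(addn1 (i %% m)) modnDml addn1. Qed.

Lemma period_modS (T : Type) (v : nat -> T) m i :
  (forall i, v (i + m)%N = v i) -> v (i %% m).+1 = v i.+1.
Proof. by move=> vm; rewrite -(period_mod _ vm) modSm period_mod. Qed.

Lemma mod_succ_neq m i : (3 <= m)%N -> i.+1 <> i %[mod m].
Proof.
move=> m3 /eqP; rewrite -addn1 -[X in _ == X %[mod _]]addn0 eqn_modDl mod0n.
by rewrite modn_small //; lia.
Qed.

Lemma edge_mod v m i s : (forall i, v (i + m)%N = v i) -> edge v (i %% m)%N s = edge v i s.
Proof.
by move=> vm; rewrite /edge period_mod // period_modS.
Qed.

Lemma poly_setP v x : poly_set v x <-> exists i s, 0 <= s < 1 /\ edge v i s = x.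
Proof.
split=> [[i _ [s + <-]]|[i [s [/andP[s0 s1] <-]]]].
  rewrite /= in_itv /= => /andP[s0]; rewrite le_eqVlt => /predU1P[->|s1].
    by exists i.+1, 0; rewrite lexx ltr01 edge0 -[LHS](edge1 v i).
  by exists i, s; rewrite s0.
by exists i => //; exists s => //; rewrite /= in_itv /= s0 ltW.
Qed.

Lemma simple_polygon_shift m v k : simple_polygon m v ->
  simple_polygon m (fun i => v (i + k)%N) /\ poly_set (fun i => v (i + k)%N) = poly_set v.
Proof.
move=> [m3 vm inj]; split; first split=> // [i|i j s t s01 t01 E].
- by rewrite addnAC vm.
- have [/eqP ij st] := inj (i + k)%N (j + k)%N s t s01 t01 E; split=> //.
  by apply/eqP; rewrite eqn_modDr in ij.
apply/seteqP; split=> x /poly_setP[i [s [s01 <-]]]; apply/poly_setP.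
  by exists (i + k)%N, s.
exists (i + (k * m - k))%N, s; split=> //.
rewrite /edge addSn -/(edge v _ s).
have -> : (i + (k * m - k) + k = k * m + i)%N by nia.
by rewrite -(edge_mod _ s vm) modnMDl edge_mod.
Qed.

(** For [c < 0] the two edges overlap near the common vertex: the parameters [1 - x] and [x / - c]
    give the same point, and the choice of [x] keeps both in [[0, 1)]. For [c = 0] two successive
    vertices coincide. *)
Lemma no_backtrack m v i c : simple_polygon m v -> c <= 0 ->
  v i.+2 - v i.+1 <> c *: (v i.+1 - v i).
Proof.
move=> [m3 vm inj] c0 E.
have m12 j : j = j.+1 %[mod m] -> False by move/esym; exact: mod_succ_neq.
move: c0; rewrite le_eqVlt => /predU1P[c0|c0].
  have [|||/m12//] := inj i.+1 i.+2 0 0; rewrite ?lexx ?ltr01 // !edge0.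
  by move: E; rewrite c0 scale0r => /eqP; rewrite subr_eq0 => /eqP.
pose x : R := Num.min 2^-1 (- c / 2).
have x0 : 0 < x by rewrite lt_min; apply/andP; split; lra.
have x1 : x <= 2^-1 by rewrite ge_min lexx.
have x2 : x <= - c / 2 by rewrite ge_min lexx orbT.
have [|||/m12//] := inj i i.+1 (1 - x) (x / - c).
- by apply/andP; split; lra.
- apply/andP; split; first by apply: divr_ge0; lra.
  have nc : 0 < - c by lra.
  by rewrite ltr_pdivrMr // mul1r; apply: le_lt_trans x2 _; lra.
- rewrite !edgeE E scalerA; have -> : x / - c * c = - x.
    by rewrite invrN mulrN mulNr divfK // ltr0_neq0.
  by apply/rowP => j; rewrite !mxE; ring.
Qed.

(** As edge vectors of a simple polygon are nonzero, this says that successive ones are linearly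
    independent, which [dual_functional] exploits. *)
Definition corner_polygon m v := simple_polygon m v /\
  forall i c, v i.+2 - v i.+1 <> c *: (v i.+1 - v i).

(** Vertex 1 is dropped. The edges 0 and 1 have lengths in ratio 1 to [c], so the parameter [s] of
    the joined edge becomes [s * (1 + c)] on the first and [(s * (1 + c) - 1) / c] on the second. *)
Lemma merge_vertex m v c : simple_polygon m v -> 0 < c ->
  v 2%N - v 1%N = c *: (v 1%N - v 0%N) ->
  exists v', simple_polygon m.-1 v' /\ poly_set v' = poly_set v.
Proof.
move=> sv c0 E; have [m3 vm inj] := sv.
(* A straight vertex of a triangle would force a backtrack at the next vertex. *)
have m4 : (4 <= m)%N.
  rewrite ltn_neqAle m3 andbT; apply/eqP => m3'.
  apply: (@no_backtrack m v 1 (- ((1 + c) / c))) => //.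
    by rewrite oppr_le0; apply: divr_ge0; lra.
  have -> : v 3%N = v 0%N by rewrite m3' -[in LHS](add0n m) vm.
  rewrite E scalerA; have -> : - ((1 + c) / c) * c = - (1 + c) by rewrite mulNr divfK // gt_eqF.
  have -> : v 2%N = v 1%N + c *: (v 1%N - v 0%N) by rewrite -E addrC subrK.
  by apply/rowP => j; rewrite !mxE; ring.
have [k mk] : exists k, m = k.+4 by exists (m - 4)%N; lia.
pose v' i := if (i %% m.-1 == 0)%N then v 0%N else v (i %% m.-1).+1.
have vm' i : v' (i + m.-1)%N = v' i by rewrite /v' modnDr.
have v'S i : (i < m.-1)%N -> v' i.+1 = v i.+2.
  move=> im; rewrite /v'; have [e|e] := eqVneq i.+1 m.-1.
    by rewrite e modnn eqxx -[in LHS](add0n 0%N) -(vm 0%N) add0n; congr v; lia.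
  by rewrite modn_small; [|lia].
have edge_0 s : edge v' 0 s = v 0%N + (s * (1 + c)) *: (v 1%N - v 0%N).
  rewrite edgeE v'S; last by lia.
  have -> : v 2%N = v 1%N + c *: (v 1%N - v 0%N) by rewrite -E addrC subrK.
  by rewrite /v' mod0n /=; apply/rowP => j; rewrite !mxE; ring.
have edge_S i s : (0 < i < m.-1)%N -> edge v' i s = edge v i.+1 s.
  move=> /andP[i0 im]; rewrite /edge v'S // /v' modn_small //.
  by case: eqP i0 => // ->.
have split_edge s : 0 <= s < 1 -> (s * (1 + c) < 1 /\ edge v' 0 s = edge v 0 (s * (1 + c))) \/
    (0 <= (s * (1 + c) - 1) / c < 1 /\ edge v' 0 s = edge v 1 ((s * (1 + c) - 1) / c)).
  move=> /andP[s0 s1]; have [lt|ge] := ltP (s * (1 + c)) 1; [left|right].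
    by rewrite edge_0 edgeE.
  split; first by apply/andP; split; [apply: divr_ge0; lra | rewrite ltr_pdivrMr //; nra].
  rewrite edge_0 edgeE E scalerA divfK ?gt_eqF //.
  by apply/rowP => j; rewrite !mxE; ring.
have key i s : 0 <= s < 1 -> exists a t, [/\ (a < m)%N, 0 <= t < 1,
    edge v' i s = edge v a t & (a = 0%N /\ i = 0 %[mod m.-1] /\ t = s * (1 + c)) \/
    (a = 1%N /\ i = 0 %[mod m.-1] /\ t = (s * (1 + c) - 1) / c) \/
    ((1 < a)%N /\ (i %% m.-1).+1 = a /\ t = s)].
  move=> s01; rewrite -(edge_mod i s vm').
  have [e|e] := eqVneq (i %% m.-1)%N 0%N.
    rewrite e; have [[t1 tE]|[t01 tE]] := split_edge s s01.
      exists 0%N, (s * (1 + c)); split=> //; first by lia.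
        by rewrite t1 andbT; have /andP[? ?] := s01; apply: mulr_ge0; lra.
      by left; rewrite mod0n.
    exists 1%N, ((s * (1 + c) - 1) / c); split=> //; first by lia.
    by right; left; rewrite mod0n.
  have im : (i %% m.-1 < m.-1)%N by apply: ltn_pmod; lia.
  exists (i %% m.-1).+1, s; split=> //; first by lia.
    by apply: edge_S; rewrite im lt0n e.
  by right; right; split=> //; lia.
exists v'; split; first split=> //; first by lia.
  move=> i j s t s01 t01 ij.
  have [a [s' [am s'01 Ea Ha]]] := key i s s01.
  have [b [t' [bm t'01 Eb Hb]]] := key j t t01.
  rewrite Ea Eb in ij; have [ab st] := inj _ _ _ _ s'01 t'01 ij.
  rewrite !modn_small // in ab.
  have inj1 (x y : R) : x * (1 + c) = y * (1 + c) -> x = y.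
    by move/mulIf; apply; rewrite gt_eqF //; lra.
  case: Ha => [[a0 [i0 sE]]|[[a1 [i0 sE]]|[a2 [iE sE]]]];
    case: Hb => [[b0 [j0 tE]]|[[b1 [j0 tE]]|[b2 [jE tE]]]];
    try by [move: ab; rewrite ?a0 ?a1 ?b0 ?b1 | move: b2; rewrite -ab ?a0 ?a1 | move: a2; rewrite ab ?b0 ?b1].
  - by rewrite i0 j0; split=> //; apply: inj1; rewrite -sE -tE.
  - rewrite i0 j0; split=> //; apply: inj1.
    have : (s * (1 + c) - 1) / c = (t * (1 + c) - 1) / c by rewrite -sE -tE.
    have c'0 : c^-1 != 0 by rewrite invr_neq0 // gt_eqF.
    by move/(mulIf c'0)/addIr.
  - by split; [apply: succn_inj; rewrite iE jE | rewrite -sE -tE].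
apply/seteqP; split=> x /poly_setP[i [s [s01 <-]]]; apply/poly_setP.
  have [a [t [am t01 Et _]]] := key i s s01; rewrite Et.
  by exists a, t.
have /andP[s0 s1] := s01.
rewrite -(edge_mod i s vm); have im : (i %% m < m)%N by apply: ltn_pmod; lia.
have [i0|i0] := eqVneq (i %% m)%N 0%N.
  exists 0%N, (s / (1 + c)); split.
    by apply/andP; split; [apply: divr_ge0; lra | rewrite ltr_pdivrMr; lra].
  by rewrite edge_0 divfK ?i0 ?edgeE // gt_eqF //; lra.
have [i1|i1] := eqVneq (i %% m)%N 1%N.
  exists 0%N, ((1 + c * s) / (1 + c)); split.
    apply/andP; split; first by apply: divr_ge0; nra.
    by rewrite ltr_pdivrMr; nra.
  rewrite edge_0 divfK ?i1; last by rewrite gt_eqF //; lra.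
  rewrite edgeE E scalerA; apply/rowP => j; rewrite !mxE; ring.
exists (i %% m).-1, s; split=> //; rewrite edge_S; last by lia.
by congr edge; lia.
Qed.

(** Induction on the number of vertices: a shift brings a straight vertex to position 1, and merging
    removes it. *)
Lemma corner_polygon_exists m v : simple_polygon m v ->
  exists m' v', corner_polygon m' v' /\ poly_set v' = poly_set v.
Proof.
elim: m v => [|m IH] v sv; first by have [] := sv.
have [H|] := pselect (forall i c, v i.+2 - v i.+1 <> c *: (v i.+1 - v i)).
  by exists m.+1, v.
move=> /existsNP[i /existsNP[c /contrapT E]].
have c0 : 0 < c.
  by rewrite ltNge; apply/negP => /(no_backtrack sv); apply; exact: E.
have [sv1 pv1] := simple_polygon_shift i sv.
have [v' [/IH[m' [v'' [cv pv'']]] pv']] := merge_vertex sv1 c0 E.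
by exists m', v''; split=> //; rewrite pv'' pv' pv1.
Qed.

(** A sum of clipped increments: at time [k + s] those before [k] are complete and those after [k]
    have not begun. *)
Fixpoint pl_path v M (y : R) : V :=
  if M is M'.+1 then pl_path v M' y + clip01 (y - M'%:R) *: (v M'.+1 - v M') else v 0%N.

Lemma pl_path_continuous v M : continuous (pl_path v M).
Proof.
elim: M => [|M IH] y; first exact: cont_cst.
change {for y, continuous
  (fun y => pl_path v M y + clip01 (y - M%:R) *: (v M.+1 - v M))}.
apply: (@cont_add R V R); first exact: IH.
apply: (@cont_scale R V R); last exact: cont_cst.
apply: (@continuous_comp _ _ _ (fun y : R => y - M%:R) (@clip01 R)); last exact: clip01_continuous.
by apply: (@cont_sub R R); [exact: cvg_id | exact: cont_cst].
Qed.

Lemma pl_path_end v M y : M%:R <= y -> pl_path v M y = v M.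
Proof.
elim: M => [//|M IH] My; rewrite /= IH; last by rewrite (le_trans _ My) // ler_nat.
rewrite clip01_eq1; first by rewrite scale1r addrC subrK.
by move: My; rewrite -natr1; lra.
Qed.

Lemma pl_pathE v M k s : (k < M)%N -> 0 <= s <= 1 ->
  pl_path v M (k%:R + s) = edge v k s.
Proof.
elim: M => [//|M IH]; rewrite ltnS leq_eqVlt => /predU1P[->|kM] s01 /=.
  rewrite pl_path_end; last by have /andP[? _] := s01; rewrite lerDl.
  have -> : M%:R + s - M%:R = s by ring.
  by rewrite edgeE clip01_id.
rewrite IH // clip01_eq0 ?scale0r ?addr0 //.
have : k.+1%:R <= M%:R :> R by rewrite ler_nat.
by rewrite -natr1; have /andP[_ ?] := s01; lra.
Qed.

Lemma polygon_loop m v : simple_polygon m v ->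
  exists2 f : R -> V, is_loop f & trace f = poly_set v.
Proof.
move=> [m3 vm inj].
have m0 : (0 < m)%N by lia.
have mR : (0 : R) < m%:R by rewrite ltr0n.
pose f x := pl_path v m (m%:R * x).
have fE x : 0 <= x < 1 -> exists k s, [/\ (k < m)%N, 0 <= s < 1, f x = edge v k s & m%:R * x = k%:R + s].
  move=> /andP[x0 x1]; have y0 : 0 <= m%:R * x by apply: mulr_ge0 => //; exact: ltW.
  have /andP[k1 k2] := truncn_itv y0.
  set k := Num.truncn _ in k1 k2; exists k, (m%:R * x - k%:R).
  have km : (k < m)%N.
    rewrite -(ltr_nat R); apply: le_lt_trans k1 _.
    by rewrite gtr_pMr.
  move: k2; rewrite -natr1 => k2.
  split=> //; first by apply/andP; split; lra.
    rewrite -(pl_pathE v km); first by rewrite addrC subrK.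
    by apply/andP; split; lra.
  by rewrite addrC subrK.
have edge_f k s : (k < m)%N -> 0 <= s < 1 -> exists2 x, 0 <= x < 1 & f x = edge v k s.
  move=> km /andP[s0 s1]; exists ((k%:R + s) / m%:R).
    apply/andP; split; first by apply: divr_ge0; [apply: addr_ge0 | exact: ltW].
    rewrite ltr_pdivrMr // mul1r; have : k.+1%:R <= m%:R :> R by rewrite ler_nat.
    by rewrite -natr1; lra.
  rewrite /f mulrC divfK ?gt_eqF // pl_pathE // s0 /=; exact: ltW.
have f0 : f 0 = v 0%N.
  by rewrite /f mulr0 -[X in pl_path _ _ X]addr0 (pl_pathE v (k := 0%N)) ?lexx ?ler01 ?edge0.
have f1 : f 1 = v 0%N by rewrite /f mulr1 pl_path_end // -[X in v X]add0n vm.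
exists f; first split.
- apply: continuous_subspaceT => x.
  apply: (@continuous_comp _ _ _ (fun x : R => m%:R * x) (pl_path v m)); last exact: pl_path_continuous.
  by apply: (@cont_mul R R); [exact: cont_cst | exact: cvg_id].
- by rewrite f0 f1.
- move=> x y; rewrite !in_itv /= => x01 y01.
  have [k [s [km s01 -> xE]]] := fE x x01; have [l [t [lm t01 -> yE]]] := fE y y01.
  move=> /(inj _ _ _ _ s01 t01)[kl st]; rewrite !modn_small // in kl.
  by apply: (mulfI (lt0r_neq0 mR)); rewrite xE yE kl st.
apply/seteqP; split=> [_ [x + <-]|x /poly_setP[i [s [s01 <-]]]].
  rewrite /= in_itv /= => /andP[x0]; rewrite le_eqVlt => /predU1P[->|x1].
    by rewrite f1; apply/poly_setP; exists 0%N, 0; rewrite lexx ltr01 edge0.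
  have [|k [s [km s01 -> xE]]] := fE x; first by rewrite x0.
  by apply/poly_setP; exists k, s.
rewrite -(edge_mod i s vm).
have [y /andP[y0 y1] <-] := edge_f _ s (ltn_pmod i m0) s01.
by exists y; rewrite //= in_itv /= y0 ltW.
Qed.

End CornerPolygons.

(** * Recognizing points of the hyperspace of polygons *)

Section PolygonHyperspace.
Context {R : realType} {n : nat}.
Local Notation V := 'rV[R]_n.

Definition curve_set (Q : @polygonal_curves R n) : set V := hset (val Q).

Lemma curve_set_inj (Q Q' : @polygonal_curves R n) : curve_set Q = curve_set Q' -> Q = Q'.
Proof. by move=> QQ'; do 2 apply: val_inj. Qed.

Lemma curve_set_continuum Q : continuum (curve_set Q).
Proof. exact: hyperspace_continuum. Qed.

Lemma trace_continuum (T : topologicalType) (f : R -> T) : is_loop f -> continuum (trace f).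
Proof.
move=> [cf _ _]; split.
- by exists (f 0), 0; rewrite //= in_itv /= lexx ler01.
- exact: continuous_compact cf (@segment_compact R 0 1).
- exact: connected_continuous_connected (@segment_connected R 0 1) cf.
Qed.

Lemma segment_line (a b : V) : segment a b `<=` line a (b - a).
Proof. by move=> _ [t _ <-]; exists t => //; rewrite -sptE. Qed.

Lemma corner_polygonP (Q : @polygonal_curves R n) :
  exists m v, corner_polygon m v /\ curve_set Q = poly_set v.
Proof.
have [scc [m [a [b [ab QE]]]]] := set_mem (valP Q).
have [f lf fE] := (simple_closed_curveP (curve_set Q) (@norm_hausdorff R V)).1 scc.
have [|k [v [sv tv]]] := @loop_polygon R n 'I_m a (fun i => b i - a i) f lf.
  move=> t t01; have : curve_set Q (f t) by rewrite fE; exists t.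
  by rewrite /curve_set QE => -[i _ /segment_line]; exists i.
have [m' [v' [cv pv]]] := corner_polygon_exists sv.
by exists m', v'; rewrite pv -tv -fE.
Qed.

Lemma loop_polygonal (I : finType) (P D : I -> V) (f : R -> V) : is_loop f ->
  (forall t, t \in `[0, 1] -> exists j, line (P j) (D j) (f t)) ->
  exists Q : @polygonal_curves R n, curve_set Q = trace f.
Proof.
move=> lf fL; have [m [v [[m3 vm inj] tv]]] := loop_polygon lf fL.
pose C : hyperspace V := exist _ (trace f) (mem_set (trace_continuum lf)).
suff CP : polygonal_curves C by exists (exist _ C (mem_set CP)).
split; first by apply/(simple_closed_curveP _ (@norm_hausdorff R V)); exists f.
exists m, (fun i : 'I_m => v i), (fun i : 'I_m => v i.+1); split.
  move=> i; apply/eqP => E.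
  have [|||] := inj i i.+1 0 0; rewrite ?lexx ?ltr01 ?edge0 //.
  by move=> /esym /(mod_succ_neq m3).
rewrite [LHS]tv; apply/seteqP; split=> x.
  move=> /poly_setP[i [s [/andP[s0 s1] <-]]].
  have im : (i %% m < m)%N by apply: ltn_pmod; lia.
  exists (Ordinal im) => //; rewrite -(edge_mod i s vm).
  by exists s; rewrite //= in_itv /= s0 ltW.
by move=> [i _ ix]; exists i.
Qed.

Lemma polygon_curve m v : simple_polygon m v ->
  exists Q : @polygonal_curves R n, curve_set Q = poly_set v.
Proof.
move=> sv; have [f lf fE] := polygon_loop sv; have [m3 vm inj] := sv.
have [|Q QE] := @loop_polygonal 'I_m (fun i => v i) (fun i => v i.+1 - v i) f lf.
  move=> t t01; have : poly_set v (f t) by rewrite -fE; exists t.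
  move=> /poly_setP[i [s [s01 <-]]].
  have im : (i %% m < m)%N by apply: ltn_pmod; lia.
  by exists (Ordinal im); rewrite -(edge_mod i s vm) /=; exists s; rewrite // -edgeE.
by exists Q; rewrite QE.
Qed.

(* The image need only be covered by finitely many lines: piecewise affinity
   of F itself plays no role. *)
Lemma injective_image_polygonal (J : finType) (Q : @polygonal_curves R n)
    (F : V -> V) (A : J -> V -> V) (L : J -> V -> V) :
  {within curve_set Q, continuous F} -> {in curve_set Q &, injective F} ->
  (forall j x y t, A j (x + t *: y) = A j x + t *: L j y) ->
  (forall x, curve_set Q x -> exists j, F x = A j x) ->
  exists Q' : @polygonal_curves R n, curve_set Q' = [set F x | x in curve_set Q].
Proof.
move=> /subspace_continuousP cF iF AL FA.
have [m [v [[[m3 vm vi] _] QE]]] := corner_polygonP Q.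
have [scc _] := set_mem (valP Q).
have [f [cf f01 fi] fE] := (simple_closed_curveP (curve_set Q) (@norm_hausdorff R V)).1 scc.
have Qf t : t \in `[0, 1] -> curve_set Q (f t) by move=> t01; rewrite fE; exists t.
have lFf : is_loop (F \o f).
  split.
  - apply/subspace_continuousP => t t01.
    move/subspace_continuousP: cf => /(_ t t01) cf.
    have cf' : f s @[s --> within [set` `[0, 1]] (nbhs t)] --> within (curve_set Q) (nbhs (f t)).
      move=> B nB; have H : \forall s \near t, s \in `[0, 1] -> curve_set Q (f s) -> B (f s).
        exact: (cf _ nB).
      change (\forall s \near t, s \in `[0, 1] -> B (f s)).
      by apply: filterS H => s + s01; apply=> //; exact: Qf.
    exact: cvg_comp cf' (cF _ (Qf t t01)).
  - by rewrite /= f01.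
  - move=> s t s1 t1 /iF E; apply: fi => //; apply: E; rewrite inE; apply: Qf.
      by move: s1; rewrite !in_itv /= => /andP[-> /ltW].
    by move: t1; rewrite !in_itv /= => /andP[-> /ltW].
have [|Q' Q'E] := @loop_polygonal ('I_m * J)%type (fun k => A k.2 (v k.1))
   (fun k => L k.2 (v k.1.+1 - v k.1)) _ lFf.
  move=> t t01; have := Qf t t01; have [j Fj] := FA _ (Qf t t01).
  rewrite {1}QE => /poly_setP[i [s [s01 fs]]].
  have im : (i %% m < m)%N by apply: ltn_pmod; lia.
  exists (Ordinal im, j) => /=; exists s => //; rewrite -AL -edgeE edge_mod //.
  by rewrite Fj fs.
exists Q'; rewrite Q'E fE; apply/seteqP; split=> [_ [t t01 <-]|_ [_ [t t01 <-] <-]].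
  by exists (f t) => //; exists t.
by exists t.
Qed.

End PolygonHyperspace.

(** * Local contractibility *)

Section Gap.
Context {R : realType}.
Implicit Types (J : set R) (a b c t u : R).

Definition free J a b := forall c, a < c < b -> ~ J c.

(** The length of the longest interval in [[0, t]] whose interior misses [J]. As a supremum it is
    Lipschitz in [t] and stable in [J], with no reference to the place of the gap. *)
Definition gap J t : R :=
  sup [set u | exists a b, [/\ 0 <= a, a <= b, b <= t, u = b - a & free J a b]].

Lemma gap_ub J t a b : 0 <= a -> a <= b -> b <= t -> free J a b -> b - a <= gap J t.
Proof.
move=> a0 ab bt fab; apply: ub_le_sup; last by exists a, b.
by exists t => _ [a' [b' [a'0 ab' b't -> _]]]; lra.
Qed.

Lemma gap_le J t y : 0 <= t ->
  (forall a b, 0 <= a -> a <= b -> b <= t -> free J a b -> b - a <= y) -> gap J t <= y.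
Proof.
move=> t0 H; apply: ge_sup; last by move=> _ [a [b [a0 ab bt -> fab]]]; exact: H.
by exists 0, 0, 0; rewrite subrr lexx; split=> // c; lra.
Qed.

Lemma gap_ge0 J t : 0 <= t -> 0 <= gap J t.
Proof. by move=> t0; rewrite -(subrr (0 : R)); apply: gap_ub => // c; lra. Qed.

Lemma gap_le_id J t : 0 <= t -> gap J t <= t.
Proof. by move=> t0; apply: gap_le => // a b *; lra. Qed.

Lemma gap_mono J t u : 0 <= t -> t <= u -> gap J t <= gap J u.
Proof.
by move=> t0 tu; apply: gap_le => // a b a0 ab bt fab; apply: gap_ub => //; lra.
Qed.

Lemma gap_lip J t u : 0 <= t -> t <= u -> gap J u <= gap J t + (u - t).
Proof.
move=> t0 tu; apply: gap_le => [|a b a0 ab bu fab]; first lra.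
have [bt|tb] := leP b t; first by have := gap_ub a0 ab bt fab; lra.
have [at_|ta] := leP a t; last by have := gap_ge0 J t0; lra.
suff : t - a <= gap J t by lra.
by apply: gap_ub => // c ?; apply: fab; lra.
Qed.

(** A free interval of [J], shortened by [e] at both ends, is free for [J']. Points of [J'] within
    [e] of 0 or 1 are exempt because, near the end of an edge, a nearby point may belong to the next
    cell. *)
Lemma gap_stable J J' e t : 0 <= e -> 0 <= t <= 1 ->
  (forall c, J' c -> e <= c <= 1 - e -> exists2 c', J c' & `|c - c'| < e) ->
  gap J t <= gap J' t + 2 * e.
Proof.
move=> e0 /andP[t0 t1] H; apply: gap_le => // a b a0 ab bt fab.
have g0 := gap_ge0 J' t0.
have [be|be] := leP (b - a) (2 * e); first lra.
suff : (b - e) - (a + e) <= gap J' t by lra.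
apply: gap_ub; [lra | lra | lra | move=> c /andP[c1 c2] J'c].
have [|c' Jc'] := H c J'c; first by apply/andP; split; lra.
by rewrite ltr_norml => /andP[? ?]; apply: (fab c' _ Jc'); apply/andP; split; lra.
Qed.

Lemma gap_full J t : 0 <= t <= 1 -> (forall c, 0 <= c <= 1 -> J c) -> gap J t = 0.
Proof.
move=> /andP[t0 t1] H; apply/eqP; rewrite eq_le gap_ge0 // andbT.
apply: gap_le => // a b a0 ab bt fab; rewrite leNgt; apply/negP => ab'.
by apply: (fab ((a + b) / 2)); [apply/andP; split | apply: H; apply/andP; split]; lra.
Qed.

Lemma gap_empty J : (forall c, ~ J c) -> 1 <= gap J 1.
Proof. by move=> J0; rewrite -[leLHS]subr0; apply: gap_ub => // c _; exact: J0. Qed.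

(** If [J] has a single gap from [a] to [b], then [t - gap J t] is [t] up to [a], constant on the
    gap, and [t - (b - a)] after it; the division rescales to [[0, 1]]. *)
Definition collapse J t := (t - gap J t) / (1 - gap J 1).

Lemma collapse0 J : collapse J 0 = 0.
Proof.
have -> : collapse J 0 = (0 - gap J 0) / (1 - gap J 1) by [].
have -> : gap J 0 = 0 by apply/eqP; rewrite eq_le gap_le_id // gap_ge0.
by rewrite subrr mul0r.
Qed.

Lemma collapse1 J : gap J 1 < 1 -> collapse J 1 = 1.
Proof. by move=> g1; rewrite /collapse divff // gt_eqF //; lra. Qed.

Lemma collapse_le J t u : gap J 1 < 1 -> 0 <= t -> t <= u -> u <= 1 ->
  collapse J t <= collapse J u.
Proof.
move=> g1 t0 tu u1; rewrite /collapse ler_pM2r ?invr_gt0; last lra.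
by have := gap_lip J t0 tu; lra.
Qed.

Lemma collapse_lip J t u : gap J 1 < 2^-1 -> 0 <= t -> t <= u ->
  collapse J u - collapse J t <= 2 * (u - t).
Proof.
move=> g1 t0 tu; have := gap_ge0 J ler01; have := gap_mono J t0 tu.
rewrite /collapse -mulrBl; move: (gap J t) (gap J u) (gap J 1) g1 => x y z z1 xy z0.
by rewrite ler_pdivrMr; [nra | lra].
Qed.

(** Both denominators exceed 1/2, so their product is at least 1/4, and the numerator of the
    difference is at most [2 * d]. *)
Lemma collapse_close J J' d t : gap J 1 < 2^-1 -> gap J' 1 < 2^-1 -> 0 <= t <= 1 ->
  `|gap J t - gap J' t| <= d -> `|gap J 1 - gap J' 1| <= d ->
  `|collapse J t - collapse J' t| <= 8 * d.
Proof.
move=> g1 g1' /andP[t0 t1]; rewrite /collapse.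
have := gap_ge0 J ler01; have := gap_ge0 J' ler01; have := gap_ge0 J t0; have := gap_ge0 J' t0.
have := gap_le_id J t0; have := gap_le_id J' t0.
move: (gap J t) (gap J' t) (gap J 1) (gap J' 1) g1 g1' => x x' y y' y1 y1' ? ? ? ? ? ?.
move=> /ler_normlP[d1 d2] /ler_normlP[d3 d4].
have e0 : 0 < 1 - y by lra.
have e0' : 0 < 1 - y' by lra.
have -> : (t - x) / (1 - y) - (t - x') / (1 - y') =
   ((t - x) * (1 - y') - (t - x') * (1 - y)) / ((1 - y) * (1 - y')).
  by field; rewrite !gt_eqF.
have e1 : 0 < (1 - y) * (1 - y') by exact: mulr_gt0.
have e2 : 4^-1 <= (1 - y) * (1 - y') by nra.
have d0 : 0 <= d by lra.
have -> : (t - x) * (1 - y') - (t - x') * (1 - y) = (x' - x) * (1 - y') + (t - x') * (y - y') by ring.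
have n1 : `|(x' - x) * (1 - y')| <= d * 1.
  by rewrite normrM; apply: ler_pM => //; rewrite ler_norml; apply/andP; split; lra.
have n2 : `|(t - x') * (y - y')| <= 1 * d.
  by rewrite normrM; apply: ler_pM => //; rewrite ler_norml; apply/andP; split; lra.
rewrite normrM normfV (gtr0_norm e1) ler_pdivrMr //.
apply: le_trans (ler_normD _ _) _.
move: `|_| `|_| ((1 - y) * _) n1 n2 e2 => p p' q ? ? ?.
by nra.
Qed.

Section OneGap.
Context (J : set R).
(** No point of [J] lies between two missing ones, so the complement of [J] in [[0, 1]] is an
    interval. For shadows of continua this is [shadow_conv]. *)
Hypothesis conv : forall t1 t2 t3, 0 <= t1 -> t1 < t2 -> t2 < t3 -> t3 <= 1 ->
  J t2 -> J t1 \/ J t3.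

Lemma one_gap : (forall t, 0 <= t <= 1 -> J t) \/ exists a b,
  [/\ 0 <= a, a <= b, b <= 1, free J a b
    & forall t, 0 <= t <= 1 -> t < a \/ b < t -> J t].
Proof.
have [H|/existsNP[g0 /not_implyP[g01 Jg0]]] := pselect (forall t, 0 <= t <= 1 -> J t); first by left.
right; pose G := [set t | 0 <= t <= 1 /\ ~ J t].
have Gg : G !=set0 by exists g0.
have lG : has_lbound G by exists 0 => t [/andP[? ?] _].
have uG : has_ubound G by exists 1 => t [/andP[? ?] _].
exists (inf G), (sup G); split.
- by apply: lb_le_inf => // t [/andP[? ?] _].
- exact: le_trans (ge_inf lG (conj g01 Jg0)) (ub_le_sup uG (conj g01 Jg0)).
- by apply: ge_sup => // t [/andP[? ?] _].
- move=> c /andP[c1 c2] Jc.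
  have [x [/andP[x0 x1] Jx] xc] := inf_lt Gg c1.
  have [y [/andP[y0 y1] Jy] cy] := sup_gt Gg c2.
  by case: (conv x0 xc cy y1 Jc).
- move=> t t01 tG; apply: contrapT => Jt.
  have := ge_inf lG (conj t01 Jt); have := ub_le_sup uG (conj t01 Jt).
  by case: tG => ?; lra.
Qed.

Lemma one_gapE a b : 0 <= a -> a <= b -> b <= 1 -> free J a b ->
  (forall t, 0 <= t <= 1 -> t < a \/ b < t -> J t) ->
  forall t, 0 <= t <= 1 -> [/\ t <= a -> gap J t = 0,
    a <= t -> t <= b -> gap J t = t - a & b <= t -> gap J t = b - a].
Proof.
move=> a0 ab b1 fab Jout t /andP[t0 t1].
have fr x y : 0 <= x -> x < y -> y <= 1 -> free J x y -> a <= x /\ y <= b.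
  move=> x0 xy y1 fxy; split; rewrite leNgt; apply/negP => h.
    pose c := (x + Num.min a y) / 2.
    have cm : x < Num.min a y by rewrite lt_min h.
    have ca : Num.min a y <= a by rewrite ge_min lexx.
    have cy : Num.min a y <= y by rewrite ge_min lexx orbT.
    apply: (fxy c); first by rewrite /c; apply/andP; split; lra.
    by apply: Jout; [rewrite /c; apply/andP; split | left; rewrite /c]; lra.
  pose c := (y + Num.max b x) / 2.
  have cm : Num.max b x < y by rewrite gt_max h.
  have cb : b <= Num.max b x by rewrite le_max lexx.
  have cx : x <= Num.max b x by rewrite le_max lexx orbT.
  apply: (fxy c); first by rewrite /c; apply/andP; split; lra.
  by apply: Jout; [rewrite /c; apply/andP; split | right; rewrite /c]; lra.
split.
- move=> ta; apply/eqP; rewrite eq_le gap_ge0 // andbT; apply: gap_le => // x y x0 xy yt fxy.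
  rewrite leNgt; apply/negP => h.
  by have [||] := fr x y x0 _ _ fxy; lra.
- move=> ta tb; apply/eqP; rewrite eq_le; apply/andP; split.
    apply: gap_le => // x y x0 xy yt fxy; have [h|h] := leP y x; first lra.
    by have [|] := fr x y x0 h _ fxy; lra.
  by apply: gap_ub => // c /andP[? ?]; apply: fab; apply/andP; split; lra.
- move=> bt; apply/eqP; rewrite eq_le; apply/andP; split; last exact: gap_ub.
  apply: gap_le => // x y x0 xy yt fxy; have [h|h] := leP y x; first lra.
  by have [|] := fr x y x0 h _ fxy; lra.
Qed.

(** Three affine formulas for the gap: they keep the number of lines carrying the image of a polygon
    finite. *)
Lemma gap_cases : exists a b, forall t, 0 <= t <= 1 ->
  [\/ gap J t = 0, gap J t = t - a | gap J t = b - a].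
Proof.
have [H|[a [b [a0 ab b1 fab Jout]]]] := one_gap.
  by exists 0, 0 => t t01; apply: Or31; exact: gap_full.
exists a, b => t t01; have [g1 g2 g3] := one_gapE a0 ab b1 fab Jout t01.
have [ta|/ltW ta] := leP t a; first by apply: Or31; exact: g1.
have [tb|/ltW tb] := leP t b; first by apply: Or32; exact: g2.
by apply: Or33; exact: g3.
Qed.

(** The intermediate value theorem gives a parameter, possibly in the gap. There the collapse is
    constant, so an end of the gap serves as well; it is in [J] by closedness if points of [J] lie
    beyond it. This holds for one end at least, since otherwise the gap has length 1. *)
Lemma collapse_surj y : closed J -> gap J 1 < 1 -> 0 <= y <= 1 ->
  exists t, [/\ J t, 0 <= t <= 1 & collapse J t = y].
Proof.
move=> cJ g1 /andP[y0 y1].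
pose h t := t - gap J t.
have ch : {within `[0, 1], continuous h}.
  apply/subspace_continuousP => t; rewrite /= in_itv /= => /andP[t0 t1].
  apply/cvgrPdist_le => e e0.
  have nt : \forall s \near t, `|t - s| < e.
    by have := @cvg_id _ (nbhs t); move/cvgrPdist_lt => /(_ e e0).
  apply: filterS nt => s ts; rewrite /= in_itv /= => /andP[s0 s1].
  change (`|h t - h s| <= e).
  move: ts; rewrite ltr_norml ler_norml /h => /andP[ts1 ts2].
  have [st|/ltW st] := leP s t.
    by have := gap_lip J s0 st; have := gap_mono J s0 st; move=> ? ?; apply/andP; split; lra.
  by have := gap_lip J t0 st; have := gap_mono J t0 st; move=> ? ?; apply/andP; split; lra.
have h0 : h 0 = 0.
  by rewrite /h; have := gap_le_id J (lexx 0); have := gap_ge0 J (lexx 0); lra.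
have [] := IVT (ler01 : 0 <= 1 :> R) ch (v := y * (1 - gap J 1)).
  rewrite h0 /h ge_min le_max; apply/andP; split; apply/orP; first by left; apply: mulr_ge0; lra.
  by right; nra.
move=> t0; rewrite in_itv /= => t01 ht.
have col t : h t = h t0 -> collapse J t = y.
  by rewrite /collapse -/(h t) => ->; rewrite ht mulfK // gt_eqF //; lra.
have [Jt|Jt] := pselect (J t0); first by exists t0; split=> //; exact: col.
have [H|[a [b [a0 ab b1 fab Jout]]]] := one_gap; first by case: Jt; exact: H.
have /andP[p0 p1] := t01.
have ta : a <= t0 by rewrite leNgt; apply/negP => ta; apply: Jt; apply: Jout => //; left.
have tb : t0 <= b by rewrite leNgt; apply/negP => tb; apply: Jt; apply: Jout => //; right.
have gE := one_gapE a0 ab b1 fab Jout.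
have ht0 : h t0 = a by rewrite /h; have [_ -> //] := gE t0 t01; lra.
have a01 : 0 <= a <= 1 by apply/andP; split; lra.
have b01 : 0 <= b <= 1 by apply/andP; split; lra.
have [b1'|b1'] := ltP b 1.
  have [Jb _] : J b /\ J 1.
    by apply: closed_ends => // u /andP[? ?]; apply: Jout; [apply/andP; split | right]; lra.
  by exists b; split=> //; apply: col; rewrite ht0 /h; have [_ _ -> //] := gE b b01; lra.
have [a0'|a0'] := ltP 0 a.
  have [_ Ja] : J 0 /\ J a.
    by apply: closed_ends => // u /andP[? ?]; apply: Jout; [apply/andP; split | left]; lra.
  by exists a; split=> //; apply: col; rewrite ht0 /h; have [-> //] := gE a a01; lra.
have i1 : 0 <= (1 : R) <= 1 by rewrite ler01 lexx.
by have [_ _] := gE 1 i1; move=> /(_ b1); lra.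
Qed.

End OneGap.
End Gap.

(** * Functionals at the corners and distances between edges *)

Section CornerData.
Context {R : realType} {n : nat}.
Local Notation V := 'rV[R]_n.
Implicit Types (w x y : V) (v : nat -> V).

(** Independence makes some 2 by 2 minor [D] nonzero, and Cramer's rule gives a functional in these
    two coordinates. *)
Lemma dual_functional w w' : w != 0 -> (forall c, w' <> c *: w) -> exists l : V -> R,
  [/\ forall x y t, l (x + t *: y) = l x + t * l y, continuous l, l w = 1, l w' = 1
    & exists2 L, 0 < L & forall x, `|l x| <= L * `|x|].
Proof.
move=> /rV0Pn[i wi] ww'.
have [j] : exists j, w ord0 i * w' ord0 j - w ord0 j * w' ord0 i != 0.
  apply: contrapT => H; apply: (ww' (w' ord0 i / w ord0 i)); apply/rowP => j; rewrite mxE.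
  have [/eqP|D0] := eqVneq (w ord0 i * w' ord0 j - w ord0 j * w' ord0 i) 0; last by case: H; exists j.
  rewrite subr_eq0 => /eqP E; apply: (mulfI wi); rewrite E.
  by field.
set D := _ - _ => D0.
pose a := (w' ord0 j - w ord0 j) / D; pose b := (w ord0 i - w' ord0 i) / D.
exists (fun x => a * x ord0 i + b * x ord0 j); rewrite /a /b.
split.
- by move=> x y t; rewrite !mxE; ring.
- move=> x; apply: (@cont_add R R V); apply: (@cont_mul R V);
    by [exact: cont_cst | exact: coord_continuous].
- by rewrite /D in D0 *; field.
- by rewrite /D in D0 *; field.
- rewrite -/a -/b; exists (1 + `|a| + `|b|) => [|x].
    by have := normr_ge0 a; have := normr_ge0 b; lra.
  have xi : `|a * x ord0 i| <= `|a| * `|x| by rewrite normrM ler_wpM2l // ler_coord_norm.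
  have xj : `|b * x ord0 j| <= `|b| * `|x| by rewrite normrM ler_wpM2l // ler_coord_norm.
  have := ler_normD (a * x ord0 i) (b * x ord0 j); have := normr_ge0 x; lra.
Qed.

Lemma corner_functionals m v : corner_polygon m v -> exists l : nat -> V -> R,
  [/\ forall k x y t, l k (x + t *: y) = l k x + t * l k y, forall k, continuous (l k),
      forall k, l (k + m)%N = l k, forall k, l k (v k.+1 - v k) = 1
    & forall k, l k (v k.+2 - v k.+1) = 1].
Proof.
move=> [[m3 vm _] cv].
have w0 k : v k.+1 - v k != 0.
  (* A zero edge vector violates the corner condition at the preceding index with factor 0; adding
     [m] makes that index exist also for [k = 0]. *)
  apply/eqP => w0; have := cv (k + m).-1 0; rewrite scale0r; apply.
  have -> : (k + m).-1.+1 = (k + m)%N by lia.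
  by rewrite vm -addSn vm.
have /choice[l lP] k := dual_functional (w0 k) (cv k).
have vSS k : v (k %% m).+2 = v k.+2 := @period_modS _ (fun i => v i.+1) m k (fun i => vm i.+1).
exists (fun k => l (k %% m)%N); split=> [k|k|k|k|k]; have [H1 H2 H3 H4 _] := lP (k %% m)%N.
- exact: H1.
- exact: H2.
- by rewrite modnDr.
- by rewrite -H3 (period_modS _ vm) (period_mod _ vm).
- by rewrite -H4 (period_modS _ vm) vSS.
Qed.

Lemma edge_continuous v i : continuous (edge v i).
Proof.
move=> t; rewrite /edge /spt; apply: (@cont_add R V R); apply: (@cont_scale R V R).
- by apply: (@cont_sub R R R); [exact: cont_cst | exact: cvg_id].
- exact: cont_cst.
- exact: cvg_id.
- exact: cont_cst.
Qed.

Lemma segment_compact_edge v i : compact [set edge v i t | t in `[0, 1]].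
Proof.
apply: continuous_compact; last exact: segment_compact.
exact/continuous_subspaceT/edge_continuous.
Qed.

(** The end of an edge is the start of the next one, which reduces closed edges to half-open ones;
    hence the three excluded congruences. *)
Lemma edges_disjoint m v i j s t : simple_polygon m v -> i <> j %[mod m] ->
  i.+1 <> j %[mod m] -> j.+1 <> i %[mod m] -> 0 <= s <= 1 -> 0 <= t <= 1 ->
  edge v i s <> edge v j t.
Proof.
move=> [m3 vm inj] ij iSj jSi.
have H k u : 0 <= u <= 1 -> exists k' u', [/\ k' = k \/ k' = k.+1, 0 <= u' < 1 & edge v k u = edge v k' u'].
  move=> /andP[u0]; rewrite le_eqVlt => /predU1P[->|u1].
    by exists k.+1, 0; rewrite lexx ltr01 edge0 edge1; split=> //; right.
  by exists k, u; rewrite u0 u1; split=> //; left.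
move=> s1 t1; have [i' [s' [i'E s01 ->]]] := H i s s1; have [j' [t' [j'E t01 ->]]] := H j t t1.
move=> /(inj _ _ _ _ s01 t01)[E _].
have S (a b : nat) : a.+1 = b.+1 %[mod m] -> a = b %[mod m].
  by rewrite -(addn1 a) -(addn1 b) => /eqP; rewrite eqn_modDr => /eqP.
case: i'E j'E E => -> [] -> E; [exact: ij | exact: jSi (esym E) | exact: iSj | exact: ij (S _ _ E)].
Qed.

Lemma edges_apart v i j : 
  (forall s t, 0 <= s <= 1 -> 0 <= t <= 1 -> edge v i s <> edge v j t) ->
  exists2 r, 0 < r & forall s t, 0 <= s <= 1 -> 0 <= t <= 1 -> r <= `|edge v i s - edge v j t|.
Proof.
move=> dis.
have cj : closed [set edge v j t | t in `[0, 1]].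
  apply: (@compact_closed V); [exact: (@norm_hausdorff R V) | exact: segment_compact_edge].
have [|r r0 rP] := compact_fattening (@segment_compact_edge v i) (closed_openC cj).
  move=> _ [s s01 <-] [t t01]; move: s01 t01; rewrite /= !in_itv /= => s01 t01.
  by move/esym; exact: dis.
exists r => // s t s01 t01; rewrite leNgt; apply/negP => st.
apply: (rP (edge v i s) (edge v j t)) st _; last by exists t; rewrite //= in_itv.
by exists s; rewrite //= in_itv.
Qed.

(** With the factor 2 the closed [eps]-tubes about non-adjacent edges are disjoint. *)
Lemma polygon_separation m v : simple_polygon m v -> exists2 eps, 0 < eps &
  forall i j s t, i <> j %[mod m] -> i.+1 <> j %[mod m] -> j.+1 <> i %[mod m] ->
  0 <= s <= 1 -> 0 <= t <= 1 -> 2 * eps < `|edge v i s - edge v j t|.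
Proof.
move=> sv; have [m3 vm _] := sv.
have /choice[r rP] : forall ij : 'I_m * 'I_m, exists r : R, 0 < r /\
    (ij.1 <> ij.2 %[mod m] -> ij.1.+1 <> ij.2 %[mod m] -> ij.2.+1 <> ij.1 %[mod m] ->
     forall s t, 0 <= s <= 1 -> 0 <= t <= 1 -> r <= `|edge v ij.1 s - edge v ij.2 t|).
  move=> [i j]; have [[ij [iSj jSi]]|H] := pselect (i <> j %[mod m] /\
     (i.+1 <> j %[mod m] /\ j.+1 <> i %[mod m])); last first.
    by exists 1; split=> // *; case: H.
  have [|r r0 rP] := @edges_apart v i j; last by exists r.
  by move=> s t; exact: edges_disjoint sv _ _ _.
pose e := \big[Num.min/1]_ij r ij.
have e0 : 0 < e by apply: lt_bigmin => // ij _; have [] := rP ij.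
exists (e / 3) => [|i j s t ij iSj jSi s01 t01]; first lra.
have m0 : (0 < m)%N by lia.
pose i' := Ordinal (ltn_pmod i m0); pose j' := Ordinal (ltn_pmod j m0).
have [_ /=] := rP (i', j'); rewrite !modSm !modn_mod => /(_ ij iSj jSi s t s01 t01).
rewrite !(edge_mod _ _ vm) => H.
have E : e <= r (i', j') by apply: bigmin_le_cond.
lra.
Qed.

End CornerData.

(** * Joining the coordinates at the two ends of an edge *)

Section Blend.
Context {R : realType}.
Implicit Types a b : R.

(* For b - a in [- 1/3, 1/3], equal to a when a <= 1/3 and to b when a >= 2/3. *)
Definition blend a b : R :=
  let w := Num.max 0 (a - 3^-1) in a + Num.max (- w) (Num.min w (b - a)).

Lemma blendP a b : exists w, (w = 0 /\ a <= 3^-1 \/ w = a - 3^-1 /\ 3^-1 <= a) /\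
  [\/ blend a b = b /\ - w <= b - a <= w, blend a b = a + w /\ w <= b - a
    | blend a b = a - w /\ b - a <= - w].
Proof.
have w0 : 0 <= Num.max 0 (a - 3^-1) by rewrite le_max lexx.
exists (Num.max 0 (a - 3^-1)); split.
  by have [h|h] := leP 0 (a - 3^-1); [right | left]; split=> //; lra.
rewrite /blend /=; move: (Num.max _ _) w0 => w w0.
have [h|h] := leP w (b - a).
  by apply: Or32; rewrite max_r //; lra.
have [h'|h'] := leP (- w) (b - a).
  by apply: Or31; split; [ring | apply/andP; split; lra].
by apply: Or33; split=> //; exact: ltW.
Qed.

Lemma blend_itv a b : 0 <= a -> b <= 1 -> - 3^-1 <= b - a <= 3^-1 -> 0 <= blend a b <= 1.
Proof.
move=> a0 b1 /andP[ba1 ba2].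
by have [w [[[w0 ?]|[w0 ?]] [[h /andP[? ?]]|[h ?]|[h ?]]]] := blendP a b; apply/andP; split; lra.
Qed.

Lemma blend0 b : blend 0 b = 0.
Proof.
by have [w [[[w0 ?]|[w0 ?]] [[h /andP[? ?]]|[h ?]|[h ?]]]] := blendP 0 b; lra.
Qed.

Lemma blend1 a : - 3^-1 <= 1 - a <= 3^-1 -> blend a 1 = 1.
Proof.
move=> /andP[? ?].
by have [w [[[w0 ?]|[w0 ?]] [[h /andP[? ?]]|[h ?]|[h ?]]]] := blendP a 1; lra.
Qed.

Lemma blendxx a : blend a a = a.
Proof.
by have [w [[[w0 ?]|[w0 ?]] [[h /andP[? ?]]|[h ?]|[h ?]]]] := blendP a a; lra.
Qed.

(** A motion along the edge changes both arguments by the same amount. Monotonicity in this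
    direction is the source of injectivity in [flow_inj_cell]. *)
Lemma blend_le a b a' b' : a <= a' -> b - a = b' - a' -> blend a b <= blend a' b'.
Proof.
move=> aa' ab.
by have [w [[[w0 ?]|[w0 ?]] [[h /andP[? ?]]|[h ?]|[h ?]]]] := blendP a b;
  have [w' [[[w0' ?]|[w0' ?]] [[h' /andP[? ?]]|[h' ?]|[h' ?]]]] := blendP a' b'; lra.
Qed.

Lemma blend_cases a b : [\/ blend a b = a, blend a b = b,
  blend a b = 2 * a - 3^-1 | blend a b = 3^-1].
Proof.
have [w [[[w0 ?]|[w0 ?]] [[h /andP[? ?]]|[h ?]|[h ?]]]] := blendP a b.
- by apply: Or42.
- by apply: Or41; lra.
- by apply: Or41; lra.
- by apply: Or42.
- by apply: Or43; lra.
- by apply: Or44; lra.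
Qed.

Lemma blend_continuous (T : topologicalType) (f g : T -> R) t :
  {for t, continuous f} -> {for t, continuous g} ->
  {for t, continuous (fun s => blend (f s) (g s))}.
Proof.
move=> cf cg; apply: (@cont_add R R T) => //.
have cw : {for t, continuous (fun s => Num.max 0 (f s - 3^-1))}.
  apply: (@continuous_max R T (fun=> 0)); first exact: cont_cst.
  by apply: (@cont_sub R R T) => //; exact: cont_cst.
apply: (@continuous_max R T (fun s => - Num.max 0 (f s - 3^-1))); first exact: cvgN.
apply: (@continuous_min R T (fun s => Num.max 0 (f s - 3^-1))) => //.
exact: (@cont_sub R R T).
Qed.

End Blend.

(** * The tube of cells around a polygon *)

Section Tube.
Context {R : realType} {n : nat}.
Local Notation V := 'rV[R]_n.
Context (m : nat) (v : nat -> V) (l : nat -> V -> R) (eps : R).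
Hypothesis m3 : (3 <= m)%N.
Hypothesis vm : forall i, v (i + m)%N = v i.
Hypothesis lD : forall k x y t, l k (x + t *: y) = l k x + t * l k y.
Hypothesis lc : forall k, continuous (l k).
Hypothesis lm : forall k, l (k + m)%N = l k.
Hypothesis l0 : forall k, l k (v k.+1 - v k) = 1.
Hypothesis l1 : forall k, l k (v k.+2 - v k.+1) = 1.
Hypothesis eps0 : 0 < eps.
Hypothesis sep : forall i j s t, i <> j %[mod m] -> i.+1 <> j %[mod m] ->
  j.+1 <> i %[mod m] -> 0 <= s <= 1 -> 0 <= t <= 1 ->
  2 * eps < `|edge v i s - edge v j t|.

(* As l k is 1 on both edge vectors at the corner v k.+1, its level set through
   the corner has the two edges on different sides. *)
Definition nu k x := l k (x - v k.+1).

Definition theta k x := blend (nu k x) (1 + nu k.+1 x).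

(* A convex neighbourhood of the edge from v k.+1 to v k.+2, cut off by the
   level sets nu k = 0 and nu k.+1 = 0 through its ends. *)
Definition cell k : set V := [set x | [/\ 0 <= nu k x, nu k.+1 x <= 0,
  - 3^-1 <= 1 + nu k.+1 x - nu k x <= 3^-1
  & exists2 t, 0 <= t <= 1 & `|x - edge v k.+1 t| <= eps]].

Lemma lB k x y : l k (x - y) = l k x - l k y.
Proof. by rewrite -scaleN1r lD mulN1r. Qed.

Lemma nuD k x y t : nu k (x + t *: y) = nu k x + t * l k y.
Proof. by rewrite /nu addrAC lD. Qed.

Lemma nu_spt k x y t : nu k ((1 - t) *: x + t *: y) = (1 - t) * nu k x + t * nu k y.
Proof.
rewrite -/(spt x y t) sptE nuD lB /nu !lB; ring.
Qed.

Lemma l_0 k : l k 0 = 0.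
Proof. by have := lB k 0 0; rewrite subr0 subrr. Qed.

Lemma nu_start k t : nu k (edge v k.+1 t) = t.
Proof. by rewrite edgeE nuD /nu subrr l_0 l1 add0r mulr1. Qed.

Lemma nu_end k t : nu k.+1 (edge v k.+1 t) = t - 1.
Proof.
rewrite edgeE nuD l0 mulr1 addrC; congr (_ + _).
by rewrite /nu -opprB -[- _]add0r lB l_0 l0 sub0r.
Qed.

Lemma nu_continuous k : continuous (nu k).
Proof.
move=> x; apply: (@continuous_comp _ _ _ (fun x : V => x - v k.+1) (l k)); last exact: lc.
by apply: (@cont_sub R V V); [exact: cvg_id | exact: cont_cst].
Qed.

Lemma theta_continuous k : continuous (theta k).
Proof.
move=> x; apply: (@blend_continuous R V (nu k)); first exact: nu_continuous.
by apply: (@cont_add R R V); [exact: cont_cst | exact: nu_continuous].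
Qed.

Lemma theta_edge k t : theta k (edge v k.+1 t) = t.
Proof.
rewrite /theta nu_start nu_end; have -> : 1 + (t - 1) = t by ring.
exact: blendxx.
Qed.

Lemma theta_itv k x : cell k x -> 0 <= theta k x <= 1.
Proof. by move=> [a0 b1 ab _]; apply: blend_itv => //; lra. Qed.

Lemma theta_left k x : nu k x = 0 -> theta k x = 0.
Proof. by rewrite /theta => ->; exact: blend0. Qed.

Lemma theta_right k x : cell k x -> nu k.+1 x = 0 -> theta k x = 1.
Proof.
move=> [_ _ ab _] b0; rewrite /theta b0 addr0; apply: blend1.
by move: ab; rewrite b0 addr0.
Qed.

Lemma nu_mod k : nu (k %% m)%N = nu k.
Proof.
apply/funext => x; rewrite /nu (period_mod k lm); congr (l k (_ - _)).
by have := edge_mod k 1 vm; rewrite !edge1.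
Qed.

Lemma nuS_mod k : nu (k %% m).+1 = nu k.+1.
Proof.
by rewrite -[LHS]nu_mod -[RHS]nu_mod modSm.
Qed.

Lemma theta_mod k : theta (k %% m)%N = theta k.
Proof. by apply/funext => x; rewrite /theta nu_mod nuS_mod. Qed.

Lemma edgeS_mod k t : edge v (k %% m).+1 t = edge v k.+1 t.
Proof.
by rewrite -[LHS](edge_mod _ _ vm) -[RHS](edge_mod _ _ vm) modSm.
Qed.

Lemma cell_mod k : cell (k %% m)%N = cell k.
Proof.
rewrite /cell nu_mod nuS_mod; apply/seteqP.
by split=> x [x1 x2 x3 [t t01 xt]]; split=> //; exists t => //; move: xt; rewrite edgeS_mod.
Qed.

Lemma cell_edge k t : 0 <= t <= 1 -> cell k (edge v k.+1 t).
Proof.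
move=> t01; have /andP[t0 t1] := t01; split; rewrite ?nu_start ?nu_end; try lra.
by exists t => //; rewrite subrr normr0 ltW.
Qed.

(** All four conditions on a cell are convex and hold on its edge. *)
Lemma cell_spt k x s t : cell k x -> 0 <= s <= 1 -> 0 <= t <= 1 ->
  cell k (spt x (edge v k.+1 t) s).
Proof.
move=> [x1 x2 /andP[x3 x4] [u /andP[u0 u1] xu]] /andP[s0 s1] /andP[t0 t1].
rewrite /spt; split; rewrite ?(nu_spt _ x) ?nu_start ?nu_end.
- by apply: addr_ge0; apply: mulr_ge0 => //; lra.
- nra.
- by apply/andP; split; nra.
exists ((1 - s) * u + s * t); first by apply/andP; split; nra.
have -> : (1 - s) *: x + s *: edge v k.+1 t - edge v k.+1 ((1 - s) * u + s * t) =
    (1 - s) *: (x - edge v k.+1 u).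
  by rewrite !edgeE; apply/rowP => j; rewrite !mxE; ring.
rewrite normrZ ger0_norm; last lra.
by have := normr_ge0 (x - edge v k.+1 u); nra.
Qed.

Lemma cell_adjacent k x : cell k x -> cell k.+1 x -> nu k.+1 x = 0.
Proof. by move=> [_ x1 _ _] [x2 _ _ _]; apply/eqP; rewrite eq_le x1 x2. Qed.

Lemma cell_disjoint i j x : i <> j %[mod m] -> i.+1 <> j %[mod m] ->
  j.+1 <> i %[mod m] -> cell i x -> cell j x -> False.
Proof.
move=> ij iSj jSi [_ _ _ [s s01 xs]] [_ _ _ [t t01 xt]].
have S (a b : nat) : a.+1 = b.+1 %[mod m] -> a = b %[mod m].
  by rewrite -(addn1 a) -(addn1 b) => /eqP; rewrite eqn_modDr => /eqP.
have := sep (fun e => ij (S _ _ e)) (fun e => iSj (S _ _ e)) (fun e => jSi (S _ _ e)) s01 t01.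
have := ler_distD x (edge v i.+1 s) (edge v j.+1 t); rewrite (distrC _ x).
lra.
Qed.

(** Non-adjacent cells are disjoint; adjacent ones meet in the level set through the common vertex,
    where [theta] takes an end value. *)
Lemma cell_meet_end i j x : i <> j %[mod m] -> cell i x -> cell j x ->
  theta i x = 0 \/ theta i x = 1.
Proof.
move=> ij xi xj; have [iSj|iSj] := pselect (i.+1 = j %[mod m]).
  right; apply: theta_right => //; apply: cell_adjacent => //.
  by rewrite -cell_mod iSj cell_mod.
have [jSi|jSi] := pselect (j.+1 = i %[mod m]); last by case: (cell_disjoint ij iSj jSi xi xj).
left; apply: theta_left; rewrite -nu_mod -jSi nu_mod; apply: cell_adjacent => //.
by rewrite -cell_mod jSi cell_mod.
Qed.

(** The index is at least 2, so that this edge and its predecessor both have the form [k.+1] of an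
    edge with a cell. *)
Lemma poly_edgeS x : poly_set v x -> exists k t, 0 <= t < 1 /\ edge v k.+2 t = x.
Proof.
move=> /poly_setP[i [s [s01 <-]]]; exists (i + m - 2)%N, s; split=> //.
have -> : (i + m - 2).+2 = (i + m)%N by lia.
by rewrite -(edge_mod (i + m) s vm) modnDr edge_mod.
Qed.

(** Inside an edge the inequalities of its cell are strict. At a vertex the sign of [nu k.+1]
    decides which of the two adjacent cells contains a nearby point. *)
Lemma cells_nbhs x : poly_set v x -> \forall y \near x, exists k, cell k y.
Proof.
move=> /poly_edgeS[k [t [/andP[t0 t1] <-]]]; set p := edge v k.+2 t.
have near_nu i d : 0 < d -> \forall y \near p, `|nu i p - nu i y| < d.
  by move=> d0; have /cvgrPdist_lt/(_ d d0) := @nu_continuous i p.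
have near_p : \forall y \near p, `|p - y| < eps.
  by have := @cvg_id _ (nbhs p); move/cvgrPdist_lt => /(_ eps eps0).
have nk1 : nu k.+1 p = t by exact: nu_start.
have nk2 : nu k.+2 p = t - 1 by exact: nu_end.
have d0 : 0 < (1 - t) / 8 by lra.
have base : \forall y \near p, 0 <= nu k.+1 y -> cell k.+1 y.
  near=> y => y1.
  have : `|nu k.+1 p - nu k.+1 y| < (1 - t) / 8 by near: y; exact: near_nu.
  have : `|nu k.+2 p - nu k.+2 y| < (1 - t) / 8 by near: y; exact: near_nu.
  rewrite nk1 nk2 !ltr_norml => /andP[? ?] /andP[? ?].
  split; [by [] | lra | by apply/andP; split; lra |].
  exists t; first by apply/andP; split; lra.
  by rewrite distrC; apply: ltW; near: y.
have [tp|t0'] := ltP 0 t.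
  near=> y; exists k.+1; have y1 : `|nu k.+1 p - nu k.+1 y| < t by near: y; exact: near_nu.
  have : 0 <= nu k.+1 y by move: y1; rewrite nk1 ltr_norml => /andP[? ?]; lra.
  by near: y.
have tE : t = 0 by lra.
have pE : p = edge v k.+1 1 by rewrite /p tE edge0 edge1.
have nk0 : nu k p = 1 by rewrite pE nu_start.
have e0 : 0 < 8^-1 :> R by lra.
near=> y; have [y1|y1] := leP 0 (nu k.+1 y).
  by exists k.+1; move: y1; near: y.
exists k; have : `|nu k.+1 p - nu k.+1 y| < 8^-1 by near: y; exact: near_nu.
have : `|nu k p - nu k y| < 8^-1 by near: y; exact: near_nu.
rewrite nk1 nk0 !ltr_norml => /andP[? ?] /andP[? ?].
split; [lra | lra | by apply/andP; split; lra |].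
by exists 1; rewrite ?lexx ?ler01 // -pE distrC; apply: ltW; near: y.
Unshelve. all: by end_near. Qed.

Lemma tube_closed k : closed [set x | exists2 t, 0 <= t <= 1 & `|x - edge v k t| <= eps].
Proof.
rewrite -openC openE => x Hx.
have oO : open [set y | eps < `|x - y|].
  apply: (@open_comp _ _ (fun y : V => `|x - y|) [set c | eps < c]); last exact: open_gt.
  move=> y _; apply: (@continuous_comp _ _ _ (fun y : V => x - y)); last exact: norm_continuous.
  by apply: (@cont_sub R V V); [exact: cont_cst | exact: cvg_id].
have [|r r0 rP] := compact_fattening (@segment_compact_edge R n v k) oO.
  move=> _ [t t01 <-] /=; rewrite ltNge; apply/negP => xt; apply: Hx; exists t => //.
apply/(@nbhs_normP _ V _ _); exists r => //= y xy [t t01 yt].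
have E : x - (edge v k t + (x - y)) = y - edge v k t by apply/rowP => j; rewrite !mxE; ring.
have := rP (edge v k t) (edge v k t + (x - y)); rewrite /= E opprD addNKr normrN xy.
move=> H; suff : eps < `|y - edge v k t| by lra.
by apply: H => //; exists t; rewrite //= in_itv.
Qed.

Lemma cell_closed k : closed (cell k).
Proof.
have -> : cell k = (nu k @^-1` [set t | 0 <= t]) `&` ((nu k.+1 @^-1` [set t | t <= 0]) `&`
   (((fun x => 1 + nu k.+1 x - nu k x) @^-1` [set t | - 3^-1 <= t]) `&`
   (((fun x => 1 + nu k.+1 x - nu k x) @^-1` [set t | t <= 3^-1]) `&`
   [set x | exists2 t, 0 <= t <= 1 & `|x - edge v k.+1 t| <= eps]))).
  apply/seteqP; split=> [x [x1 x2 /andP[x3 x4] x5] //|x [x1 [x2 [x3 [x4 x5]]]]].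
  by split=> //; apply/andP.
have cd : continuous (fun x => 1 + nu k.+1 x - nu k x).
  move=> x; apply: (@cont_sub R R V); last exact: nu_continuous.
  by apply: (@cont_add R R V); [exact: cont_cst | exact: nu_continuous].
apply: closedI; first by apply: closed_comp => [x _|]; [exact: nu_continuous | exact: closed_ge].
apply: closedI; first by apply: closed_comp => [x _|]; [exact: nu_continuous | exact: closed_le].
apply: closedI; first by apply: closed_comp => [x _|]; [exact: cd | exact: closed_ge].
apply: closedI; first by apply: closed_comp => [x _|]; [exact: cd | exact: closed_le].
exact: tube_closed.
Qed.

Lemma edge_norm k t : 0 <= t <= 1 -> `|edge v k t| <= `|v k| + `|v k.+1|.
Proof.
move=> /andP[t0 t1]; apply: le_trans (ler_normD _ _) _; rewrite !normrZ.
rewrite !ger0_norm; try lra.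
by have := normr_ge0 (v k); have := normr_ge0 (v k.+1); nra.
Qed.

Lemma cell_norm k x : cell k x -> `|x| <= eps + (`|v k.+1| + `|v k.+2|).
Proof.
move=> [_ _ _ [t t01 xt]]; have := edge_norm k.+1 t01.
by have := ler_normD (x - edge v k.+1 t) (edge v k.+1 t); rewrite subrK; lra.
Qed.

Lemma cell_compact k : compact (cell k).
Proof.
apply: bounded_closed_compact; last exact: cell_closed.
exists (eps + (`|v k.+1| + `|v k.+2|)); split; first exact: num_real.
by move=> M /ltW MM x /cell_norm xM; exact: le_trans xM MM.
Qed.

(** * Straight homotopies towards the edges *)

Section Flow.
Context (E : nat -> R -> R) (s : R).
Hypothesis E0 : forall k, E k 0 = 0.
Hypothesis E1 : forall k, E k 1 = 1.
Hypothesis Ele : forall k t u, 0 <= t -> t <= u -> u <= 1 -> E k t <= E k u.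
Hypothesis Em : forall k, E (k + m)%N = E k.
Hypothesis s01 : 0 <= s <= 1.

(** [E k] stands for a collapse: it fixes 0 and 1, so that adjacent flows agree on the common wall,
    and it is monotone, which gives injectivity. *)
Definition flow k x : V := spt x (edge v k.+1 (E k (theta k x))) s.

Lemma E_itv k t : 0 <= t <= 1 -> 0 <= E k t <= 1.
Proof.
move=> /andP[t0 t1]; have := @Ele k 0 t (lexx 0) t0 t1; have := @Ele k t 1 t0 t1 (lexx 1).
by rewrite E0 E1 => -> ->.
Qed.

Lemma flow_mod k : flow (k %% m)%N = flow k.
Proof.
by apply/funext => x; rewrite /flow theta_mod edgeS_mod (period_mod k Em).
Qed.

Lemma flow_cell k x : cell k x -> cell k (flow k x).
Proof. by move=> xk; apply: cell_spt => //; apply/E_itv/theta_itv. Qed.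

Lemma flow_right k x : cell k x -> nu k.+1 x = 0 -> flow k x = spt x (v k.+2) s.
Proof. by move=> xk x0; rewrite /flow theta_right // E1 edge1. Qed.

Lemma flow_left k x : nu k x = 0 -> flow k x = spt x (v k.+1) s.
Proof. by move=> x0; rewrite /flow theta_left // E0 edge0. Qed.

Lemma flow_agree_adj k x : cell k x -> cell k.+1 x -> flow k x = flow k.+1 x.
Proof.
move=> xk xk1; have x0 := cell_adjacent xk xk1.
by rewrite flow_right // flow_left.
Qed.

Lemma flow_agree i j x : cell i x -> cell j x -> flow i x = flow j x.
Proof.
move=> xi xj; have [ij|ij] := pselect (i = j %[mod m]).
  by rewrite -flow_mod ij flow_mod.
have [iSj|iSj] := pselect (i.+1 = j %[mod m]).
  rewrite (@flow_agree_adj i) //; last by rewrite -cell_mod iSj cell_mod.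
  by rewrite -flow_mod iSj flow_mod.
have [jSi|jSi] := pselect (j.+1 = i %[mod m]); last by case: (cell_disjoint ij iSj jSi xi xj).
have -> : flow i x = flow j.+1 x by rewrite -(flow_mod i) -jSi flow_mod.
by apply/esym/flow_agree_adj => //; rewrite -cell_mod jSi cell_mod.
Qed.

(** Equal images give [x = y + c *: w] with [c] of the sign of [b - a] or 0. If [c < 0], then [x]
    lies behind [y] along the edge, and monotonicity yields [a <= b], so [c >= 0]; the case [c > 0]
    is symmetric. *)
Lemma flow_inj_cell k x y : s < 1 -> cell k x -> cell k y -> flow k x = flow k y -> x = y.
Proof.
move=> s1 xk yk; rewrite /flow /spt; set a := E k (theta k x); set b := E k (theta k y) => xy.
pose w := v k.+2 - v k.+1; pose c := s / (1 - s) * (b - a).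
have s1' : 1 - s != 0 by rewrite gt_eqF //; lra.
have xyE : x = y + c *: w.
  apply: (scalerI s1'); apply: (addIr (s *: edge v k.+1 a)); rewrite xy /c !edgeE.
  by apply/rowP => j; rewrite !mxE; field.
have /andP[sg0 _] := s01.
have c0 : 0 <= s / (1 - s) by apply: divr_ge0; lra.
have nux : nu k x = nu k y + c by rewrite xyE nuD l1 mulr1.
have nux' : nu k.+1 x = nu k.+1 y + c by rewrite xyE nuD l0 mulr1.
have /andP[tx0 tx1] := theta_itv xk; have /andP[ty0 ty1] := theta_itv yk.
suff c00 : c = 0 by rewrite xyE c00 scale0r addr0.
apply/eqP; case: (ltgtP c 0) => // cs.
  have : theta k x <= theta k y by apply: blend_le; rewrite ?nux ?nux'; [lra | ring].
  move=> /Ele => /(_ k tx0 ty1); rewrite -/a -/b => ab.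
  have : 0 <= c by apply: mulr_ge0; lra.
  lra.
have : theta k y <= theta k x by apply: blend_le; rewrite ?nux ?nux'; [lra | ring].
move=> /Ele => /(_ k ty0 tx1); rewrite -/a -/b => ab.
have : c <= 0 by apply: mulr_ge0_le0; lra.
lra.
Qed.

(** A common image lies on the wall [nu k.+1 = 0]. There [nu k.+1] is a convex combination of two
    values of one sign, and the starting point has weight [1 - s > 0]; so both points start on the
    wall, where the flow is a homothety towards the vertex. *)
Lemma flow_inj_adj k x y : s < 1 -> cell k x -> cell k.+1 y -> flow k x = flow k.+1 y -> x = y.
Proof.
move=> s1 xk yk xy; have zk := flow_cell xk; have zk1 := flow_cell yk.
rewrite -xy in zk1; have z0 := cell_adjacent zk zk1.
have /andP[sg0 _] := s01.
have x0 : nu k.+1 x = 0.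
  move: z0; rewrite /flow /spt (nu_spt _ x) nu_end => z0.
  have [_ x1 _ _] := xk.
  have /andP[_ e1] := E_itv k (theta_itv xk).
  nra.
have y0 : nu k.+1 y = 0.
  move: z0; rewrite xy /flow /spt (nu_spt _ y) nu_start => z0.
  have [y1 _ _ _] := yk.
  have /andP[e0 _] := E_itv k.+1 (theta_itv yk).
  nra.
move: xy; rewrite flow_right // flow_left // /spt => /addIr /scalerI; apply.
by rewrite gt_eqF //; lra.
Qed.

Lemma flow_inj i j x y : s < 1 -> cell i x -> cell j y -> flow i x = flow j y -> x = y.
Proof.
move=> s1 xi yj xy; have [ij|ij] := pselect (i = j %[mod m]).
  apply: (@flow_inj_cell i) => //; first by rewrite -cell_mod ij cell_mod.
  by rewrite xy -flow_mod -ij flow_mod.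
have [iSj|iSj] := pselect (i.+1 = j %[mod m]).
  apply: (@flow_inj_adj i) => //; first by rewrite -cell_mod iSj cell_mod.
  by rewrite xy -flow_mod -iSj flow_mod.
have zi := flow_cell xi; have zj := flow_cell yj; rewrite -xy in zj.
have [jSi|jSi] := pselect (j.+1 = i %[mod m]); last by case: (cell_disjoint ij iSj jSi zi zj).
apply/esym/(@flow_inj_adj j) => //; first by rewrite -cell_mod jSi cell_mod.
by rewrite -xy -(flow_mod i) -jSi flow_mod.
Qed.

End Flow.

Definition tube : set V := [set x | exists k, cell k x].

Definition shadow (C : set V) k : set R := [set theta k x | x in C `&` cell k].

(** Representatives below [m] make the union finite, hence closed. *)
Definition others k : set V := \bigcup_(j in [set j | (j < m)%N /\ j <> k %[mod m]]) cell j.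

Lemma others_closed k : closed (others k).
Proof.
apply: closed_bigcup => [|j _]; last exact: cell_closed.
by apply: (@sub_finite_set _ _ `I_m) => // j [].
Qed.

Lemma others_end k x : cell k x -> others k x -> theta k x = 0 \/ theta k x = 1.
Proof. by move=> xk [j [_ jk] xj]; apply: cell_meet_end xk xj => // kj; apply: jk. Qed.

Lemma tube_split k x : tube x -> cell k x \/ others k x.
Proof.
move=> [j xj]; have [jk|jk] := pselect (j = k %[mod m]).
  by left; rewrite -cell_mod -jk cell_mod.
by right; exists (j %% m)%N; rewrite ?cell_mod //= ?modn_mod; split=> //; rewrite ltn_pmod //; lia.
Qed.

Lemma shadow_mod C k : shadow C (k %% m)%N = shadow C k.
Proof. by rewrite /shadow cell_mod theta_mod. Qed.

Lemma shadow_closed C k : compact C -> closed (shadow C k).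
Proof.
move=> cC; apply: (@compact_closed R); first exact: norm_hausdorff.
apply: continuous_compact; first exact/continuous_subspaceT/theta_continuous.
apply: compact_closedI => //; exact: cell_closed.
Qed.

(** If [t1] and [t3] are both missed, the part of [C] in the cell with [theta k] between them is
    closed and open in [C], hence all of [C]. But [C] also meets the next cell, and there [theta k]
    could only be 0 or 1, so [t1] or [t3] would be attained. *)
Lemma shadow_conv C k t1 t2 t3 : connected C -> C `<=` tube -> shadow C k.+1 !=set0 ->
  0 <= t1 -> t1 < t2 -> t2 < t3 -> t3 <= 1 -> shadow C k t2 ->
  shadow C k t1 \/ shadow C k t3.
Proof.
move=> connC Ct [_ [z [Cz zk1] _]] t10 t12 t23 t31 [x [Cx xk] xt].
apply: contrapT => /not_orP[N1 N3].
have kk1 : k <> k.+1 %[mod m] by move/esym; exact: mod_succ_neq.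
have ct : closed (cell k `&` theta k @^-1` [set t | t1 <= t <= t3]).
  apply: closedI; first exact: cell_closed.
  apply: closed_comp => [y _|]; first exact: theta_continuous.
  have -> : [set t | t1 <= t <= t3] = [set` `[t1, t3]].
    by apply/seteqP; split=> t /=; rewrite in_itv.
  exact: interval_closed.
have co : closed (others k `|` (cell k `&` (theta k @^-1` [set t | t <= t1] `|`
    theta k @^-1` [set t | t3 <= t]))).
  apply: closedU; first exact: others_closed.
  apply: closedI; first exact: cell_closed.
  apply: closedU; apply: closed_comp => [y _|]; try exact: theta_continuous.
    exact: closed_le.
  exact: closed_ge.
pose B := C `&` (cell k `&` theta k @^-1` [set t | t1 <= t <= t3]).
have BC : B = C.
  apply: connC.
  - by exists x; split=> //; split=> //=; rewrite xt; apply/andP; split; lra.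
  - exists (~` (others k `|` (cell k `&` (theta k @^-1` [set t | t <= t1] `|`
      theta k @^-1` [set t | t3 <= t])))); first exact: closed_openC.
    apply/seteqP; split=> y [Cy].
      move=> [yk /= /andP[y1 y3]]; split=> // -[yo|[_ /= [y1'|y3']]].
      + by case: (others_end yk yo) => y01;
          [apply: N1; exists y => //; lra | apply: N3; exists y => //; lra].
      + by apply: N1; exists y => //; lra.
      + by apply: N3; exists y => //; lra.
    move=> Ny; have [yk|yo] := @tube_split k y (Ct y Cy); last by case: Ny; left.
    split=> //; split=> //=; apply/andP; split; rewrite leNgt; apply/negP => /ltW h;
      by apply: Ny; right; split=> //; first [by left | by right].
  - by exists (cell k `&` theta k @^-1` [set t | t1 <= t <= t3]).
have [_ [zk /= /andP[z1 z3]]] : B z by rewrite BC.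
by case: (cell_meet_end kk1 zk zk1) => z01;
  [apply: N1; exists z => //; lra | apply: N3; exists z => //; lra].
Qed.

(** The other cells meet cell [k] only at end values of [theta k], so they stay away from its
    compact middle part. *)
Lemma tube_uniform e : 0 < e -> exists2 r, 0 < r & forall k x y, cell k x -> tube y ->
  e <= theta k x <= 1 - e -> `|x - y| < r -> cell k y /\ `|theta k x - theta k y| < e.
Proof.
move=> e0.
have H k : exists r, 0 < r /\ forall x y, (cell k `&` theta k @^-1` [set` `[e, 1 - e]]) x ->
    `|x - y| < r -> tube y -> cell k y /\ `|theta k x - theta k y| < e.
  have cC : compact (cell k `&` theta k @^-1` [set` `[e, 1 - e]]).
    apply: compact_closedI; first exact: cell_compact.
    by apply: closed_comp => [y _|]; [exact: theta_continuous | exact: interval_closed].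
  have [|r r0 rP] := @compact_uniform R V _
      (fun x y => tube y -> cell k y /\ `|theta k x - theta k y| < e) cC.
    move=> x [xk /= ]; rewrite in_itv /= => /andP[x0 x1].
    have Nx : (~` others k) x by move=> /(others_end xk)[]; lra.
    have n1 : \forall y \near x, (~` others k) y.
      by apply: open_nbhs_nbhs; split=> //; exact/closed_openC/others_closed.
    have n2 : \forall y \near x, `|theta k x - theta k y| < e / 2.
      by have /cvgrPdist_lt/(_ (e / 2)) := @theta_continuous k x; apply; lra.
    have : nbhs (x : V) ((~` others k) `&` [set y | `|theta k x - theta k y| < e / 2]) by exact: filterI.
    move/(@nbhs_normP _ V _ _) => [r /= r0 rP].
    exists r => // y z /rP[/= _ xy] /rP[/= Nz xz] tz.
    split; first by have [] := @tube_split k z tz.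
    by have := ler_distD (theta k x) (theta k y) (theta k z); rewrite (distrC _ (theta k x)); lra.
  by exists r; split=> // x y; exact: rP.
have /choice[r rP] := H.
pose r0 := \big[Num.min/1]_(k < m) r k.
exists r0; first by apply: lt_bigmin => // k _; have [] := rP k.
move=> k x y xk ty xe xy; have m0 : (0 < m)%N by lia.
pose k' := Ordinal (ltn_pmod k m0).
have r0k : r0 <= r k' by apply: bigmin_le_cond.
have [_ /(_ x y)] := rP k'; rewrite /= cell_mod theta_mod; apply => //; lra.
Qed.

Lemma gap_shadow_near e : 0 < e -> exists2 r, 0 < r & forall C D, hclose r C D ->
  C `<=` tube -> D `<=` tube -> forall k t, 0 <= t <= 1 ->
  `|gap (shadow C k) t - gap (shadow D k) t| <= e.
Proof.
move=> e0; have [|r r0 rP] := @tube_uniform (e / 2); first lra.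
have H C D : hclose r C D -> C `<=` tube -> D `<=` tube -> forall k t, 0 <= t <= 1 ->
    gap (shadow C k) t <= gap (shadow D k) t + 2 * (e / 2).
  move=> [_ DC] Ct Dt k t t01; apply: gap_stable => //; first lra.
  move=> c [y [Dy yk] <-] ye; have [x Cx xy] := DC y Dy.
  have [|xk xe] := rP k y x yk (Ct x Cx) ye; first by rewrite distrC.
  by exists (theta k x) => //; exists x.
exists r => // C D CD Ct Dt k t t01; rewrite ler_norml.
have := H C D CD Ct Dt k t t01; have := H D C (hclose_sym CD) Dt Ct k t t01.
by move=> ? ?; apply/andP; split; lra.
Qed.

Lemma tube_bounded : exists2 M, 0 <= M & forall x, tube x -> `|x| <= M.
Proof.
pose M := \big[Num.max/0]_(k < m) (eps + (`|v k.+1| + `|v k.+2|)).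
exists M; first exact: bigmax_ge_id.
move=> x [k]; rewrite -cell_mod => xk; apply: le_trans (cell_norm xk) _.
have m0 : (0 < m)%N by lia.
exact: (@le_bigmax_cond _ _ _ 0 (Ordinal (ltn_pmod k m0)) xpredT
  (fun k : 'I_m => eps + (`|v k.+1| + `|v k.+2|))).
Qed.

Lemma edge_tube k t : 0 <= t <= 1 -> tube (edge v k.+1 t).
Proof. by exists k; exact: cell_edge. Qed.

Lemma vertex_tube k : tube (v k.+1).
Proof. by rewrite -(edge0 v k.+1); apply: edge_tube; rewrite lexx ler01. Qed.

Lemma edge_vector_le k M : (forall x, tube x -> `|x| <= M) -> `|v k.+2 - v k.+1| <= 2 * M.
Proof.
move=> tM; have := ler_normB (v k.+2) (v k.+1).
have := tM _ (vertex_tube k); have := tM _ (vertex_tube k.+1); lra.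
Qed.

Lemma edge_diff k t u : edge v k t - edge v k u = (t - u) *: (v k.+1 - v k).
Proof. by rewrite !edgeE; apply/rowP => j; rewrite !mxE; ring. Qed.

(** A gap below 1/2 makes each shadow nonempty and keeps the denominator of [collapse] above 1/2. *)
Definition good C := C `<=` tube /\ forall k, gap (shadow C k) 1 < 2^-1.

(** Any cell containing [x] gives the same value, by [flow_agree]; see [pushE]. *)
Definition push C s x := flow (fun k => collapse (shadow C k)) s (xget 0%N [set k | cell k x]) x.

Section Push.
Context (C : set V).
Hypothesis gC : good C.

Let gap_lt k : gap (shadow C k) 1 < 1. Proof. by have [_ /(_ k)] := gC; lra. Qed.
Let E0 k : collapse (shadow C k) 0 = 0. Proof. exact: collapse0. Qed.
Let E1 k : collapse (shadow C k) 1 = 1. Proof. exact: collapse1. Qed.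
Let Ele k t u : 0 <= t -> t <= u -> u <= 1 ->
  collapse (shadow C k) t <= collapse (shadow C k) u.
Proof. exact: collapse_le. Qed.
Let Em k : collapse (shadow C (k + m)%N) = collapse (shadow C k).
Proof. by rewrite -shadow_mod modnDr shadow_mod. Qed.

Lemma pushE s k x : cell k x ->
  push C s x = spt x (edge v k.+1 (collapse (shadow C k) (theta k x))) s.
Proof.
move=> xk; have xk' : cell (xget 0%N [set k | cell k x]) x.
  by apply: (@xgetPex _ 0%N [set k | cell k x]); exists k.
exact: (@flow_agree (fun k => collapse (shadow C k)) s E0 E1 Em _ _ _ xk' xk).
Qed.

Lemma push_inj s : 0 <= s < 1 -> {in C &, injective (push C s)}.
Proof.
move=> /andP[s0 s1]; have s01 : 0 <= s <= 1 by apply/andP; split; lra.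
have [Ct _] := gC.
move=> x y; rewrite !inE => /Ct[i xi] /Ct[j yj]; rewrite (pushE _ xi) (pushE _ yj).
exact: (@flow_inj (fun k => collapse (shadow C k)) s E0 E1 Ele Em s01 _ _ _ _ s1 xi yj).
Qed.

Lemma collapse_itv k t : 0 <= t <= 1 -> 0 <= collapse (shadow C k) t <= 1.
Proof. exact: (@E_itv (fun k => collapse (shadow C k)) E0 E1 Ele). Qed.

Lemma push0 x : C x -> push C 0 x = x.
Proof. by have [Ct _] := gC; move=> /Ct[k xk]; rewrite (pushE _ xk) spt0. Qed.

Lemma push_continuous s : 0 <= s <= 1 -> {within tube, continuous (push C s)}.
Proof.
move=> s01; apply/subspace_continuousP => x tx; apply/cvgrPdist_le => e e0.
have [M M0 tM] := tube_bounded.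
have m0 : (0 < m)%N by lia.
have H (k : 'I_m) : \forall y \near x, cell k y -> `|push C s x - push C s y| <= e.
  have [xk|xk] := pselect (cell k x); last first.
    have : \forall y \near x, (~` cell k) y.
      by apply: open_nbhs_nbhs; split=> //; exact/closed_openC/cell_closed.
    by apply: filterS => y /= yk /yk.
  (* [collapse] has Lipschitz constant 2 and edge vectors have norm at most [2 * M], whence
     [4 * M]. *)
  pose d := e / (1 + 4 * M).
  have M1 : 0 < 1 + 4 * M by lra.
  have d0 : 0 < d by apply: divr_gt0.
  have n1 : \forall y \near x, `|x - y| < d.
    by have := @cvg_id _ (nbhs x); move/cvgrPdist_lt => /(_ d d0).
  have n2 : \forall y \near x, `|theta k x - theta k y| < d.
    by have /cvgrPdist_lt/(_ d d0) := @theta_continuous k x.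
  apply: filterS2 n1 n2 => y xy txy yk.
  rewrite (pushE _ xk) (pushE _ yk); set a := collapse _ _; set b := collapse _ _.
  have ab : `|a - b| <= 2 * `|theta k x - theta k y|.
    have [_ /(_ k) g1] := gC.
    have /andP[x0 x1] := theta_itv xk; have /andP[y0 y1] := theta_itv yk.
    rewrite /a /b; have [h|/ltW h] := leP (theta k x) (theta k y).
      have c1 := collapse_lip g1 x0 h; have c2 := collapse_le (gap_lt k) x0 h y1.
      by rewrite !ler0_norm; lra.
    have c1 := collapse_lip g1 y0 h; have c2 := collapse_le (gap_lt k) y0 h x1.
    by rewrite !ger0_norm; lra.
  have -> : spt x (edge v k.+1 a) s - spt y (edge v k.+1 b) s =
      (1 - s) *: (x - y) + s *: (edge v k.+1 a - edge v k.+1 b).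
    by apply/rowP => j; rewrite !mxE; ring.
  have wM := edge_vector_le k tM.
  apply: le_trans (ler_normD _ _) _; rewrite edge_diff !normrZ.
  have /andP[s0 s1] := s01; rewrite (ger0_norm s0) ger0_norm; last lra.
  have h1 : (1 - s) * `|x - y| <= 1 * d by apply: ler_pM => //; lra.
  have h2 : s * (`|a - b| * `|v k.+2 - v k.+1|) <= 1 * (2 * d * (2 * M)).
    have p0 : 0 <= `|a - b| * `|v k.+2 - v k.+1| by rewrite mulr_ge0.
    apply: (ler_pM s0 p0 s1); apply: ler_pM => //.
    by apply: le_trans ab _; lra.
  have -> : e = d * (1 + 4 * M) by rewrite /d divfK // gt_eqF.
  lra.
have : \forall y \near x, forall k : 'I_m, cell k y -> `|push C s x - push C s y| <= e.
  exact: (@filter_forall V 'I_m _ (nbhs x) (nbhs_filter x) H).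
apply: filterS => y Hy [k yk].
change (`|push C s x - push C s y| <= e).
by apply: (Hy (Ordinal (ltn_pmod k m0))); rewrite /= cell_mod.
Qed.

End Push.

Lemma good_conv C k t1 t2 t3 : connected C -> good C ->
  0 <= t1 -> t1 < t2 -> t2 < t3 -> t3 <= 1 -> shadow C k t2 ->
  shadow C k t1 \/ shadow C k t3.
Proof.
move=> cC [Ct gC]; apply: shadow_conv => //; apply/set0P/eqP => E.
have := @gap_empty R (shadow C k.+1); rewrite E => /(_ (fun c => id)).
by have := gC k.+1; rewrite E; lra.
Qed.

Lemma push1_image C : compact C -> connected C -> good C ->
  [set push C 1 x | x in C] = poly_set v.
Proof.
move=> cC connC gC; have [Ct g1] := gC; apply/seteqP; split=> [_ [x Cx <-]|y].
  have [k xk] := Ct x Cx; rewrite (pushE gC _ xk) spt1; exists k.+1 => //.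
  exists (collapse (shadow C k) (theta k x)) => //.
  by rewrite /= in_itv /=; apply: (collapse_itv gC); exact: theta_itv.
move=> /poly_edgeS[k [t [/andP[t0 /ltW t1] <-]]].
have t01 : 0 <= t <= 1 by apply/andP.
have g1' : gap (shadow C k.+1) 1 < 1 by have := g1 k.+1; lra.
have [u [[x [Cx xk] xu] _ ut]] := @collapse_surj R (shadow C k.+1)
  (fun t1 t2 t3 => @good_conv C k.+1 t1 t2 t3 connC gC) t (shadow_closed cC) g1' t01.
by exists x => //; rewrite (pushE gC _ xk) spt1 xu ut.
Qed.

(** Three affine formulas for [gap] times four for [blend] make twelve. *)
Lemma collapse_coefficients C k : connected C -> good C ->
  exists s : seq (R * R * R), size s = 12%N /\ forall x, cell k x ->
  exists2 c, c \in s & collapse (shadow C k) (theta k x) =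
    c.1.1 + c.1.2 * nu k x + c.2 * nu k.+1 x.
Proof.
move=> connC gC.
have [a [b gE]] := gap_cases (fun t1 t2 t3 => @good_conv C k t1 t2 t3 connC gC).
pose i := (1 - gap (shadow C k) 1)^-1.
exists [seq (p.1 + p.2 * q.1.1, p.2 * q.1.2, p.2 * q.2) |
  p <- [:: (0, i); (a * i, 0); (- (b - a) * i, i)],
  q <- [:: (0, 1, 0); (1, 0, 1); (- 3^-1, 2, 0); (3^-1, 0, 0)]]; split=> // x xk.
have [p pP pE] : exists2 p : R * R, p \in [:: (0, i); (a * i, 0); (- (b - a) * i, i)] &
    collapse (shadow C k) (theta k x) = p.1 + p.2 * theta k x.
  rewrite /collapse -/i; case: (gE _ (theta_itv xk)) => ->.
  - by exists (0, i); rewrite ?inE ?eqxx //=; ring.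
  - by exists (a * i, 0); rewrite ?inE ?eqxx ?orbT //=; ring.
  - by exists (- (b - a) * i, i); rewrite ?inE ?eqxx ?orbT //=; ring.
have [q qP qE] : exists2 q : R * R * R, q \in [:: (0, 1, 0); (1, 0, 1); (- 3^-1, 2, 0); (3^-1, 0, 0)] &
    theta k x = q.1.1 + q.1.2 * nu k x + q.2 * nu k.+1 x.
  rewrite /theta; case: (blend_cases (nu k x) (1 + nu k.+1 x)) => ->.
  - by exists (0, 1, 0); rewrite ?inE ?eqxx ?orbT //=; ring.
  - by exists (1, 0, 1); rewrite ?inE ?eqxx ?orbT //=; ring.
  - by exists (- 3^-1, 2, 0); rewrite ?inE ?eqxx ?orbT //=; ring.
  - by exists (3^-1, 0, 0); rewrite ?inE ?eqxx ?orbT //=; ring.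
exists (p.1 + p.2 * q.1.1, p.2 * q.1.2, p.2 * q.2).
  exact: (allpairs_f (fun p q => (p.1 + p.2 * q.1.1, p.2 * q.1.2, p.2 * q.2)) pP qP).
by rewrite pE qE /=; ring.
Qed.

(** Before time 1 the push is injective and follows finitely many affine maps, twelve for each cell;
    at time 1 the image is [P] itself. *)
Lemma push_image (P Q : @polygonal_curves R n) s : curve_set P = poly_set v -> good (curve_set Q) ->
  0 <= s <= 1 -> exists Q' : @polygonal_curves R n, curve_set Q' = [set push (curve_set Q) s x | x in curve_set Q].
Proof.
move=> PE gQ s01; have [_ cQ connQ] := curve_set_continuum Q; have [Qt _] := gQ.
have [s1|s1] := eqVneq s 1; first by exists P; rewrite s1 push1_image.
have s1' : 0 <= s < 1 by move: s01; rewrite lt_neqAle s1.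
have /choice[cs csP] k := @collapse_coefficients (curve_set Q) k connQ gQ.
pose cf (j : 'I_m * 'I_12) := nth (0, 0, 0) (cs j.1) j.2.
pose w (j : 'I_m * 'I_12) := v j.1.+2 - v j.1.+1.
apply: (@injective_image_polygonal R n ('I_m * 'I_12)%type Q _
  (fun j x => spt x (v j.1.+1 + ((cf j).1.1 + (cf j).1.2 * nu j.1 x + (cf j).2 * nu j.1.+1 x) *: w j) s)
  (fun j y => (1 - s) *: y + (s * ((cf j).1.2 * l j.1 y + (cf j).2 * l j.1.+1 y)) *: w j)).
- exact: continuous_subspaceW (push_continuous gQ s01).
- exact: push_inj.
- by move=> j x y t; rewrite !nuD /spt; apply/rowP => i; rewrite !mxE; ring.
- move=> x /Qt[k']; rewrite -cell_mod => xk.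
  have m0 : (0 < m)%N by lia.
  pose k := Ordinal (ltn_pmod k' m0).
  have [sz /(_ x xk)[c cc cE]] := csP (k' %% m)%N.
  have ic : (index c (cs (k' %% m)%N) < 12)%N by rewrite -sz index_mem.
  exists (k, Ordinal ic); rewrite (pushE gQ _ xk) cE /cf /= nth_index // edgeE.
  by [].
Qed.

(** The targets differ by at most [8 * d] times an edge vector of norm at most [2 * M], and a change
    of time moves a point by at most [2 * M] times that change. *)
Lemma push_near C D s t d M : good C -> good D -> 0 <= s <= 1 -> 0 <= t <= 1 ->
  (forall x, tube x -> `|x| <= M) ->
  (forall k u, 0 <= u <= 1 -> `|gap (shadow C k) u - gap (shadow D k) u| <= d) ->
  forall x, tube x -> `|push C s x - push D t x| <= 16 * M * d + 2 * M * `|s - t|.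
Proof.
move=> gC gD /andP[s0 s1] /andP[t0 t1] tM H x [k xk].
have t01 := theta_itv xk.
have M0 : 0 <= M by apply: le_trans (tM _ (vertex_tube 0)); exact: normr_ge0.
rewrite (pushE gC _ xk) (pushE gD _ xk).
set a := collapse _ _; set b := collapse _ _.
have ab : `|a - b| <= 8 * d.
  have [_ gC1] := gC; have [_ gD1] := gD.
  by apply: collapse_close => //; apply: H; rewrite // ler01 lexx.
have wM := edge_vector_le k tM.
have b01 : 0 <= b <= 1 by exact: collapse_itv.
have -> : spt x (edge v k.+1 a) s - spt x (edge v k.+1 b) t =
    s *: (edge v k.+1 a - edge v k.+1 b) + (s - t) *: (edge v k.+1 b - x).
  by apply/rowP => j; rewrite !mxE; ring.
have h1 : `|edge v k.+1 b - x| <= 2 * M.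
  have := ler_normB (edge v k.+1 b) x.
  have := tM _ (edge_tube k b01); have := tM x (ex_intro _ k xk); lra.
apply: le_trans (ler_normD _ _) _; rewrite edge_diff !normrZ (ger0_norm s0).
have p0 : 0 <= `|a - b| * `|v k.+2 - v k.+1| by rewrite mulr_ge0.
have h2 : s * (`|a - b| * `|v k.+2 - v k.+1|) <= 1 * (8 * d * (2 * M)).
  by apply: (ler_pM s0 p0 s1); apply: ler_pM.
have h3 : `|s - t| * `|edge v k.+1 b - x| <= `|s - t| * (2 * M).
  by apply: ler_wpM2l.
lra.
Qed.

Lemma shadow_poly k t : 0 <= t <= 1 -> shadow (poly_set v) k t.
Proof.
move=> t01; exists (edge v k.+1 t); last exact: theta_edge.
split; last exact: cell_edge.
by exists k.+1 => //; exists t; rewrite //= in_itv.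
Qed.

Lemma poly_tube : poly_set v `<=` tube.
Proof. by move=> x /cells_nbhs /nbhs_singleton. Qed.

Lemma good_poly : good (poly_set v).
Proof.
split; first exact: poly_tube.
move=> k; rewrite gap_full; [lra | by rewrite ler01 lexx | exact: shadow_poly].
Qed.

Lemma push_poly s x : poly_set v x -> push (poly_set v) s x = x.
Proof.
move=> /poly_edgeS[k [t [/andP[t0 /ltW t1] <-]]].
have t01 : 0 <= t <= 1 by apply/andP.
rewrite (pushE good_poly _ (cell_edge k.+1 t01)) theta_edge /collapse.
have gF u : 0 <= u <= 1 -> gap (shadow (poly_set v) k.+1) u = 0.
  by move=> u01; apply: gap_full => // c; exact: shadow_poly.
rewrite !gF ?ler01 ?lexx // !subr0 divr1 sptE subrr scaler0 addr0.
by [].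
Qed.

Lemma good_near : compact (poly_set v) ->
  exists2 r, 0 < r & forall D, hclose r (poly_set v) D -> good D.
Proof.
move=> cP; have [r1 r10 r1P] := @gap_shadow_near (4^-1) (ltac:(lra)).
have [r2 r20 r2P] := @compact_fattening R V _ (interior tube) cP (@open_interior _ _)
  (fun x Px => cells_nbhs Px).
have rr1 : Num.min r1 r2 <= r1 by rewrite ge_min lexx.
have rr2 : Num.min r1 r2 <= r2 by rewrite ge_min lexx orbT.
exists (Num.min r1 r2) => [|D PD]; first by rewrite lt_min r10.
have Dt : D `<=` tube.
  move=> y Dy; have [_ /(_ y Dy)[x Px xy]] := PD.
  by apply: interior_subset; apply: (r2P x) => //; exact: lt_le_trans xy rr2.
split=> // k; have i1 : 0 <= (1 : R) <= 1 by rewrite ler01 lexx.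
have := r1P _ _ (hclose_le rr1 PD) poly_tube Dt k 1 i1.
rewrite gap_full //; last by move=> c; exact: shadow_poly.
by rewrite sub0r normrN => /ler_normlP[_ ?]; lra.
Qed.

(** * The contraction of a neighbourhood of a polygon *)

Section Contraction.
Context (P : @polygonal_curves R n).
Hypothesis PE : curve_set P = poly_set v.

(** For [Q] that is not good there is no candidate and the default is [P]. This gives [contraction1]
    for all [Q], as [contracts_in] demands. *)
Definition contraction (Q : @polygonal_curves R n) (s : R) : @polygonal_curves R n :=
  xget P [set Q' | good (curve_set Q) /\
    curve_set Q' = [set push (curve_set Q) (clip01 s) x | x in curve_set Q]].

Lemma contractionE Q s : good (curve_set Q) ->
  curve_set (contraction Q s) = [set push (curve_set Q) (clip01 s) x | x in curve_set Q].
Proof.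
move=> gQ; have [Q' Q'E] := push_image PE gQ (clip01_itv s).
have [] // := @xgetPex _ P [set Q' | good (curve_set Q) /\
    curve_set Q' = [set push (curve_set Q) (clip01 s) x | x in curve_set Q]].
by exists Q'.
Qed.

Lemma contraction_clip Q s : contraction Q (clip01 s) = contraction Q s.
Proof. by rewrite /contraction (clip01_id (clip01_itv s)). Qed.

Lemma contraction0 Q : good (curve_set Q) -> contraction Q 0 = Q.
Proof.
move=> gQ; apply: curve_set_inj; rewrite contractionE // clip01_eq0 //.
apply/seteqP; split=> [_ [x Qx <-]|x Qx]; first by rewrite push0.
by exists x => //; rewrite push0.
Qed.

Lemma contraction1 Q : contraction Q 1 = P.
Proof.
have [gQ|gQ] := pselect (good (curve_set Q)); last by apply: xgetPN => Q' [].
apply: curve_set_inj; rewrite contractionE // clip01_eq1 // PE.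
by have [_ ? ?] := curve_set_continuum Q; exact: push1_image.
Qed.

Lemma contraction_center s : contraction P s = P.
Proof.
have gP : good (curve_set P) by rewrite PE; exact: good_poly.
apply: curve_set_inj; rewrite contractionE //.
have pP x : curve_set P x -> push (curve_set P) (clip01 s) x = x by rewrite PE; exact: push_poly.
by apply/seteqP; split=> [_ [x Px <-]|x Px]; [rewrite pP | exists x; rewrite ?pP].
Qed.

Lemma contraction_continuous Q0 s0 : (\forall Q \near Q0, good (curve_set Q)) ->
  {for (Q0, s0), continuous (fun p => contraction p.1 p.2)}.
Proof.
move=> gN U /nbhs_hyperspace_sub[r r0 rU].
have g0 : good (curve_set Q0) := nbhs_singleton gN; have [Qt0 _] := g0.
have [_ cQ0 _] := curve_set_continuum Q0.
set t0 := clip01 s0; have t01 : 0 <= t0 <= 1 := clip01_itv s0.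
have [G GE] : exists G, G = push (curve_set Q0) t0 by exists (push (curve_set Q0) t0).
have [M M0 tM] := tube_bounded.
have [|d d0 dP] := @compact_uniform R V _ (fun y z => tube y -> tube z ->
    `|G y - G z| <= r / 4) cQ0.
  move=> x /Qt0 tx; have /subspace_continuousP/(_ x tx)/cvgrPdist_le := push_continuous g0 t01.
  move=> /(_ (r / 8)); rewrite -GE => H.
  have : nbhs (x : V) [set y | tube y -> `|G x - G y| <= r / 8] by apply: H; lra.
  move/(@nbhs_normP _ V _ _) => [e /= e0 eP]; exists e => // y z xy xz ty tz.
  have := eP y xy ty; have := eP z xz tz; have := ler_distD (G x) (G y) (G z).
  by rewrite (distrC (G y) (G x)); lra.
have M1 : 0 < M + 1 by lra.
(* With gaps and times [e]-close, [push_near] gives at most [18 * M * e], below [r / 2]; the modulus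
   [d] of [G] adds [r / 4]. *)
pose e := r / (64 * (M + 1)).
have e0 : 0 < e by apply: divr_gt0 => //; lra.
have eE : 64 * (M + 1) * e = r.
  by rewrite /e mulrC divfK //; apply: lt0r_neq0; lra.
have [d' d'0 d'P] := gap_shadow_near e0.
have nQ : \forall Q \near Q0, good (curve_set Q) /\
    hclose (Num.min d d') (curve_set Q0) (curve_set Q).
  apply: filterI => //; apply/nbhs_hyperspace_sub.
  by exists (Num.min d d') => //; rewrite lt_min d0.
have ns : \forall s \near s0, `|t0 - clip01 s| < e.
  by have /cvgrPdist_lt/(_ e e0) := @clip01_continuous R s0.
exists ([set Q | good (curve_set Q) /\ hclose (Num.min d d') (curve_set Q0) (curve_set Q)],
  [set s | `|t0 - clip01 s| < e]) => //.
move=> [Q s] [/= [gQ QQ] ts]; apply: rU; rewrite -!/(curve_set _).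
change (hclose r (curve_set (contraction Q0 s0)) (curve_set (contraction Q s))).
have [Qt _] := gQ.
have dd : Num.min d d' <= d by rewrite ge_min lexx.
have dd' : Num.min d d' <= d' by rewrite ge_min lexx orbT.
have near_gap := d'P _ _ (hclose_le dd' QQ) Qt0 Qt.
have far x : tube x -> `|G x - push (curve_set Q) (clip01 s) x| <= r / 2.
  move=> tx; rewrite GE; apply: le_trans (push_near g0 gQ t01 (clip01_itv s) tM near_gap tx) _.
  have m1 : 2 * M * `|t0 - clip01 s| <= 2 * M * e by apply: ler_wpM2l; lra.
  by rewrite -/t0; lra.
have close x y : curve_set Q0 x -> curve_set Q y -> `|x - y| < Num.min d d' ->
    `|G x - push (curve_set Q) (clip01 s) y| < r.
  move=> Qx Qy xy; have ty := Qt y Qy; have := far y ty.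
  have := dP x y Qx (lt_le_trans xy dd) (Qt0 x Qx) ty.
  by have := ler_distD (G y) (G x) (push (curve_set Q) (clip01 s) y); lra.
rewrite (contractionE _ gQ) (contractionE _ g0) -/t0 -GE.
have [Q0Q QQ0] := QQ; split=> [_ [x Qx <-]|_ [y Qy <-]].
  have [y Qy xy] := Q0Q x Qx; exists (push (curve_set Q) (clip01 s) y); first by exists y.
  exact: close.
have [x Qx xy] := QQ0 y Qy; exists (G x); first by exists x.
exact: close.
Qed.

Lemma tube_contracts (U : set (@polygonal_curves R n)) : nbhs P U ->
  exists (W : set (@polygonal_curves R n)) (c : @polygonal_curves R n -> R -> @polygonal_curves R n),
    W P /\ contracts_in W U c P.
Proof.
move=> nU.
have gN : \forall Q \near P, good (curve_set Q).
  have [_ cP _] := curve_set_continuum P; move: cP; rewrite PE => /good_near[r r0 rP].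
  by apply/nbhs_hyperspace_sub; exists r => // D; rewrite -!/(curve_set _) PE; exact: rP.
pose T : set (@polygonal_curves R n) :=
  [set Q | good (curve_set Q) /\ forall s, s \in `[0, 1] -> U (contraction Q s)].
(* [P] is fixed at all times, so by compactness of [[0, 1]] the whole track of a nearby curve stays
   in [U]. *)
have nT : nbhs P T.
  apply: filterI => //.
  have /compact_near_coveringP/near_covering_withinP
    /(_ _ (nbhs P) (fun Q s => U (contraction Q s)) _) H := @segment_compact R 0 1.
  have {}H : \forall Q \near P, [set` `[0, 1]] `<=` (fun s => U (contraction Q s)).
    apply: H => s s01; have := @contraction_continuous P s gN U.
    rewrite /= contraction_center => /(_ nU) [[A B] /= [nA nB] AB].
    exists (B, A) => //= -[s' Q] [/= Bs AQ] _; exact: (AB (Q, s')).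
  by apply: filterS H => Q QU s; exact: QU.
exists T^°, contraction; split=> //; split.
- exact: open_interior.
- by move=> Q /interior_subset[gQ _]; exact: contraction0.
- exact: contraction1.
- move=> Q s /interior_subset[_ QU]; rewrite -contraction_clip; apply: QU.
  exact: clip01_in.
- move=> Q s QT; apply: contraction_continuous.
  have : nbhs Q T by exact: QT.
  by apply: filterS => Q' [].
Qed.

End Contraction.

End Tube.

Lemma polygonal_locally_contractible (R : realType) n :
  locally_contractible R (@polygonal_curves R n).
Proof.
move=> P U nU; have [m [v [cv PE]]] := corner_polygonP P.
have [l [lD lc lm l0 l1]] := corner_functionals cv.
have [[m3 vm _] _] := cv; have [eps eps0 sep] := polygon_separation cv.1.
have [W [c [WP cW]]] := tube_contracts m3 vm lD lc lm l0 l1 eps0 sep PE nU.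
by exists W, c, P.
Qed.

(** * Compact cells of polygons *)

Section RobustPolygons.
Context {R : realType} {n : nat}.
Local Notation V := 'rV[R]_n.
Implicit Types (v : nat -> V).

(* A quantitative, closed version of the conditions in corner_polygon. *)
Definition edges_separated m v (d : R) i j :=
  [/\ i <> j %[mod m] -> forall s t, 0 <= s <= 1 -> 0 <= t <= 1 ->
        d * Num.min s (1 - s) <= `|edge v i s - edge v j t|,
      i <> j %[mod m] -> d <= `|v i - v j|
    & forall c, d <= `|v i.+2 - v i.+1 - c *: (v i.+1 - v i)|].

Definition robust m v d := forall i j, edges_separated m v d i j.

(** For edges different modulo [m] the first clause forces both parameters to be 0, and the second
    clause separates the vertices. *)
Lemma robust_edge_eq m v d i j s t : 0 < d -> robust m v d -> 0 <= s < 1 -> 0 <= t < 1 ->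
  edge v i s = edge v j t -> i = j %[mod m].
Proof.
move=> d0 rv /andP[s0 s1] /andP[t0 t1] E; apply: contrapT => ij.
have s01 : 0 <= s <= 1 by apply/andP; split=> //; exact: ltW.
have t01 : 0 <= t <= 1 by apply/andP; split=> //; exact: ltW.
have H a b (x y : R) : a <> b %[mod m] -> 0 <= x < 1 -> 0 <= y <= 1 -> edge v a x = edge v b y -> x = 0.
  move=> ab /andP[x0 x1] y01 xy; have [+ _ _] := rv a b => /(_ ab x y _ y01).
  rewrite xy subrr normr0 pmulr_rle0 // => H; apply/eqP; rewrite eq_le x0 andbT.
  have : Num.min x (1 - x) <= 0 by apply: H; rewrite x0 ltW.
  by rewrite ge_min => /orP[//|]; lra.
have sE : s = 0 by apply: (H i j s t) => //; apply/andP.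
have tE : t = 0 by apply: (H j i t s) => //; [move=> /esym | apply/andP].
have [_ /(_ ij) + _] := rv i j.
by move: E; rewrite sE tE !edge0 => ->; rewrite subrr normr0; lra.
Qed.

Lemma robust_corner m v d : (3 <= m)%N -> (forall i, v (i + m)%N = v i) -> 0 < d ->
  robust m v d -> corner_polygon m v.
Proof.
move=> m3 vm d0 rv; split; first split=> // i j s t s01 t01 E.
  have ij := robust_edge_eq d0 rv s01 t01 E; split=> //.
  move: E; rewrite -(edge_mod i s vm) ij (edge_mod j s vm) => /spt_inj; apply.
  apply/eqP => E; have [_ + _] := rv j j.+1.
  move=> /(_ (fun e => mod_succ_neq m3 (esym e))).
  by rewrite E subrr normr0; lra.
move=> i c E; have [_ _ /(_ c)] := rv i i.
by rewrite E subrr normr0; lra.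
Qed.

Lemma edges_separated_le m v d d' i j : d' <= d -> edges_separated m v d i j -> edges_separated m v d' i j.
Proof.
move=> dd [H1 H2 H3]; split=> [ij s t s01 t01|ij|c].
- apply: le_trans (H1 ij s t s01 t01); apply: ler_wpM2r => //.
  by have /andP[? ?] := s01; rewrite le_min; apply/andP; split; lra.
- exact: le_trans dd (H2 ij).
- exact: le_trans dd (H3 c).
Qed.

Lemma edges_separated_mod m v d i j : (forall i, v (i + m)%N = v i) ->
  edges_separated m v d (i %% m)%N (j %% m)%N -> edges_separated m v d i j.
Proof.
move=> vm; rewrite /edges_separated !modn_mod !(period_mod _ vm).
have vSS : v (i %% m).+2 = v i.+2 := @period_modS _ (fun i => v i.+1) m i (fun i => vm i.+1).
rewrite vSS (period_modS _ vm) => -[H1 H2 H3]; split=> // ij s t s01 t01.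
by have := H1 ij s t s01 t01; rewrite !(edge_mod _ _ vm).
Qed.

(** Non-adjacent edges have a positive distance. For adjacent ones the functional at the common
    corner bounds the distance below by a multiple of [1 - s + t], which vanishes only at that
    corner and dominates the minimum in the first clause. *)
Lemma corner_edges_separated m v i j : corner_polygon m v ->
  exists d, 0 < d /\ edges_separated m v d i j.
Proof.
move=> [sv cv]; have [m3 vm inj] := sv.
have ne a b : a <> b %[mod m] -> v a != v b.
  move=> ab; apply/eqP => E; apply: ab.
  have [|||] := inj a b 0 0; rewrite ?edge0 ?lexx ?ltr01 //.
have wne k : v k.+1 - v k != 0 by rewrite subr_eq0; apply: ne; exact: mod_succ_neq.
have [d1 [d10 d1P]] : exists d, 0 < d /\ (i <> j %[mod m] -> forall s t, 0 <= s <= 1 -> 0 <= t <= 1 ->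
    d * Num.min s (1 - s) <= `|edge v i s - edge v j t|).
  have [ij|ij] := pselect (i = j %[mod m]); first by exists 1.
  have min_le (d x y s : R) : 0 < d -> 0 <= s <= 1 -> Num.min s (1 - s) <= x ->
      d * x <= y -> d * Num.min s (1 - s) <= y.
    by move=> d0 s01 sx; apply: le_trans; rewrite ler_pM2l.
  have adj k : exists2 d, 0 < d & forall s t, 0 <= s <= 1 -> 0 <= t <= 1 ->
      d * (1 - s + t) <= `|edge v k s - edge v k.+1 t|.
    have [l [lD _ l0 l1 [L L0 lL]]] := dual_functional (wne k) (cv k).
    exists L^-1 => [|s t /andP[? ?] /andP[? ?]]; first by rewrite invr_gt0.
    rewrite ler_pdivrMl //; apply: le_trans (lL _).
    have -> : edge v k s - edge v k.+1 t =
        0 + (s - 1) *: (v k.+1 - v k) + (- t) *: (v k.+2 - v k.+1).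
      by rewrite !edgeE; apply/rowP => c; rewrite !mxE; ring.
    have l_0 : l 0 = 0 by have := lD 0 0 1; rewrite scale1r addr0 mul1r; lra.
    by rewrite !lD l_0 l0 l1 ler0_norm; lra.
  have [iSj|iSj] := pselect (i.+1 = j %[mod m]).
    have [d d0 dP] := adj i; exists d; split=> // _ s t s01 t01.
    apply: (min_le _ (1 - s + t)) => //.
      by have /andP[? _] := t01; rewrite ge_min; apply/orP; right; lra.
    by have := dP s t s01 t01; rewrite -(edge_mod i.+1 t vm) iSj (edge_mod j t vm).
  have [jSi|jSi] := pselect (j.+1 = i %[mod m]).
    have [d d0 dP] := adj j; exists d; split=> // _ s t s01 t01.
    apply: (min_le _ (1 - t + s)) => //.
      by have /andP[_ ?] := t01; rewrite ge_min; apply/orP; left; lra.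
    by have := dP t s t01 s01; rewrite distrC -(edge_mod j.+1 s vm) jSi (edge_mod i s vm).
  have [|r r0 rP] := @edges_apart R n v i j; first by move=> s t; exact: edges_disjoint sv ij iSj jSi.
  exists r; split=> // _ s t s01 t01; apply: le_trans (rP s t s01 t01).
  rewrite ger_pMr //; have /andP[? ?] := s01.
  by rewrite ge_min; apply/orP; left.
have [d2 [d20 d2P]] : exists d, 0 < d /\ (i <> j %[mod m] -> d <= `|v i - v j|).
  have [ij|ij] := pselect (i = j %[mod m]); first by exists 1.
  by exists `|v i - v j|; split=> //; rewrite normr_gt0 subr_eq0; exact: ne.
have [d3 [d30 d3P]] : exists d, 0 < d /\ forall c, d <= `|v i.+2 - v i.+1 - c *: (v i.+1 - v i)|.
  have : nbhs (v i.+2 - v i.+1 : V) (~` line 0 (v i.+1 - v i)).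
    apply: open_nbhs_nbhs; split; first exact/closed_openC/line_closed.
    by move=> [c _]; rewrite add0r => /esym; exact: cv.
  move/(@nbhs_normP _ V _ _) => [r /= r0 rP]; exists r; split=> // c.
  rewrite leNgt; apply/negP => /rP; apply.
  by exists c; rewrite ?add0r.
pose d := Num.min d1 (Num.min d2 d3).
have dd1 : d <= d1 by rewrite ge_min lexx.
have dd2 : d <= d2 by rewrite /d !ge_min lexx orbT.
have dd3 : d <= d3 by rewrite /d !ge_min lexx !orbT.
exists d; split; first by rewrite !lt_min d10 d20.
split=> [ij s t s01 t01|ij|c].
- apply: le_trans (d1P ij s t s01 t01); apply: ler_wpM2r => //.
  by have /andP[? ?] := s01; rewrite le_min; apply/andP; split; lra.
- exact: le_trans dd2 (d2P ij).
- exact: le_trans dd3 (d3P c).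
Qed.

Lemma corner_robust m v : corner_polygon m v -> exists2 d, 0 < d & robust m v d.
Proof.
move=> cv; have [[m3 vm _] _] := cv; have m0 : (0 < m)%N by lia.
have /choice[r rP] : forall ij : 'I_m * 'I_m, exists d, 0 < d /\ edges_separated m v d ij.1 ij.2.
  by move=> [i j]; exact: corner_edges_separated.
exists (\big[Num.min/1]_ij r ij) => [|i j].
  by apply: lt_bigmin => // ij _; have [] := rP ij.
apply: edges_separated_mod => //.
pose ij := (Ordinal (ltn_pmod i m0), Ordinal (ltn_pmod j m0)).
have [_] := rP ij; apply: edges_separated_le; exact: bigmin_le_cond.
Qed.

Lemma robust_near_edge m v d j t y : (forall i, v (i + m)%N = v i) -> 0 < d -> robust m v d ->
  0 <= t <= 1 -> poly_set v y -> `|edge v j t - y| < d * Num.min t (1 - t) ->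
  line (v j) (v j.+1 - v j) y.
Proof.
move=> vm d0 rv t01 /poly_setP[i [s [/andP[s0 s1] <-]]] H.
have [ij|ij] := pselect (j = i %[mod m]).
  rewrite -(edge_mod i s vm) -ij (edge_mod j s vm).
  by exists s; rewrite // -edgeE.
have [+ _ _] := rv j i => /(_ ij t s t01); rewrite s0 (ltW s1) => /(_ isT).
by rewrite leNgt H.
Qed.

(** The corner and one point close to it on each of its edges would lie on a line, making the edge
    vectors proportional; [e] is chosen to bring both points into the ball. *)
Lemma corner_vertex m v k p d (r : R) : corner_polygon m v -> 0 < r ->
  (forall y, poly_set v y -> `|v k.+1 - y| < r -> line p d y) -> False.
Proof.
move=> [[m3 vm inj] cv] r0 H.
set w := v k.+1 - v k; set w' := v k.+2 - v k.+1.
pose e := Num.min 2^-1 (r / (1 + `|w| + `|w'|) / 2).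
have q0 : 0 < 1 + `|w| + `|w'| by have := normr_ge0 w; have := normr_ge0 w'; lra.
have rq : 0 < r / (1 + `|w| + `|w'|) by exact: divr_gt0.
have e0 : 0 < e by rewrite lt_min; apply/andP; split; lra.
have e1 : e <= 2^-1 by rewrite ge_min lexx.
have er : e * (1 + `|w| + `|w'|) < r.
  rewrite -ltr_pdivlMr //; apply: le_lt_trans (_ : _ <= r / (1 + `|w| + `|w'|) / 2) _.
    by rewrite ge_min lexx orbT.
  lra.
have ew : e * `|w| < r by have := normr_ge0 w'; nra.
have ew' : e * `|w'| < r by have := normr_ge0 w; nra.
have [a _ aE] : line p d (v k.+1 + e *: w').
  apply: H; last by rewrite opprD addNKr normrN normrZ gtr0_norm.
  by apply/poly_setP; exists k.+1, e; rewrite edgeE; split=> //; apply/andP; split; lra.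
have [b _ bE] : line p d (v k.+1 - e *: w).
  apply: H; last by rewrite opprB addrC subrK normrZ gtr0_norm.
  apply/poly_setP; exists k, (1 - e); rewrite edgeE; split; first by apply/andP; split; lra.
  by rewrite /w; apply/rowP => c; rewrite !mxE; ring.
have [c _ cE] : line p d (v k.+1).
  apply: H; last by rewrite subrr normr0.
  by apply/poly_setP; exists k.+1, 0; rewrite edge0 lexx ltr01.
have w'E : e *: w' = (a - c) *: d.
  by rewrite scalerBl; apply: (addrI (v k.+1)); rewrite -aE -[in RHS]cE; apply/rowP => i; rewrite !mxE; ring.
have wE : e *: w = (c - b) *: d.
  apply: (addrI (- v k.+1)); apply: oppr_inj; rewrite opprD opprK -bE -[in RHS]cE.
  by apply/rowP => i; rewrite !mxE; ring.
have [cb|cb] := eqVneq (c - b) 0.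
  move: wE; rewrite cb scale0r => /eqP; rewrite scaler_eq0 gt_eqF //= subr_eq0 => /eqP E.
  have [|||] := inj k.+1 k 0 0; rewrite ?edge0 ?lexx ?ltr01 //.
  by move/(mod_succ_neq m3).
apply: (cv k ((a - c) / (c - b))).
rewrite -/w -/w'; apply: (scalerI (lt0r_neq0 e0)).
by rewrite w'E scalerA mulrC -scalerA wE scalerA divfK.
Qed.

(** A corner of [v] inside an edge of [v'] would have a neighbourhood in which the curve is
    straight, by [robust_near_edge], against [corner_vertex]. *)
Lemma robust_vertices m v m' v' d i : corner_polygon m v -> (forall i, v' (i + m')%N = v' i) ->
  0 < d -> robust m' v' d -> poly_set v = poly_set v' -> exists j, v i.+1 = v' j.
Proof.
move=> cv vm' d0 rv' vv'.
have : poly_set v' (v i.+1).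
  by rewrite -vv'; apply/poly_setP; exists i.+1, 0; rewrite edge0 lexx ltr01.
move=> /poly_setP[j [t [/andP[t0 t1] tE]]].
have [t00|tn0] := eqVneq t 0; first by exists j; rewrite -tE t00 edge0.
have tp : 0 < Num.min t (1 - t).
  by rewrite lt_min lt_neqAle eq_sym tn0 t0 /=; lra.
exfalso; apply: (@corner_vertex m v i (v' j) (v' j.+1 - v' j) (d * Num.min t (1 - t)) cv).
  exact: mulr_gt0.
move=> y; rewrite vv' -tE => Py; apply: (robust_near_edge vm' d0 rv') => //.
by rewrite t0 ltW.
Qed.

End RobustPolygons.

Lemma closed_forall (T : topologicalType) (I : Type) (P : I -> set T) :
  (forall i, closed (P i)) -> closed [set u | forall i, P i u].
Proof.
move=> cP; have -> : [set u | forall i, P i u] = \bigcap_i P i.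
  by apply/seteqP; split=> u Pu // i; exact: Pu.
by apply: closed_bigI => i _; exact: cP.
Qed.

Lemma closed_norm_ge (R : realType) (T : topologicalType) (V : normedModType R) (f : T -> V) (c : R) :
  continuous f -> closed [set u | c <= `|f u|].
Proof.
move=> cf; apply: (@closed_comp _ _ (fun u => `|f u|) [set t | c <= t]); last exact: closed_ge.
by move=> u _; apply: (@continuous_comp _ _ _ f); [exact: cf | exact: norm_continuous].
Qed.

(** The index [i0] serves the numbers that encode no index. *)
Lemma has_compact_cells_countable (R : realType) (X : topologicalType) (I : countType) (i0 : I)
    (N : I -> nat) (K : forall i, set 'rV[R]_(N i)) (psi : forall i, 'rV[R]_(N i) -> X) :
  (forall i, compact (K i)) -> (forall i, {within K i, continuous (psi i)}) ->
  (forall i, {in K i &, injective (psi i)}) ->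
  \bigcup_i [set psi i x | x in K i] = setT -> has_compact_cells R X.
Proof.
move=> cK cpsi ipsi KT; pose g j := odflt i0 (unpickle j : option I).
exists (fun j => N (g j)), (fun j => K (g j)), (fun j => psi (g j)); split=> //.
apply/seteqP; split=> // x _; have : (\bigcup_i [set psi i x | x in K i]) x by rewrite KT.
move=> [i _ xi]; exists (pickle i) => //.
by rewrite /g pickleK.
Qed.

Lemma rational_approximation (R : realType) N (u : 'rV[R]_N) (e : R) : 0 < e ->
  exists q : 'rV[rat]_N, `|u - map_mx ratr q| <= e.
Proof.
move=> e0; have /choice[q qP] : forall i, exists q : rat, ratr q \in `]u ord0 i, u ord0 i + e[.
  by move=> i; apply: rat_in_itvoo; lra.
exists (\row_i q i); apply: ler_norm_coord; first exact: ltW.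
move=> i j; rewrite !mxE (ord1 i); have := qP j; rewrite in_itv /= => /andP[q1 q2].
by rewrite ler_norml; apply/andP; split; lra.
Qed.

(** * Euclidean coordinates for polygons *)

Section Cells.
Context {R : realType} {n : nat} (Q0 : @polygonal_curves R n).
Local Notation V := 'rV[R]_n.

Definition vertices m (u : 'rV[R]_(m.+3 * n)) (i : nat) : V :=
  \row_c u ord0 (mxvec_index (inord (i %% m.+3) : 'I_m.+3) c).

Lemma vertices_period m (u : 'rV[R]_(m.+3 * n)) i : vertices u (i + m.+3) = vertices u i.
Proof. by rewrite /vertices modnDr. Qed.

Lemma vertices_surj m v : (forall i, v (i + m.+3)%N = v i) -> exists u, @vertices m u = v.
Proof.
move=> vm; exists (mxvec (\matrix_(i, c) v i ord0 c)); apply/funext => i.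
by apply/rowP => c; rewrite mxE mxvecE mxE inordK ?ltn_pmod // (period_mod _ vm).
Qed.

(** Successors are compared because [robust_vertices] speaks of [v i.+1]; periodicity recovers
    vertex 0. *)
Lemma vertices_inj m (u u' : 'rV[R]_(m.+3 * n)) : (forall i, vertices u i.+1 = vertices u' i.+1) -> u = u'.
Proof.
move=> E; apply/rowP => k; case/mxvec_indexP: k => i c.
have := E (i + m.+2)%N; rewrite -addnS !vertices_period => /rowP/(_ c).
by rewrite !mxE modn_small // inord_val.
Qed.

Lemma vertices_continuous m i : continuous (fun u : 'rV[R]_(m.+3 * n) => vertices u i).
Proof.
move=> u; apply: matrix_continuous => a b; rewrite /vertices.
have -> : (fun s : 'rV[R]_(m.+3 * n) => (\row_c s ord0 (mxvec_index (inord (i %% m.+3) : 'I_m.+3) c)) a b) =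
    (fun s => s ord0 (mxvec_index (inord (i %% m.+3) : 'I_m.+3) b)).
  by apply/funext => s; rewrite mxE.
exact: coord_continuous.
Qed.

Lemma vertices_dist m (u u' : 'rV[R]_(m.+3 * n)) i : `|vertices u i - vertices u' i| <= `|u - u'|.
Proof.
apply: ler_norm_coord => // a b; rewrite !mxE.
have := ler_coord_norm (u - u') ord0 (mxvec_index (inord (i %% m.+3) : 'I_m.+3) b).
by rewrite !mxE.
Qed.

(** For fixed parameters each clause is a non-strict lower bound on the norm of a continuous
    function of [u]; robustness is an intersection of such closed conditions. *)
Lemma robust_closed m d : closed [set u : 'rV[R]_(m.+3 * n) | robust m.+3 (vertices u) d].
Proof.
pose U := 'rV[R]_(m.+3 * n).
have cE i s : continuous (fun u : 'rV[R]_(m.+3 * n) => edge (vertices u) i s).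
  move=> u; rewrite /edge /spt.
  by apply: (@cont_add R V U); apply: (@cont_scale R V U); try exact: cont_cst; exact: vertices_continuous.
apply: closed_forall => i; apply: closed_forall => j.
have E : [set u : 'rV[R]_(m.+3 * n) | edges_separated m.+3 (vertices u) d i j] =
  [set u | forall (H : i <> j %[mod m.+3]) s t (s01 : 0 <= s <= 1) (t01 : 0 <= t <= 1),
     d * Num.min s (1 - s) <= `|edge (vertices u) i s - edge (vertices u) j t|] `&`
  ([set u | forall H : i <> j %[mod m.+3], d <= `|vertices u i - vertices u j|] `&`
   [set u | forall c, d <= `|vertices u i.+2 - vertices u i.+1 - c *: (vertices u i.+1 - vertices u i)|]).
  by apply/seteqP; split=> u => [[]|[? []]].
change (closed [set u : 'rV[R]_(m.+3 * n) | edges_separated m.+3 (vertices u) d i j]); rewrite E.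
apply: closedI; [|apply: closedI].
- do 5 apply: closed_forall => ?.
  by apply: closed_norm_ge => u; apply: (@cont_sub R V U); exact: cE.
- apply: closed_forall => _; apply: closed_norm_ge => u.
  by apply: (@cont_sub R V U); exact: vertices_continuous.
- apply: closed_forall => c; apply: closed_norm_ge => u.
  apply: (@cont_sub R V U); first by apply: (@cont_sub R V U); exact: vertices_continuous.
  apply: (@cont_scale R V U); first exact: cont_cst.
  by apply: (@cont_sub R V U); exact: vertices_continuous.
Qed.

(* An index records the number of vertices (minus three), a robustness
   constant 1 / (k + 1), and a rational point near the vertices. *)
Definition cell_index : countType := {m : nat & (nat * 'rV[rat]_(m.+3 * n))%type}.

Definition cell_dim (a : cell_index) := ((tag a).+3 * n)%N.

Definition cell_const (a : cell_index) : R := (tagged a).1.+1%:R^-1.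

Definition polygon_cell (a : cell_index) : set 'rV[R]_(cell_dim a) :=
  [set u | robust (tag a).+3 (@vertices (tag a) u) (cell_const a) /\
           `|u - map_mx ratr (tagged a).2| <= cell_const a / 4].

Arguments polygon_cell a u : clear implicits.

Definition cell_curve (a : cell_index) (u : 'rV[R]_(cell_dim a)) : @polygonal_curves R n :=
  xget Q0 [set Q | curve_set Q = poly_set (@vertices (tag a) u)].

Lemma cell_const_gt0 a : 0 < cell_const a.
Proof. by rewrite invr_gt0 ltr0n. Qed.

Lemma polygon_cell_corner a u : polygon_cell a u -> corner_polygon (tag a).+3 (@vertices (tag a) u).
Proof.
by move=> [ru _]; apply: (robust_corner _ _ (cell_const_gt0 a) ru) => // i; exact: vertices_period.
Qed.

Lemma cell_curveE a u : polygon_cell a u -> curve_set (cell_curve u) = poly_set (@vertices (tag a) u).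
Proof.
move=> /polygon_cell_corner[sv _]; have [Q QE] := polygon_curve sv.
by apply: (@xgetPex _ Q0 [set Q | curve_set Q = poly_set (@vertices (tag a) u)]); exists Q.
Qed.

Lemma polygon_cell_compact a : compact (polygon_cell a).
Proof.
apply: bounded_closed_compact.
  exists (cell_const a / 4 + `|map_mx ratr (tagged a).2 : 'rV[R]_(cell_dim a)|).
  split; first exact: num_real.
  move=> M MM u [_ uq]; have := ler_normD (u - map_mx ratr (tagged a).2) (map_mx ratr (tagged a).2).
  by rewrite subrK => h; apply: le_trans h _; lra.
apply: closedI; first exact: robust_closed.
apply: (@closed_comp _ _ (fun u : 'rV[R]_(cell_dim a) => `|u - map_mx ratr (tagged a).2|)
  [set t | t <= cell_const a / 4]); last exact: closed_le.
move=> u _; apply: (@continuous_comp _ _ _ (fun u : 'rV[R]_(cell_dim a) => u - map_mx ratr (tagged a).2)).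
  apply: (@cont_sub R 'rV[R]_(cell_dim a) 'rV[R]_(cell_dim a)); first exact: cvg_id.
  exact: cont_cst.
exact: norm_continuous.
Qed.

(** Vertex [i.+1] of [u] is some vertex [j] of [u']. Through the rational point it is within half of
    [cell_const a] of vertex [i.+1] of [u'], while different vertices of [u'] are at least
    [cell_const a] apart. *)
Lemma cell_curve_inj a : {in polygon_cell a &, injective (@cell_curve a)}.
Proof.
move=> u u'; rewrite !inE => Ku Ku' E.
have cu := polygon_cell_corner Ku; have [ru' uq'] := Ku'; have [ru uq] := Ku.
have PP : poly_set (@vertices (tag a) u) = poly_set (@vertices (tag a) u').
  by rewrite -!cell_curveE // E.
apply: (@vertices_inj (tag a)) => i.
have [j ij] := robust_vertices i cu (vertices_period (m := tag a) u') (cell_const_gt0 a) ru' PP.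
rewrite ij; have [jE|jE] := pselect (j = i.+1 %[mod (tag a).+3]).
  rewrite -(period_mod j (vertices_period (m := tag a) u')) jE.
  by rewrite (period_mod _ (vertices_period (m := tag a) u')).
exfalso; have [_ /(_ jE) + _] := ru' j i.+1; rewrite -ij; clear ij.
have d1 := vertices_dist (u : 'rV[R]_((tag a).+3 * n)) (map_mx ratr (tagged a).2) i.+1.
have d2 := vertices_dist (u' : 'rV[R]_((tag a).+3 * n)) (map_mx ratr (tagged a).2) i.+1.
have := ler_distD (vertices (map_mx ratr (tagged a).2 : 'rV[R]_((tag a).+3 * n)) i.+1)
  (@vertices (tag a) u i.+1) (@vertices (tag a) u' i.+1).
rewrite (distrC (vertices (map_mx _ _) _)).
have := cell_const_gt0 a; lra.
Qed.

Lemma cell_curve_continuous a : {within polygon_cell a, continuous (@cell_curve a)}.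
Proof.
apply/subspace_continuousP => u Ku W /nbhs_hyperspace_sub[r r0 rW].
have : nbhs (u : 'rV[R]_(cell_dim a)) [set u' | `|u - u'| < r].
  by apply/(@nbhs_normP _ 'rV[R]_(cell_dim a) _ _); exists r.
apply: filterS => u' /= uu' Ku'; apply: rW; rewrite -!/(curve_set _).
rewrite (cell_curveE Ku) (cell_curveE Ku').
have H (x y : 'rV[R]_((tag a).+3 * n)) i s : 0 <= s < 1 -> `|x - y| < r ->
    `|edge (vertices x) i s - edge (vertices y) i s| < r.
  move=> /andP[s0 s1] xy; apply: le_lt_trans xy.
  have -> : edge (vertices x) i s - edge (vertices y) i s =
      (1 - s) *: (vertices x i - vertices y i) + s *: (vertices x i.+1 - vertices y i.+1).
    by apply/rowP => c; rewrite !mxE; ring.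
  apply: le_trans (ler_normD _ _) _; rewrite !normrZ (ger0_norm s0) ger0_norm; last lra.
  have := vertices_dist x y i; have := vertices_dist x y i.+1.
  move: `|_| `|_| `|_| => p q q' ? ?; nra.
split=> [_ /poly_setP[i [s [s01 <-]]]|_ /poly_setP[i [s [s01 <-]]]].
  exists (edge (@vertices (tag a) u') i s); last exact: H.
  by apply/poly_setP; exists i, s.
exists (edge (@vertices (tag a) u) i s); last exact: H.
by apply/poly_setP; exists i, s.
Qed.

Lemma cell_curve_cover : \bigcup_a [set cell_curve u | u in polygon_cell a] = setT.
Proof.
apply/seteqP; split=> // Q _; have [m [v [cv QE]]] := corner_polygonP Q.
have [[m3 vm _] _] := cv; have [d d0 rv] := corner_robust cv.
case: m m3 cv vm rv => [|[|[|m]]] // _ cv vm rv.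
have [u uv] := vertices_surj vm.
pose k := Num.bound d^-1; pose c : R := k.+1%:R^-1.
have c0 : 0 < c by rewrite invr_gt0 ltr0n.
have cd : c <= d.
  rewrite -[leRHS]invrK lef_pV2 ?posrE ?ltr0n ?invr_gt0 //.
  apply: le_trans (_ : k%:R <= _); last by rewrite ler_nat.
  by apply/ltW/archi_boundP; rewrite invr_ge0 ltW.
have [q qu] := @rational_approximation R _ u (c / 4) (ltac:(lra)).
pose a : cell_index := existT _ m (k, q).
have Ku : polygon_cell a u.
  by split=> //; rewrite /= uv => i j; apply: edges_separated_le (rv i j).
exists a => //; exists u => //; apply: curve_set_inj.
by rewrite (cell_curveE Ku) QE -uv.
Qed.

Lemma polygonal_compact_cells : has_compact_cells R (@polygonal_curves R n).
Proof.
have a0 : cell_index by exists 0; split; [exact: 0%N | exact: 0].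
exact: (has_compact_cells_countable a0 polygon_cell_compact cell_curve_continuous
  cell_curve_inj cell_curve_cover).
Qed.

End Cells.

Theorem theorem4p2 (R : realType) :
  [/\ sigma_compact (simple_closed_polygons R),
      strongly_countable_dimensional (simple_closed_polygons R)
    & absolute_neighborhood_retract R (simple_closed_polygons R)] /\
  [/\ sigma_compact (polygonal_knots R),
      strongly_countable_dimensional (polygonal_knots R)
    & absolute_neighborhood_retract R (polygonal_knots R)].
Proof.
have H n : [/\ sigma_compact (@polygonal_curves R n),
    strongly_countable_dimensional (@polygonal_curves R n)
  & absolute_neighborhood_retract R (@polygonal_curves R n)].
  apply: compact_cells_ANR.
  - exact: hyperspace_metrizable.
  - exact: polygonal_compact_cells.
  - exact: polygonal_locally_contractible.
by split; exact: H.
Qed.
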